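(* Let $\mu\in P_2(\mathbb{R}^d)$ and $\nu\in P_2(\mathbb{R}^d)$ absolutely continuous with respect to Lebesgue measure. Let $\varphi\in\mathcal{A}_{cx}\cap C_{b,2}$ be an optimizer of $$\mathcal{D}_2(\mathrm{P}^{cx}_{2,\mu\le},\nu)=\sup_{g\in\mathcal{A}_{cx}\cap\mathrm{S}_{b,2}}\Big\{\int g\,d\mu-\int Q_{\bar2}(g)\,d\nu\Big\},$$ and put $\bar\varphi_0(x)=\frac12|x|^2-\frac12\varphi(x)$. Then (i) $\bar\varphi_0^*$ is a convex expansion and is uniformly convex; (ii) $(\nabla\bar\varphi_0^* )_\#\nu$ is the unique minimizer of $\mathcal{T}_2(\cdot,\nu)$ over $\mathrm{P}^{cx}_{2,\mu\le}$.
   Context: $\mu\le_{cx}\xi$: $\int\varphi\,d\mu\le\int\varphi\,d\xi$ for all real-valued convex $\varphi$ with both integrals existing in the extended sense. $\mathcal{A}_{cx}$: proper lsc convex functions on $\mathbb{R}^d$. $\mathrm{P}^{cx}_{2,\mu\le}=\{\xi\in P_2(\mathbb{R}^d):\mu\le_{cx}\xi\}$. $C_{b,2}$ (resp. $\mathrm{S}_{b,2}$): continuous (resp. measurable) $u$ with $\sup|u(x)|/(1+|x|^2)<\infty$. $Q_{\bar2}(g)(y)=\sup_x\{g(x)-|x-y|^2\}$. $\mathcal{T}_2(\xi,\nu)=\inf_{\pi\in\Pi(\xi,\nu)}\int|x-y|^2d\pi$. $g^*(y)=\sup_x\{x\cdot y-g(x)\}$ is the Legendre transform. A proper lsc convex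 $\psi$ is a convex expansion if $\psi=\phi^*$ for some proper $\phi$ with $D^2\phi\le \mathrm{Id}$ in the sense of distributions (equivalently $D^2\psi\ge\mathrm{Id}$). *)

(* Defs.v *)
(* R^d is modelled as [d.-tuple R], which carries the
   product (= Borel) sigma-algebra of MathComp-Analysis. *)
From HB Require Import structures.
From mathcomp Require Import all_boot all_order all_algebra.
From mathcomp Require Import all_classical all_reals all_analysis.
Import Order.TTheory GRing.Theory Num.Theory.
Set Implicit Arguments.
Unset Strict Implicit.
Unset Printing Implicit Defensive.
Local Open Scope classical_set_scope.
Local Open Scope ring_scope.

Section OTDefs.
Context {R : realType} {d : nat}.
Local Notation E := (d.-tuple R).

Definition tadd (x y : E) : E := [tuple tnth x i + tnth y i | i < d].
Definition tsub (x y : E) : E := [tuple tnth x i - tnth y i | i < d].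
Definition tscale (a : R) (x : E) : E := [tuple a * tnth x i | i < d].
Definition dotp (x y : E) : R := \sum_(i < d) tnth x i * tnth y i.
Definition sqn (x : E) : R := dotp x x.
Definition tbasis (i : 'I_d) : E := [tuple (i == j)%:R | j < d].
Definition seg (x y : E) (t : R) : E := tadd (tscale (1 - t) x) (tscale t y).

(* Lebesgue measure on R^d: characterized by its values on boxes
   (this determines the measure uniquely on Borel sets). *)
Definition is_lebesgue (leb : {measure set E -> \bar R}) : Prop :=
  forall a b : E, (forall i, tnth a i <= tnth b i) ->
    leb [set x | forall i, tnth a i < tnth x i <= tnth b i] =
    (\prod_(i < d) (tnth b i - tnth a i))%:E.

Definition abs_cont (leb : {measure set E -> \bar R}) (nu : set E -> \bar R) :=
  forall A, measurable A -> leb A = 0%E -> nu A = 0%E.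

Definition in_P2 (mu : probability E R) : Prop :=
  (\int[mu]_x (sqn x)%:E < +oo)%E.

Definition econvex (f : E -> \bar R) : Prop :=
  forall x y t, 0 <= t <= 1 ->
    (f (seg x y t) <= (1 - t)%:E * f x + t%:E * f y)%E.
Definition eproper (f : E -> \bar R) : Prop :=
  (forall x, f x != -oo%E) /\ exists x, f x != +oo%E.
Definition elsc (f : E -> \bar R) : Prop :=
  forall x (a : R), (a%:E < f x)%E ->
    exists2 del : R, 0 < del & forall y, sqn (tsub y x) < del -> (a%:E < f y)%E.
Definition Acx (f : E -> \bar R) : Prop := eproper f /\ elsc f /\ econvex f.

Definition quad_growth (u : E -> R) : Prop :=
  exists C : R, forall x, `|u x| <= C * (1 + sqn x).
Definition continuous_on_Rd (u : E -> R) : Prop :=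
  forall x (e : R), 0 < e ->
    exists2 del : R, 0 < del & forall y, sqn (tsub y x) < del -> `|u y - u x| < e.
Definition C_b2 (u : E -> R) : Prop := continuous_on_Rd u /\ quad_growth u.
Definition S_b2 (u : E -> R) : Prop := measurable_fun setT u /\ quad_growth u.

Definition Q2 (g : E -> R) (y : E) : \bar R :=
  ereal_sup [set (g x - sqn (tsub x y))%:E | x in [set: E]].

Definition D2fun (mu nu : probability E R) (g : E -> R) : \bar R :=
  (\int[mu]_x (g x)%:E - \int[nu]_y Q2 g y)%E.

Definition int_exists (m : probability E R) (f : E -> R) : Prop :=
  ~ ((\int[m]_x (Num.max (f x) 0)%:E = +oo)%E /\
     (\int[m]_x (Num.max (- f x) 0)%:E = +oo)%E).

Definition cx_le (mu xi : probability E R) : Prop :=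
  forall f : E -> R, econvex (fun x => (f x)%:E) ->
    int_exists mu f -> int_exists xi f ->
    (\int[mu]_x (f x)%:E <= \int[xi]_x (f x)%:E)%E.

Definition Pcx (mu xi : probability E R) : Prop := in_P2 xi /\ cx_le mu xi.

Definition coupling (xi nu : probability E R) (pi : probability (E * E)%type R) : Prop :=
  (forall A, measurable A -> pi (A `*` [set: E]) = xi A) /\
  (forall B, measurable B -> pi ([set: E] `*` B) = nu B).
Definition T2 (xi nu : probability E R) : \bar R :=
  ereal_inf [set (\int[pi]_z (sqn (tsub z.1 z.2))%:E)%E
            | pi in [set pi | coupling xi nu pi]].

Definition legendre (g : E -> \bar R) (y : E) : \bar R :=
  ereal_sup [set ((dotp x y)%:E - g x)%E | x in [set: E]].

Definition ddir (f : E -> R) (v : E) : E -> R :=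
  fun x => derive1 (fun t : R => f (tadd x (tscale t v))) 0.
Definition iter_ddir (vs : seq E) (f : E -> R) : E -> R :=
  foldr (fun v g => ddir g v) f vs.
Definition smooth (f : E -> R) : Prop :=
  forall vs : seq E, continuous_on_Rd (iter_ddir vs f) /\
    forall v x, derivable (fun t : R => iter_ddir vs f (tadd x (tscale t v))) 0 1.
Definition test_fun (z : E -> R) : Prop :=
  smooth z /\ exists M : R, forall x, M < sqn x -> z x = 0.

Definition loc_integrable (leb : {measure set E -> \bar R}) (f : E -> \bar R) :=
  forall M : R, leb.-integrable [set x | sqn x <= M] f.

(* D^2 f <= Id in the sense of distributions:
   for all test functions z >= 0 and all v,
   int f (d_v d_v z) <= |v|^2 int z. *)
Definition hess_le_id (leb : {measure set E -> \bar R}) (f : E -> \bar R) : Prop :=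
  loc_integrable leb f /\
  forall z : E -> R, test_fun z -> (forall x, 0 <= z x) -> forall v : E,
    (\int[leb]_x (f x * (ddir (ddir z v) v x)%:E) <=
       (sqn v)%:E * \int[leb]_x (z x)%:E)%E.

Definition convex_expansion (leb : {measure set E -> \bar R}) (psi : E -> \bar R) :=
  Acx psi /\ exists phi : E -> \bar R,
    eproper phi /\ (forall y, psi y = legendre phi y) /\ hess_le_id leb phi.

Definition unif_convex (psi : E -> \bar R) : Prop :=
  exists rho : R -> R, (forall r, 0 < r -> 0 < rho r) /\
    forall x y t, 0 <= t <= 1 ->
      (psi (seg x y t) + (t * (1 - t) * rho (Num.sqrt (sqn (tsub x y))))%:E
        <= (1 - t)%:E * psi x + t%:E * psi y)%E.

Definition grad (psi : E -> \bar R) (x : E) : E :=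
  [tuple derive1 (fun t : R => fine (psi (tadd x (tscale t (tbasis i))))) 0 | i < d].

Definition phibar0 (phi : E -> R) (x : E) : R := sqn x / 2 - phi x / 2.

End OTDefs.

(* Main.v *)
Require Import Defs.
From HB Require Import structures.
From mathcomp Require Import all_boot all_order all_algebra.
From mathcomp Require Import all_classical all_reals all_analysis.
From mathcomp Require Import measurable_realfun ring lra.
Import Order.TTheory GRing.Theory Num.Theory.
Import numFieldNormedType.Exports.
Local Open Scope classical_set_scope.
Local Open Scope ring_scope.

(* Write psi for the Legendre transform of |x|^2/2 - phi/2, so that Q2 phi = 2 psi - |y|^2, and
   T = grad psi.  Uniform convexity of psi holds because Q2 phi is a supremum of convex functions
   y |-> phi (y + z) - |z|^2.

   The kinks of psi on a line are countable, so by Tonelli and translation invariance psi has all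
   partial derivatives nu-almost everywhere on its domain; at such a y every almost maximizer of
   phi x - |x - y|^2 is close to T y.  Hence (Q2 (phi + e u) y - Q2 phi y) / e -> u (T y) as e -> 0
   (Danskin).  With u = g - phi, g convex and Lipschitz, optimality of phi and Fatou's lemma give
   int (g - phi) dmu <= int (g - phi) o T dnu.  The choice g = 0 bounds int phi o T dnu by
   int phi dmu, so T_# nu has finite second moment and attains the dual value; replacing g by a
   large multiple gives int g dmu <= int g o T dnu, that is, mu <=cx T_# nu.

   If xi is another minimizer, weak duality for phi + e f with f bounded and Danskin's formula with
   u = f and u = - f give int f dxi = int f o T dnu, so xi = T_# nu.  No optimal coupling is used. *)

(** Dual competitors must be convex, so [phi] can only be moved along segments towards convex
    functions, and optimality yields one-sided inequalities. As [e |-> Q2 (phi + e u) y] is convex,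
    the chord at 1 minus the difference quotient is nonnegative, which suits Fatou where no
    dominating function is at hand. For [g] of quadratic growth [Q2 g] may be [+oo] everywhere;
    hence the restriction to Lipschitz [g], for which [Q2 g - g] is bounded, and general convex
    functions are recovered as increasing limits of Lipschitz ones. Weak duality holds for arbitrary
    functions, so the uniqueness step may perturb by both signs of [f].

    Quadratic growth of [phi] gives no a priori moment for [T_# nu]: integrability of [phi o T] is a
    conclusion of Fatou, and the second moment then comes from the cost
    [|T y - y|^2 = phi (T y) - Q2 phi y]. Derivatives along the axes suffice because an affine
    minorant of [psi] that almost touches it at [y] has its slope confined one coordinate at a
    time. *)

(** * Convex functions of one real variable *)

Section ConvexLine.
Context {R : realType}.
Implicit Types (D : set R) (f : R -> R).

Lemma harmonic_le (e : R) : 0 < e -> exists n : nat, n.+1%:R^-1 <= e.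
Proof.
move=> e0; exists (Num.trunc e^-1); rewrite invf_ple ?posrE//.
by apply/ltW; rewrite truncnS_gt.
Qed.

Lemma near_dist (b e : R) : 0 < e -> \forall t \near b, `|b - t| < e.
Proof.
move=> e0; suff /(@cvgrPdist_lt _ R^o)/(_ _ e0) : (id : R^o -> R^o) t @[t --> b] --> b by [].
exact: cvg_id.
Qed.

(** Convexity with denominators cleared. The clause [D b] makes [D] an interval, so the finiteness
    domain of an extended-valued function is handled together with its values. *)
Definition conv_on D f := forall a b c, D a -> D c -> a <= b -> b <= c ->
  D b /\ (c - a) * f b <= (c - b) * f a + (b - a) * f c.

Lemma conv_on_opp D f : conv_on D f -> conv_on [set t | D (- t)] (fun t => f (- t)).
Proof.
move=> cf a b c /= Da Dc ab bc.
have [||Db H] := cf _ (- b) _ Dc Da; rewrite ?lerN2 //.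
by split=> //; lra.
Qed.

Lemma conv_on_lslope D f t s m : conv_on D f -> D t -> D (t - s) -> 0 < m -> m <= s ->
  D (t - m) /\ (f t - f (t - s)) / s <= (f t - f (t - m)) / m.
Proof.
move=> cf Dt Ds m0 ms; have s0 := lt_le_trans m0 ms.
have [||D1 H] := cf _ (t - m) _ Ds Dt; [lra|lra|].
split=> //; rewrite ler_pdivrMr// mulrAC ler_pdivlMr//; lra.
Qed.

Lemma conv_on_rslope D f t s m : conv_on D f -> D t -> D (t + s) -> 0 < m -> m <= s ->
  D (t + m) /\ (f (t + m) - f t) / m <= (f (t + s) - f t) / s.
Proof.
move=> cf Dt Ds m0 ms; have s0 := lt_le_trans m0 ms.
have [||D1 H] := cf _ (t + m) _ Dt Ds; [lra|lra|].
split=> //; rewrite ler_pdivlMr// mulrAC ler_pdivrMr//; lra.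
Qed.

Lemma conv_on_slopes D f t s m : conv_on D f -> D (t - s) -> D (t + m) ->
  0 < s -> 0 < m -> (f t - f (t - s)) / s <= (f (t + m) - f t) / m.
Proof.
move=> cf Ds Dm s0 m0; have [||D1 H] := cf _ t _ Ds Dm; [lra|lra|].
rewrite ler_pdivrMr// mulrAC ler_pdivlMr//; lra.
Qed.

Lemma conv_on_continuous D f a b c : conv_on D f -> D a -> D c -> a < b -> b < c ->
  {for b, continuous f}.
Proof.
move=> cf Da Dc ab bc.
(* Sum of the absolute slopes from [b] to the two ends; convexity makes it a Lipschitz constant at
   [b] on the whole interval. *)
set K := `|f c - f b| / (c - b) + `|f a - f b| / (b - a).
have c0 : 0 < c - b by rewrite subr_gt0.
have a0 : 0 < b - a by rewrite subr_gt0.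
have K0 : 0 <= K by rewrite addr_ge0// divr_ge0// ltW.
have [Db _] := cf _ _ _ Da Dc (ltW ab) (ltW bc).
have KR : (f c - f b) <= K * (c - b).
  apply: le_trans (ler_norm _) _; rewrite /K mulrDl (divfK (lt0r_neq0 c0)).
  by rewrite lerDl mulr_ge0 ?divr_ge0// ltW.
have KL : (f a - f b) <= K * (b - a).
  apply: le_trans (ler_norm _) _; rewrite /K mulrDl (divfK (lt0r_neq0 a0)).
  by rewrite lerDr mulr_ge0 ?divr_ge0// ltW.
have bnd t : a <= t -> t <= c -> `|f b - f t| <= K * `|b - t|.
  move=> at_ tc; case: (leP b t) => bt.
    have [D1 H1] := cf b t c Db Dc bt tc.
    have [D2 H2] := cf a b t Da D1 (ltW ab) bt.
    have bt' : 0 <= t - b by rewrite subr_ge0.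
    rewrite (distrC b) (ger0_norm bt') ler_norml.
    have A1 : (t - b) * (f c - f b) <= (t - b) * (K * (c - b)) by rewrite ler_wpM2l.
    have A2 : (t - b) * (f a - f b) <= (t - b) * (K * (b - a)) by rewrite ler_wpM2l.
    apply/andP; split.
      rewrite -(ler_pM2l c0); lra.
    rewrite -(ler_pM2l a0); lra.
  have [D1 H1] := cf a t b Da Db at_ (ltW bt).
  have [D2 H2] := cf t b c D1 Dc (ltW bt) (ltW bc).
  have bt' : 0 <= b - t by rewrite subr_ge0 ltW.
  rewrite (ger0_norm bt') ler_norml.
  have A1 : (b - t) * (f c - f b) <= (b - t) * (K * (c - b)) by rewrite ler_wpM2l.
  have A2 : (b - t) * (f a - f b) <= (b - t) * (K * (b - a)) by rewrite ler_wpM2l.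
  apply/andP; split.
    rewrite -(ler_pM2l a0); lra.
  rewrite -(ler_pM2l c0); lra.
apply/(@cvgrPdist_le _ R^o) => e e0.
near=> t.
have : `|b - t| < Num.min (b - a) (Num.min (c - b) (e / (K + 1))).
  near: t; apply: near_dist; rewrite !lt_min a0 c0/= divr_gt0// ltr_pwDr//.
rewrite !lt_min => /and3P[ta tc /ltW te].
move: (ta) (tc); rewrite !ltr_norml => /andP[ta1 ta2] /andP[tc1 tc2].
apply: le_trans (bnd t _ _) _; [lra|lra|].
move: te; rewrite ler_pdivlMr ?ltr_pwDr// => H; apply: le_trans H.
by rewrite mulrC ler_wpM2l// lerDl.
Unshelve. all: by end_near. Qed.

(** Dichotomy: if [D] meets every right neighbourhood of 0, it contains some []0, s[], where
    convexity gives continuity; otherwise [f] is identically 0 just to the right of 0. *)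
Lemma conv_on_continuous_right D f : conv_on D f -> (forall t, ~ D t -> f t = 0) ->
  exists2 del, 0 < del & forall t, 0 < t -> t < del -> {for t, continuous f}.
Proof.
move=> cf f0.
have [H|] := pselect (forall del, 0 < del -> exists2 t, D t & 0 < t < del).
  have [s Ds /andP[s0 s1]] := H 1 ltr01.
  exists s => // t t0 ts; have [u Du /andP[u0 ut]] := H t t0.
  exact: (conv_on_continuous _ _ _ _ _ cf Du Ds).
move=> /existsNP[del /not_implyP[del0 H]]; exists del => // t t0 td.
have f00 u : 0 < u -> u < del -> f u = 0.
  by move=> u0 ud; apply: f0 => Du; apply: H; exists u => //; rewrite u0.
rewrite /prop_for /continuous_at f00//.
apply/(@cvgrPdist_le _ R^o) => e e0; near=> u.
have : `|t - u| < Num.min t (del - t) by near: u; apply: near_dist; rewrite lt_min t0 subr_gt0.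
rewrite lt_min !ltr_norml => /andP[/andP[? ?] /andP[? ?]].
by rewrite f00 ?subr0 ?normr0 1?ltW//; lra.
Unshelve. all: by end_near. Qed.

(** Continuity off 0 is what lets rational increments decide differentiability at 0. The centre is
    excluded: [f] may jump there when 0 is an end of [D]. *)
Lemma conv_on_continuous_punctured D f : conv_on D f -> (forall t, ~ D t -> f t = 0) ->
  exists2 del, 0 < del & forall t, t != 0 -> `|t| < del -> {for t, continuous f}.
Proof.
move=> cf f0; have [d1 d10 H1] := conv_on_continuous_right _ _ cf f0.
have [|d2 d20 H2] := conv_on_continuous_right _ _ (conv_on_opp _ _ cf).
  by move=> t /= Dt; exact: f0.
exists (Num.min d1 d2); first by rewrite lt_min d10.
move=> t t0; rewrite lt_min => /andP[td1 td2].
case: (ltgtP t 0) t0 => // t0 _.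
  have := H2 (- t); rewrite oppr_gt0 => /(_ t0).
  rewrite -(ltr0_norm t0) => /(_ td2); rewrite (ltr0_norm t0) => C.
  have -> : f = (fun t => f (- t)) \o -%R by apply/funext => u /=; rewrite opprK.
  apply: (@continuous_comp R R R) => //; exact: (@opp_continuous R^o).
by apply: H1 => //; rewrite -(gtr0_norm t0).
Qed.

(* For convex [f] the second difference quotient decreases to the jump of the slope at [t]. *)
Definition kinkfree D f t := D t /\ forall e, 0 < e ->
  exists s, [/\ 0 < s, D (t + s), D (t - s) & f (t + s) + f (t - s) <= 2 * f t + e * s].

(** [kinkfree] supplies points of [D] on both sides, so the left slopes are nonempty and bounded
    above by a right slope; their supremum is a subgradient. *)
Lemma kinkfree_slope D f t : conv_on D f -> kinkfree D f t ->
  exists T : R, (forall s, 0 < s -> D (t - s) -> f t - f (t - s) <= T * s) /\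
    (forall s, 0 < s -> D (t + s) -> T * s <= f (t + s) - f t).
Proof.
move=> cf [Dt gt].
pose L := [set x | exists s, [/\ 0 < s, D (t - s) & x = (f t - f (t - s)) / s]].
have ubL s : 0 < s -> D (t + s) -> ubound L ((f (t + s) - f t) / s).
  move=> s0 Ds _ [m [m0 Dm ->]]; exact: (conv_on_slopes _ _ _ _ _ cf).
have [r [r0 Dr1 Dr2 _]] := gt _ ltr01.
have hL : has_sup L by split; [exists ((f t - f (t - r)) / r), r|exists ((f (t + r) - f t) / r); exact: ubL].
exists (sup L); split=> s s0 Ds.
  rewrite -ler_pdivrMr//; apply: ub_le_sup; first by case: hL.
  by exists s.
rewrite -ler_pdivlMr//; apply: ge_sup; [by case: hL|exact: ubL].
Qed.

(** The left and right slopes at the scale [s] given by [kinkfree] lie within [e] of [T], and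
    monotonicity of slopes confines all quotients with smaller increments. *)
Lemma kinkfree_derive D f t (T : R) : conv_on D f -> kinkfree D f t ->
    (forall s, 0 < s -> D (t - s) -> f t - f (t - s) <= T * s) ->
    (forall s, 0 < s -> D (t + s) -> T * s <= f (t + s) - f t) ->
  derive1 f t = T.
Proof.
move=> cf [Dt gt] TL TR; apply/cvg_lim => //.
apply/(@cvgrPdist_le _ R^o) => e e0.
have [s [s0 D1 D2 H]] := gt e e0.
near=> h.
have h0 : h != 0 by near: h; exact: nbhs_dnbhs_neq.
have hs : `|h| <= s.
  near: h; apply: dnbhs0_le => //.
rewrite /= -[_ *: _]/(h^-1 * (f (h + t) - f t)) mulrC addrC [h + t]addrC.
have U : (f (t + s) - f t) / s <= T + e.
  rewrite ler_pdivrMr//; have := TL s s0 D2; lra.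
have V : T - e <= (f t - f (t - s)) / s.
  rewrite ler_pdivlMr//; have := TR s s0 D1; lra.
case: (ltgtP h 0) h0 => // h0 _.
  have hs' : - h <= s by rewrite -(ltr0_norm h0).
  have [|Dh H1] := conv_on_lslope _ _ _ _ (- h) cf Dt D2 _ hs'; first by rewrite oppr_gt0.
  rewrite opprK in H1 Dh.
  have H2 : (f t - f (t + h)) / (- h) <= T.
    rewrite ler_pdivrMr ?oppr_gt0//; have := TL (- h); rewrite opprK oppr_gt0; exact.
  have -> : (f (t + h) - f t) / h = (f t - f (t + h)) / (- h) by rewrite invrN mulrN -mulNr opprB.
  rewrite ler_norml; apply/andP; split; lra.
have hs' : h <= s by rewrite -(gtr0_norm h0).
have [Dh H1] := conv_on_rslope _ _ _ _ _ cf Dt D1 h0 hs'.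
have H2 : T <= (f (t + h) - f t) / h by rewrite ler_pdivlMr//; exact: TR.
rewrite ler_norml; apply/andP; split; lra.
Unshelve. all: by end_near. Qed.

Lemma countable_setU (A B : set R) : countable A -> countable B -> countable (A `|` B).
Proof.
move=> cA cB; rewrite -bigcup2E; apply: bigcup_countable => // -[|[|n]] _ //=.
Qed.

(* Distinct kinks have disjoint nondegenerate intervals of subgradients, and each contains a rational. *)
Lemma conv_on_kinks_countable D f : conv_on D f ->
  countable [set t | D t /\ ~ kinkfree D f t].
Proof.
move=> cf.
(* [BR] and [BL] can only contain the right and left end of [D]. At a point of [B q] the number [q]
   lies strictly between left and right slopes, which cannot happen at two points for the same
   [q]. *)
pose BR := [set t | D t /\ forall s, 0 < s -> ~ D (t + s)].
pose BL := [set t | D t /\ forall s, 0 < s -> ~ D (t - s)].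
pose B (q : R) := [set t | D t /\ forall s, 0 < s ->
  (D (t + s) -> q * s < f (t + s) - f t) /\ (D (t - s) -> f t - f (t - s) < q * s)].
have single (A : set R) : (forall t t', A t -> A t' -> t < t' -> False) -> countable A.
  move=> HA; apply: finite_set_countable.
  have [->|/set0P[t At]] := eqVneq A set0; first exact: finite_set0.
  apply: (@sub_finite_set _ _ [set t]); last exact: finite_set1.
  move=> u Au /=; case: (ltgtP u t) => // ut; exfalso; [exact: (HA u t)|exact: (HA t u)].
apply: (@sub_countable _ _ _ (BR `|` BL `|` \bigcup_(q in range (@ratr R)) B q)); last first.
  apply: countable_setU; first apply: countable_setU.
  - apply: single => t t' [_ Ht] [Dt' _] tt'; apply: (Ht (t' - t)); first by rewrite subr_gt0.
    by rewrite addrC subrK.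
  - apply: single => t t' [Dt _] [_ Ht'] tt'; apply: (Ht' (t' - t)); first by rewrite subr_gt0.
    by rewrite opprB addrC subrK.
  - apply: bigcup_countable; first by apply: card_le_trans (card_image_le _ _) _; exact: countableP.
    move=> q _; apply: single => t t' [Dt Ht] [Dt' Ht'] tt'.
    have s0 : 0 < t' - t by rewrite subr_gt0.
    have [H1 _] := Ht _ s0; have [_ H2] := Ht' _ s0.
    have e1 : t + (t' - t) = t' by rewrite addrC subrK.
    have e2 : t' - (t' - t) = t by rewrite opprB addrC subrK.
    rewrite e1 in H1; rewrite e2 in H2.
    by have := lt_trans (H1 Dt') (H2 Dt); rewrite ltxx.
apply: subset_card_le => t [Dt nk].
have [HR|nR] := pselect (forall s, 0 < s -> ~ D (t + s)); first by left; left.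
have [HL|nL] := pselect (forall s, 0 < s -> ~ D (t - s)); first by left; right.
right.
move/existsNP : nR => [r /not_implyP[r0 /contrapT Dr]].
move/existsNP : nL => [l /not_implyP[l0 /contrapT Dl]].
have [e [e0 He]] : exists e, 0 < e /\ forall s, 0 < s -> D (t + s) -> D (t - s) ->
    2 * f t + e * s < f (t + s) + f (t - s).
  apply: contrapT => H; apply: nk; split=> // e e0.
  apply: contrapT => H2; apply: H; exists e; split=> // s s0 D1 D2.
  by rewrite ltNge; apply/negP => H3; apply: H2; exists s.
pose L := [set x | exists s, [/\ 0 < s, D (t - s) & x = (f t - f (t - s)) / s]].
have ubL s : 0 < s -> D (t + s) -> ubound L ((f (t + s) - f t) / s - e).
  move=> s0 Ds _ [m [m0 Dm ->]].
  (* The gap [e] is known for symmetric increments only, so both slopes are first moved to a common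
     scale. *)
  set k := Num.min s m.
  have k0 : 0 < k by rewrite lt_min s0.
  have [|D1 H1] := conv_on_lslope _ _ _ _ k cf Dt Dm k0; first by rewrite ge_min lexx orbT.
  have [|D2 H2] := conv_on_rslope _ _ _ _ k cf Dt Ds k0; first by rewrite ge_min lexx.
  rewrite lerBrDr; apply: le_trans H2; apply: (le_trans (_ : _ <= (f t - f (t - k)) / k + e)).
    by rewrite lerD2r.
  rewrite ler_pdivlMr// mulrDl divfK ?gt_eqF//; have := He _ k0 D2 D1; lra.
have hL : has_sup L by split; [exists ((f t - f (t - l)) / l), l|exists ((f (t + r) - f t) / r - e); exact: ubL].
have Le : sup L < sup L + e by rewrite ltrDl.
have [q] := rat_in_itvoo Le.
rewrite in_itv /= => /andP[q1 q2].
exists (ratr q); first by exists q.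
split=> // s s0; split=> Ds.
  rewrite -ltr_pdivlMr//; apply: (lt_le_trans q2); rewrite -lerBrDr.
  apply: ge_sup; [by case: hL|exact: ubL].
rewrite -ltr_pdivrMr//; apply: le_lt_trans q1; apply: ub_le_sup; first by case: hL.
by exists s.
Qed.

(** Countable quantifiers, for measurability. Passing to a smaller reciprocal is harmless because
    the second difference divided by the increment is nondecreasing for convex [f]. *)
Lemma kinkfree_harmonicP D f t : conv_on D f -> kinkfree D f t <->
  D t /\ forall k : nat, exists n : nat, let s := n.+1%:R^-1 in
    [/\ D (t + s), D (t - s) & f (t + s) + f (t - s) <= 2 * f t + k.+1%:R^-1 * s].
Proof.
move=> cf; split=> -[Dt H]; split=> //; last move=> e e0; first move=> k.
  have : 0 < k.+1%:R^-1 :> R by rewrite invr_gt0.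
  move: k.+1%:R^-1 => c c0; have [s [s0 D1 D2 Hs]] := H c c0.
  have [n ns] := harmonic_le s s0.
  have n0 : 0 < n.+1%:R^-1 :> R by rewrite invr_gt0.
  exists n => /=; move: n.+1%:R^-1 n0 ns => m m0 ms.
  have [E1 H1] := conv_on_lslope _ _ _ _ _ cf Dt D2 m0 ms.
  have [E2 H2] := conv_on_rslope _ _ _ _ _ cf Dt D1 m0 ms.
  split=> //.
  have H3 : (f (t + s) - f t) / s - (f t - f (t - s)) / s <= c.
    rewrite -mulrBl ler_pdivrMr//; lra.
  have H4 : (f (t + m) - f t) / m - (f t - f (t - m)) / m <= c.
    by apply: le_trans H3; rewrite lerB.
  move: H4; rewrite -mulrBl ler_pdivrMr//; lra.
have [k ke] := harmonic_le e e0.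
have [n [D1 D2 Hn]] := H k.
have n0 : 0 < n.+1%:R^-1 :> R by rewrite invr_gt0.
exists n.+1%:R^-1; split=> //; apply: le_trans Hn _.
by rewrite lerD2l ler_wpM2r// ltW.
Qed.

End ConvexLine.

(** * Vectors *)

Section Vectors.
Context {R : realType} {d : nat}.
Local Notation E := (d.-tuple R).
Implicit Types (x y z : E).

Lemma tnth_tadd x y i : tnth (tadd x y) i = tnth x i + tnth y i.
Proof. by rewrite tnth_mktuple. Qed.
Lemma tnth_tsub x y i : tnth (tsub x y) i = tnth x i - tnth y i.
Proof. by rewrite tnth_mktuple. Qed.
Lemma tnth_tscale a x i : tnth (tscale a x) i = a * tnth x i.
Proof. by rewrite tnth_mktuple. Qed.
Lemma tnth_tbasis i j : tnth (@tbasis R d i) j = (i == j)%:R.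
Proof. by rewrite tnth_mktuple. Qed.
Definition tnthE := (tnth_tadd, tnth_tsub, tnth_tscale, tnth_tbasis).

Lemma sqnE x : sqn x = \sum_(i < d) tnth x i ^+ 2.
Proof. by apply: eq_bigr => i _; rewrite expr2. Qed.

Lemma sqn_ge0 x : 0 <= sqn x.
Proof. by rewrite sqnE sumr_ge0// => i _; rewrite sqr_ge0. Qed.

Lemma sqr_tnth_le x i : tnth x i ^+ 2 <= sqn x.
Proof.
by rewrite sqnE (bigD1 i)//= lerDl sumr_ge0// => j _; rewrite sqr_ge0.
Qed.

Lemma tnth_lt_sqn x (e : R) i : 0 <= e -> sqn x < e ^+ 2 -> `|tnth x i| < e.
Proof.
move=> e0 H; have := le_lt_trans (sqr_tnth_le x i) H.
by rewrite -real_normK ?num_real// ltr_pXn2r ?nnegrE.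
Qed.

(** The factor [d.+1] in place of [d] is what makes the inequality strict. *)
Lemma sqn_lt_tnth x (e : R) : 0 < e -> (forall i, `|tnth x i| <= e) -> sqn x < d.+1%:R * e ^+ 2.
Proof.
move=> e0 H; apply: (@le_lt_trans _ _ (\sum_(i < d) e ^+ 2)).
  rewrite sqnE; apply: ler_sum => i _.
  by rewrite -real_normK ?num_real// ler_pXn2r ?nnegrE// ltW.
rewrite sumr_const card_ord -[X in X < _]mulr_natl ltr_pM2r ?exprn_gt0//.
by rewrite ltr_nat.
Qed.

(** The l1 norm: its triangle inequality is coordinatewise, so Lipschitz estimates avoid square
    roots and Cauchy-Schwarz. *)
Definition n1 x := \sum_(i < d) `|tnth x i|.

Lemma n1_ge0 x : 0 <= n1 x.
Proof. by rewrite sumr_ge0. Qed.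

Lemma tnth_le_n1 x i : `|tnth x i| <= n1 x.
Proof. by rewrite /n1 (bigD1 i)//= lerDl sumr_ge0. Qed.

Lemma n1_le_sqn x : n1 x <= d%:R + sqn x.
Proof.
have -> : d%:R = \sum_(i < d) 1 :> R by rewrite sumr_const card_ord.
rewrite sqnE -big_split/=; apply: ler_sum => i _.
rewrite -real_normK ?num_real//; move: `|_| (normr_ge0 (tnth x i)) => t t0; nra.
Qed.

Lemma n1_triangle x y z : n1 (tsub x z) <= n1 (tsub x y) + n1 (tsub y z).
Proof.
rewrite -big_split/=; apply: ler_sum => i _; rewrite !tnthE.
have -> : tnth x i - tnth z i = (tnth x i - tnth y i) + (tnth y i - tnth z i) by ring.
exact: ler_normD.
Qed.

Lemma n1C x y : n1 (tsub x y) = n1 (tsub y x).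
Proof. by apply: eq_bigr => i _; rewrite !tnthE distrC. Qed.

Lemma n1_eq0 x y : n1 (tsub x y) = 0 -> x = y.
Proof.
move=> /eqP; rewrite psumr_eq0// => /allP H; apply: eq_from_tnth => i.
have := H i (mem_index_enum i); rewrite normr_eq0 tnthE subr_eq0 => /eqP//.
Qed.

Lemma n1_refl x : n1 (tsub x x) = 0.
Proof. by rewrite /n1 big1// => i _; rewrite tnthE subrr normr0. Qed.

Lemma sqn_refl x : sqn (tsub x x) = 0.
Proof. by rewrite sqnE big1// => i _; rewrite tnthE subrr expr0n. Qed.

Lemma n1_lt_sqn x (e : R) : 0 < e -> sqn x < (e / d.+1%:R) ^+ 2 -> n1 x < e.
Proof.
move=> e0 H; have e1 : 0 < e / d.+1%:R by rewrite divr_gt0.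
apply: (@le_lt_trans _ _ (\sum_(i < d) (e / d.+1%:R))).
  by apply: ler_sum => i _; apply/ltW/tnth_lt_sqn => //; exact: ltW.
by rewrite sumr_const card_ord -[_ *+ d]mulr_natr mulrAC ltr_pdivrMr// ltr_pM2l// ltr_nat.
Qed.

Lemma tscale0 x v : tadd x (tscale 0 v) = x.
Proof. by apply: eq_from_tnth => i; rewrite !tnthE; ring. Qed.

Lemma line_tadd x v (s t : R) : tadd (tadd x (tscale s v)) (tscale t v) = tadd x (tscale (s + t) v).
Proof. by apply: eq_from_tnth => i; rewrite !tnthE; ring. Qed.

Lemma line_seg x v (a b t : R) : tadd x (tscale ((1 - t) * a + t * b) v) =
  seg (tadd x (tscale a v)) (tadd x (tscale b v)) t.
Proof. by apply: eq_from_tnth => i; rewrite !tnthE; ring. Qed.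

Lemma dotp_line x y (t : R) i : dotp x (tadd y (tscale t (tbasis i))) = dotp x y + t * tnth x i.
Proof.
have -> : t * tnth x i = \sum_(j < d) tnth x j * (t * (i == j)%:R).
  rewrite (bigD1 i)//= eqxx big1 ?addr0; first by rewrite mulr1 mulrC.
  by move=> j ij; rewrite eq_sym (negbTE ij) !mulr0.
by rewrite /dotp -big_split/=; apply: eq_bigr => j _; rewrite !tnthE; move: (_%:R) => b; ring.
Qed.

Lemma sqn_tsub x y : sqn (tsub x y) = sqn x - 2 * dotp x y + sqn y.
Proof.
rewrite /sqn /dotp mulr_sumr -sumrB -big_split/=; apply: eq_bigr => i _.
by rewrite !tnthE; ring.
Qed.

Lemma sqn_le2 x y : sqn x <= 2 * sqn (tsub x y) + 2 * sqn y.
Proof.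
rewrite !sqnE !mulr_sumr -big_split/=; apply: ler_sum => i _; rewrite !tnthE.
have := sqr_ge0 (tnth x i - 2 * tnth y i); lra.
Qed.

Lemma n1_seg x y x' y' (t : R) : 0 <= t <= 1 ->
  n1 (tsub (seg x y t) (seg x' y' t)) <= (1 - t) * n1 (tsub x x') + t * n1 (tsub y y').
Proof.
move=> /andP[t0 t1]; rewrite /n1 !mulr_sumr -big_split/=; apply: ler_sum => i _.
rewrite !tnthE.
have -> : (1 - t) * tnth x i + t * tnth y i - ((1 - t) * tnth x' i + t * tnth y' i)
  = (1 - t) * (tnth x i - tnth x' i) + t * (tnth y i - tnth y' i) by ring.
apply: le_trans (ler_normD _ _) _; rewrite !normrM (ger0_norm t0) ger0_norm//.
by rewrite subr_ge0.
Qed.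

Lemma econvexR (f : E -> R) : econvex (fun x => (f x)%:E) <->
  forall x y t, 0 <= t <= 1 -> f (seg x y t) <= (1 - t) * f x + t * f y.
Proof. by split=> H x y t /(H x y t). Qed.

Lemma econvex_comb (f g : E -> R) (a b : R) : 0 <= a -> 0 <= b ->
  econvex (fun x => (f x)%:E) -> econvex (fun x => (g x)%:E) ->
  econvex (fun x => (a * f x + b * g x)%:E).
Proof.
move=> a0 b0 /econvexR cf /econvexR cg; apply/econvexR => x y t t01.
have := ler_wpM2l a0 (cf x y t t01); have := ler_wpM2l b0 (cg x y t t01); lra.
Qed.

Lemma continuous_on_Rd_elsc (f : E -> R) : continuous_on_Rd f -> elsc (fun x => (f x)%:E).
Proof.
move=> cf x a; rewrite lte_fin -subr_gt0 => ax.
have [del del0 H] := cf x _ ax; exists del => // y /H.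
by rewrite ltr_norml lte_fin => /andP[+ _]; lra.
Qed.

Lemma continuous_on_Rd_comb (f g : E -> R) (a b : R) :
  continuous_on_Rd f -> continuous_on_Rd g -> continuous_on_Rd (fun x => a * f x + b * g x).
Proof.
move=> cf cg x e e0.
pose c := e / (2 * (`|a| + `|b| + 1)).
have m0 : 0 < 2 * (`|a| + `|b| + 1) by rewrite mulr_gt0// ltr_pwDr// addr_ge0.
have c0 : 0 < c by rewrite divr_gt0.
have [d1 d10 H1] := cf x _ c0; have [d2 d20 H2] := cg x _ c0.
exists (Num.min d1 d2); first by rewrite lt_min d10.
move=> y; rewrite lt_min => /andP[/H1 A1 /H2 A2].
have -> : a * f y + b * g y - (a * f x + b * g x) = a * (f y - f x) + b * (g y - g x) by ring.
apply: le_lt_trans (ler_normD _ _) _; rewrite !normrM.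
have B1 : `|a| * `|f y - f x| <= `|a| * c by rewrite ler_wpM2l// ltW.
have B2 : `|b| * `|g y - g x| <= `|b| * c by rewrite ler_wpM2l// ltW.
have B3 : c * (2 * (`|a| + `|b| + 1)) = e by rewrite divfK// gt_eqF.
have := mulr_ge0 (normr_ge0 a) (ltW c0); have := mulr_ge0 (normr_ge0 b) (ltW c0).
lra.
Qed.

Lemma quad_growth_comb (f g : E -> R) (a b : R) :
  quad_growth f -> quad_growth g -> quad_growth (fun x => a * f x + b * g x).
Proof.
move=> [C HC] [C' HC']; exists (`|a| * C + `|b| * C') => x.
apply: le_trans (ler_normD _ _) _; rewrite !normrM.
have := ler_wpM2l (normr_ge0 a) (HC x); have := ler_wpM2l (normr_ge0 b) (HC' x); lra.
Qed.

Definition n1_lip (L : R) (f : E -> R) := forall x y, `|f x - f y| <= L * n1 (tsub x y).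

Lemma n1_lip_continuous L f : 0 <= L -> n1_lip L f -> continuous_on_Rd f.
Proof.
move=> L0 H x e e0.
have c0 : 0 < e / (L + 1) by rewrite divr_gt0// ltr_pwDr.
exists ((e / (L + 1) / d.+1%:R) ^+ 2); first by rewrite exprn_gt0// divr_gt0.
move=> y /(n1_lt_sqn _ _ c0); rewrite ltr_pdivlMr ?ltr_pwDr// => Hy.
apply: le_lt_trans (H _ _) _; apply: le_lt_trans Hy.
by rewrite mulrC ler_wpM2l ?n1_ge0// lerDl.
Qed.

Lemma n1_lip_quad_growth L f : 0 <= L -> n1_lip L f -> quad_growth f.
Proof.
move=> L0 H; pose z : E := [tuple 0 | i < d].
have sz (x : E) : tsub x z = x.
  by apply: eq_from_tnth => i; rewrite !tnthE tnth_mktuple subr0.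
exists (`|f z| + L * (d%:R + 1)) => x.
have := H x z; rewrite sz => Hx.
have A : `|f x| <= `|f z| + L * n1 x.
  by have := ler_normD (f x - f z) (f z); rewrite subrK; lra.
apply: (le_trans A).
have := ler_wpM2l L0 (n1_le_sqn x) => B.
have := mulr_ge0 (normr_ge0 (f z)) (sqn_ge0 x).
have := mulr_ge0 (mulr_ge0 L0 (ler0n R d)) (sqn_ge0 x).
move: L0; lra.
Qed.

End Vectors.

(** * Borel sets and Lebesgue measure *)

Lemma measurable_exists (dsp : measure_display) (T : measurableType dsp) (I : countType)
    (A : I -> set T) :
  (forall i, measurable (A i)) -> measurable [set x | exists i, A i x].
Proof.
move=> mA; have -> : [set x | exists i, A i x] = \bigcup_i A i.
  by apply/seteqP; split=> x /=; [move=> [i Ai]; exists i|move=> [i _ Ai]; exists i].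
exact: (countable_bigcupT_measurable (countableP _)).
Qed.

Lemma measurable_forall (dsp : measure_display) (T : measurableType dsp) (I : countType)
    (A : I -> set T) :
  (forall i, measurable (A i)) -> measurable [set x | forall i, A i x].
Proof.
move=> mA; rewrite -[X in measurable X]setCK; apply: measurableC.
have -> : ~` [set x | forall i, A i x] = [set x | exists i, (~` A i) x].
  apply/seteqP; split=> x /=; first by move/existsNP.
  by move=> [i nAi] H; exact/nAi/H.
by apply: measurable_exists => i; exact: measurableC.
Qed.

Lemma measurable_and_prop (dsp : measure_display) (T : measurableType dsp) (A : set T) (P : Prop) :
  measurable A -> measurable [set x | A x /\ P].
Proof.
move=> mA; have [p|np] := pselect P.
  by rewrite (_ : [set x | _] = A)//; apply/seteqP; split=> [x []|x].
by rewrite (_ : [set x | _] = set0)//; apply/seteqP; split=> [x []|x].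
Qed.

Section SigmaFiniteWitness.
Context {dsp : measure_display} {T : measurableType dsp} {R : realType}.
Variables (m : {measure set T -> \bar R}) (sfm : sigma_finite setT m).

(* The unused argument lets the sigma-finite instance be inferred from a proof. *)
Definition with_sigma_finite of sigma_finite setT m : set T -> \bar R := m.

HB.instance Definition _ := Measure.copy (with_sigma_finite sfm) m.
HB.instance Definition _ := Measure_isSigmaFinite.Build _ _ _ (with_sigma_finite sfm) sfm.

End SigmaFiniteWitness.

Section BorelRd.
Context {R : realType} {d : nat}.
Local Notation E := (d.-tuple R).
Implicit Types (x y z : E).

Lemma measurable_coord (A : 'I_d -> set R) : (forall i, measurable (A i)) ->
  measurable [set x : E | forall i, A i (tnth x i)].
Proof.
move=> mA; apply: (measurable_forall _ _ _ (fun i x => A i (tnth x i))) => i.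
by rewrite -[X in measurable X]setTI; exact: measurable_tnth.
Qed.

Lemma rat_grid x (e : R) : 0 < e ->
  exists q : d.-tuple rat, forall i, `|tnth x i - ratr (tnth q i)| < e.
Proof.
move=> e0; have H i : exists q : rat, `|tnth x i - ratr q| < e.
  have [|q] := @rat_in_itvoo R (tnth x i - e) (tnth x i + e); first by lra.
  rewrite in_itv/= => /andP[q1 q2]; exists q; rewrite ltr_norml; apply/andP; split; lra.
have [f Hf] := choice H; exists [tuple f i | i < d] => i.
by rewrite tnth_mktuple.
Qed.

(** Superlevel sets are open for the distance of [sqn], hence countable unions of the boxes with
    rational centre and half-side [1/(n+1)] that they contain. *)
Lemma elsc_measurable (F : E -> \bar R) : elsc F -> measurable_fun setT F.
Proof.
move=> lF; apply: (measurability (ErealGenOInfty.G (R:=R))).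
  exact: ErealGenOInfty.measurableE.
move=> _ [_ [a ->] <-]; rewrite setTI.
pose itv (qn : d.-tuple rat * nat) i : set R :=
  [set t | ratr (tnth qn.1 i) - qn.2.+1%:R^-1 < t < ratr (tnth qn.1 i) + qn.2.+1%:R^-1].
pose box (qn : d.-tuple rat * nat) : set E :=
  [set x | forall i, itv qn i (tnth x i)].
have -> : F @^-1` `]a%:E, +oo[ =
    [set x | exists qn, box qn x /\ box qn `<=` [set y | (a%:E < F y)%E]].
  apply/seteqP; split=> x /=; last first.
    by move=> [qn [bx H]]; rewrite in_itv/= andbT; exact: H.
  rewrite in_itv/= andbT => /lF [del del0 H].
  (* Two points of a box of half-side [m] differ by at most [2 m] in each coordinate, so [sqn] is
     below [4 (d+1) m^2], at most [del] once [m <= 1] and [m <= c]. *)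
  pose c := del / (4 * d.+1%:R).
  have c0 : 0 < c by rewrite divr_gt0// mulr_gt0.
  have [n [m [mE m0 ns m1]]] : exists (n : nat) (m : R), [/\ m = n.+1%:R^-1, 0 < m, m <= c & m <= 1].
    exists (Num.trunc c^-1); eexists; split; [reflexivity|by rewrite invr_gt0| |].
      by rewrite invf_ple ?posrE//; apply/ltW; rewrite truncnS_gt.
    by rewrite invf_le1// ler1n.
  have [q Hq] := rat_grid x _ m0.
  exists (q, n); split=> [i|y bxy] /=.
    have := Hq i; rewrite /itv/= -mE ltr_norml => /andP[? ?]; apply/andP; split; lra.
  apply: H.
  have e0 : 0 < m * 2 by rewrite mulr_gt0.
  apply: lt_le_trans (sqn_lt_tnth _ _ e0 _) _.
    move=> i; rewrite tnthE.
    have := Hq i; have : itv (q, n) i (tnth y i) := bxy i.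
    rewrite /itv/= -mE ltr_norml ler_norml => /andP[? ?] /andP[? ?].
    by apply/andP; split; lra.
  move: ns; rewrite /c ler_pdivlMr ?mulr_gt0//.
  have := ler0n R d.+1; move: (d.+1%:R) => D D0 H1.
  by have := mulr_ge0 D0 (mulr_ge0 (ltW m0) (_ : 0 <= 1 - m)); rewrite subr_ge0 => /(_ m1); lra.
apply: (measurable_exists _ _ _ (fun qn x => box qn x /\ box qn `<=` [set y | (a%:E < F y)%E])) => qn.
apply: measurable_and_prop; apply: (measurable_coord (itv qn)) => i.
by rewrite /itv -set_itvoo; exact: measurable_itv.
Qed.

Lemma continuous_on_Rd_measurable (f : E -> R) : continuous_on_Rd f -> measurable_fun setT f.
Proof. by move=> /continuous_on_Rd_elsc/elsc_measurable/measurable_EFinP. Qed.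

(** Measurability of the identity from [<<s G >>] to the product sigma-algebra is checked on each
    coordinate, and there on open rays. *)
Lemma tuple_measurable_gen (G : set (set E)) :
  (forall i (b : R), <<s G >> [set x | b < tnth x i]) ->
  forall A, measurable A -> <<s G >> A.
Proof.
move=> H; have : measurable_fun (setT : set (g_sigma_algebraType G)) (id : g_sigma_algebraType G -> E).
  apply/measurable_fun_tnthP => i; apply: (measurability (RGenOInfty.G (R:=R))).
    exact: RGenOInfty.measurableE.
  move=> _ [_ [b ->] <-]; rewrite setTI.
  have := H i b; congr (<<s G >> _).
  by apply/seteqP; split=> x /=; rewrite in_itv/= andbT.
by move=> mid A mA; have := mid measurableT A mA; rewrite setTI.
Qed.

Definition box (a b : E) : set E := [set x | forall i, tnth a i < tnth x i <= tnth b i].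

Lemma box_measurable a b : measurable (box a b).
Proof.
apply: (measurable_coord (fun i => `]tnth a i, tnth b i]%classic)) => i.
exact: measurable_itv.
Qed.

Lemma box_cover x : exists n : nat, box [tuple - n%:R | i < d] [tuple n%:R | i < d] x.
Proof.
exists (Num.trunc (n1 x)).+1 => i; rewrite !tnth_mktuple.
have := truncnS_gt (n1 x); have := tnth_le_n1 x i; rewrite ler_norml => /andP[].
set N := _.+1%:R; move=> H1 H2 H3; apply/andP; split; lra.
Qed.

(** Half-open boxes form a pi-system, exhaust the space with finite measure and generate the
    half-spaces. The lemma serves both translation invariance of [leb] and equality of laws. *)
Lemma measure_eq_on_boxes (m1 m2 : {measure set E -> \bar R}) :
  (forall a b, m1 (box a b) = m2 (box a b)) -> (forall a b, (m1 (box a b) < +oo)%E) ->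
  forall A, measurable A -> m1 A = m2 A.
Proof.
move=> H Hoo A mA.
pose G := [set B | exists a b, B = box a b].
apply: (g_sigma_algebra_measure_unique G _ (fun n => box [tuple - n%:R | i < d] [tuple n%:R | i < d])).
- by move=> _ [a [b ->]]; exact: box_measurable.
- by move=> n; eexists; eexists; reflexivity.
- by apply/seteqP; split=> // x _; have [n Hn] := box_cover x; exists n.
- move=> _ _ [a [b ->]] [a' [b' ->]].
  exists [tuple Num.max (tnth a i) (tnth a' i) | i < d], [tuple Num.min (tnth b i) (tnth b' i) | i < d].
  apply/seteqP; split=> x /=.
    move=> [H1 H2] i; rewrite !tnth_mktuple gt_max le_min.
    by have /andP[-> ->] := H1 i; have /andP[-> ->] := H2 i.
  move=> H1; split=> i; have := H1 i; rewrite !tnth_mktuple gt_max le_min.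
    by move=> /andP[/andP[-> _] /andP[-> _]].
  by move=> /andP[/andP[_ ->] /andP[_ ->]].
- by move=> _ [a [b ->]].
- by move=> k.
apply: tuple_measurable_gen mA => i b.
have -> : [set x | b < tnth x i] = \bigcup_n
    box [tuple if i == j then b else - n%:R | j < d] [tuple n%:R | j < d].
  apply/seteqP; split=> x /=.
    move=> bx; have [n Hn] := box_cover x; exists n => // j.
    have := Hn j; rewrite !tnth_mktuple; case: eqP => // <- /andP[_ ->].
    by rewrite bx.
  by move=> [n _ /(_ i)]; rewrite !tnth_mktuple eqxx => /andP[].
apply: sigma_algebra_bigcup => n; apply: sub_sigma_algebra.
by eexists; eexists; reflexivity.
Qed.

Lemma shift_measurable v : measurable_fun setT (fun x : E => tadd x v).
Proof.
apply/measurable_fun_tnthP => i; rewrite (_ : _ \o _ = fun x : E => tnth x i + tnth v i).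
  by apply: measurable_funD; [exact: measurable_tnth|exact: measurable_cst].
by apply/funext => x /=; rewrite tnthE.
Qed.

Section Lebesgue.
Variable leb : {measure set E -> \bar R}.
Hypothesis hleb : is_lebesgue leb.

Lemma leb_box a b : leb (box a b) =
  (if [forall i, tnth a i <= tnth b i] then \prod_(i < d) (tnth b i - tnth a i) else 0)%:E.
Proof.
case: ifPn => [/forallP/hleb//|/forallPn[i]]; rewrite -ltNge => ba.
rewrite (_ : box a b = set0) ?measure0//; apply/seteqP; split=> // x /(_ i) /andP[ax xb].
by have := lt_le_trans ax xb; rewrite ltNge (ltW ba).
Qed.

Lemma leb_box_lty a b : (leb (box a b) < +oo)%E.
Proof. by rewrite leb_box ltry. Qed.

Lemma leb_shift v A : measurable A -> leb ((fun x => tadd x v) @^-1` A) = leb A.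
Proof.
move=> mA; suff H : forall B, measurable B -> leb B = pushforward leb (fun x => tadd x v) B.
  by rewrite (H A).
apply: measure_eq_on_boxes; [exact: shift_measurable| |move=> ?; exact: leb_box_lty].
move=> ? a b; rewrite /= /pushforward.
have -> : (fun x => tadd x v) @^-1` box a b = box (tsub a v) (tsub b v).
  by apply/seteqP; split=> x H i; have := H i; rewrite !tnthE ltrBlDr lerBrDr.
rewrite !leb_box; congr (_%:E).
have -> : [forall i, tnth (tsub a v) i <= tnth (tsub b v) i] = [forall i, tnth a i <= tnth b i].
  by apply: eq_forallb => i; rewrite !tnthE lerD2r.
by case: ifP => // _; apply: eq_bigr => i _; rewrite !tnthE; ring.
Qed.

Lemma leb_sigma_finite : sigma_finite setT leb.
Proof.
exists (fun n => box [tuple - n%:R | i < d] [tuple n%:R | i < d]).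
  by apply/esym/seteqP; split=> // x _; have [n Hn] := box_cover x; exists n.
by move=> n; split; [exact: box_measurable|exact: leb_box_lty].
Qed.

(* Averaging the translates of [B] along [v] reduces to one-dimensional sections by Tonelli. *)
Lemma leb_countable_lines v (B : set E) : measurable B ->
  (forall x, countable [set t | B (tadd x (tscale t v))]) -> leb B = 0%E.
Proof.
move=> mB cB.
pose g (z : E * R) : E := tadd z.1 (tscale z.2 v).
have mg : measurable_fun setT g.
  apply/measurable_fun_tnthP => i.
  rewrite (_ : _ \o _ = fun z : E * R => tnth z.1 i + z.2 * tnth v i); last first.
    by apply/funext => z /=; rewrite !tnthE.
  apply: measurable_funD; first by apply: (measurableT_comp (measurable_tnth i)); exact: measurable_fst.
  by apply: measurable_funM; [exact: measurable_snd|exact: measurable_cst].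
pose f (z : E * R) : \bar R := (\1_B (g z))%:E.
have f0 w : (0 <= f w)%E by rewrite lee_fin.
have mf : measurable_fun setT f.
  by apply/measurable_EFinP; apply: (measurableT_comp _ mg); exact: measurable_indic.
have := @fubini_tonelli _ _ E _ R (with_sigma_finite _ leb_sigma_finite) (@lebesgue_measure R) f mf f0.
have mline x : measurable [set t : R | B (g (x, t))].
  rewrite -[X in measurable X]setTI.
  apply: (measurableT_comp mg (@pair1_measurable _ _ _ _ x)) => //.
have mshift t : measurable [set x : E | B (g (x, t))].
  rewrite -[X in measurable X]setTI.
  apply: (measurableT_comp mg (@pair2_measurable _ _ _ _ t)) => //.
rewrite integral0_eq; last first.
  move=> x _; rewrite (_ : (fun s => _) = fun t : R => (\1_[set t : R | B (g (x, t))] t)%:E)//.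
  rewrite integral_indic//; last exact: mline.
  by apply: countable_lebesgue_measure0; apply: sub_countable (cB x); apply: subset_card_le => t [].
rewrite (_ : (fun s => _) = cst (leb B)); last first.
  apply/funext => t; rewrite (_ : (fun s => _) = fun x : E => (\1_[set x : E | B (g (x, t))] x)%:E)//.
  have mS := mshift t; rewrite integral_indic//.
  by rewrite setIT -[RHS](leb_shift (tscale t v)).
(* [H] equates the iterated integrals: 0 in one order, and in the other [leb B] integrated over a
   line of infinite length. *)
move=> H; have lT : @lebesgue_measure R setT = +oo%E by rewrite -set_itvNyy lebesgue_measure_itv.
have {}H : (leb B * +oo)%E = 0%E.
  rewrite -lT; apply/esym/(etrans H).
  exact: (@integral_cst _ _ _ (@lebesgue_measure R) setT measurableT (leb B)).
apply/eqP; case: (ltgtP (leb B) 0%E) => // H0.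
  by have := measure_ge0 leb B; rewrite leNgt H0.
by move: H; rewrite gt0_muley.
Qed.

End Lebesgue.
End BorelRd.

(** * Measurability of derivatives *)

Section RationalDerivative.
Context {R : realType}.
Implicit Types f : R -> R.

Definition dquot f (h : R) : R := h^-1 * (f h - f 0).

Definition rat_cauchy f := forall k : nat, exists n : nat, forall p q : rat,
  p != 0 -> q != 0 -> `|ratr p| < n.+1%:R^-1 :> R -> `|ratr q| < n.+1%:R^-1 :> R ->
  `|dquot f (ratr p) - dquot f (ratr q)| <= k.+1%:R^-1.

Lemma derive1_dquot f : derive1 f 0 = lim (dquot f h @[h --> 0^']).
Proof.
by rewrite (_ : dquot f = fun h => h^-1 *: (f (h + 0) - f 0))//; apply/funext => h; rewrite addr0.
Qed.

(** Off 0 the quotient is continuous, so each real increment is exchanged for a rational one at cost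
    [e / 3]; the rational criterion pays the last third. *)
Lemma rat_cauchy_real f : rat_cauchy f ->
    (exists2 del, 0 < del & forall t, t != 0 -> `|t| < del -> {for t, continuous f}) ->
  forall e, 0 < e -> exists2 r, 0 < r & forall h h' : R, h != 0 -> h' != 0 ->
    `|h| < r -> `|h'| < r -> `|dquot f h - dquot f h'| <= e.
Proof.
move=> cf [del del0 fc] e e0.
have [k ke] := harmonic_le (e / 3) ltac:(by rewrite divr_gt0).
have [n Hn] := cf k.
have [r [rE r0]] : exists r : R, r = n.+1%:R^-1 /\ 0 < r by eexists; split; [reflexivity|rewrite invr_gt0].
exists (Num.min r del); first by rewrite lt_min r0.
have app h : h != 0 -> `|h| < Num.min r del -> exists p : rat,
    [/\ p != 0, `|ratr p| < r & `|dquot f h - dquot f (ratr p)| <= e / 3].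
  move=> h0; rewrite lt_min => /andP[hr hd].
  have qc : {for h, continuous (dquot f)}.
    apply: (@continuousM R R^o) => /=; first exact: (@continuousV R R^o).
    by apply: (@continuousB R R^o R^o); [exact: fc|exact: cst_continuous].
  have e3 : 0 < e / 3 by rewrite divr_gt0.
  have /(@cvgrPdist_le _ R^o)/(_ _ e3)/nbhs_ballP[s s0 Hs] := qc.
  (* Closer to [h] than its absolute value, the rational is nonzero; closer than [r] minus that
     value, it stays in the range of the criterion. *)
  pose m := Num.min s (Num.min `|h| (r - `|h|)).
  have m0 : 0 < m by rewrite !lt_min s0 normr_gt0 h0 subr_gt0.
  have hm : h - m < h + m by lra.
  have [p] := rat_in_itvoo hm; rewrite in_itv/= => /andP[p1 p2].
  have : `|h - ratr p| < m by rewrite ltr_norml; apply/andP; split; lra.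
  rewrite !lt_min => /and3P[ps ph pr].
  exists p; split; last exact: Hs.
    by apply: contraTneq ph => ->; rewrite rmorph0 subr0 ltxx.
  have := ler_normD (ratr p - h) h; rewrite subrK distrC; lra.
move=> h h' h0 h'0 hr hr'.
have [p [p0 pr Hp]] := app h h0 hr; have [q [q0 qr Hq]] := app h' h'0 hr'.
rewrite rE in pr qr; have H := Hn p q p0 q0 pr qr.
have {}H := le_trans H ke.
move: Hp Hq H; rewrite !ler_norml => /andP[? ?] /andP[? ?] /andP[? ?].
by apply/andP; split; lra.
Qed.

Lemma cauchy_cvg_dquot f :
  (forall e, 0 < e -> exists2 r, 0 < r & forall h h' : R, h != 0 -> h' != 0 ->
    `|h| < r -> `|h'| < r -> `|dquot f h - dquot f h'| <= e) ->
  cvg (dquot f h @[h --> 0^']).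
Proof.
move=> H; apply: (@cauchy_cvg R^o); apply/cauchy_exP => e e0.
have e2 : 0 < e / 2 by rewrite divr_gt0.
have [r r0 Hr] := H _ e2.
exists (dquot f (r / 2)); suff : \forall h \near 0^', `|dquot f (r / 2) - dquot f h| < e by [].
near=> h; suff : `|dquot f (r / 2) - dquot f h| <= e / 2 by move=> /le_lt_trans; apply; lra.
apply: Hr.
- by rewrite mulf_neq0 ?gt_eqF.
- by near: h; exact: nbhs_dnbhs_neq.
- by rewrite gtr0_norm; lra.
- by near: h; apply: dnbhs0_lt.
Unshelve. all: by end_near. Qed.

Lemma cvg_dquot_rat_cauchy f : cvg (dquot f h @[h --> 0^']) -> rat_cauchy f.
Proof.
move=> /cvg_ex[l fl] k.
have e0 : 0 < k.+1%:R^-1 / 2 :> R by rewrite divr_gt0// invr_gt0.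
have /(@cvgrPdist_le _ R^o)/(_ _ e0)/nbhs_ballP[s s0 Hs] := fl.
have [n ns] := harmonic_le s s0; exists n => p q p0 q0 pn qn.
have P (a : rat) : a != 0 -> `|ratr a| < n.+1%:R^-1 :> R -> `|l - dquot f (ratr a)| <= k.+1%:R^-1 / 2.
  move=> a0 an; apply: Hs => /=.
    by rewrite /ball/= sub0r normrN (lt_le_trans an).
  by rewrite fmorph_eq0.
have := P p p0 pn; have := P q q0 qn; move: (k.+1%:R^-1) => c.
rewrite !ler_norml => /andP[? ?] /andP[? ?]; apply/andP; split; lra.
Qed.

Lemma derive1_rat_cauchy f :
    (exists2 del, 0 < del & forall t, t != 0 -> `|t| < del -> {for t, continuous f}) ->
  (rat_cauchy f -> dquot f n.+1%:R^-1 @[n --> \oo] --> derive1 f 0) /\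
  (~ rat_cauchy f -> derive1 f 0 = point).
Proof.
move=> fc; split=> [rc|nrc]; last first.
  rewrite derive1_dquot; apply: dvgP => H; exact/nrc/cvg_dquot_rat_cauchy.
have /cvg_ex[l fl] := cauchy_cvg_dquot _ (rat_cauchy_real _ rc fc).
rewrite derive1_dquot (cvg_lim _ fl)//.
apply/(@cvgrPdist_le _ R^o) => e e0.
have /(@cvgrPdist_le _ R^o)/(_ _ e0)/nbhs_ballP[s s0 Hs] := fl.
have [N NS] := harmonic_le (s / 2) ltac:(by rewrite divr_gt0).
near=> n; apply: Hs => /=; last by rewrite invr_neq0.
have Nn : (N <= n)%N by near: n; exists N.
rewrite /ball/= sub0r normrN ger0_norm ?invr_ge0//.
apply: (@le_lt_trans _ _ (s / 2)); last by rewrite ltr_pdivrMr// ltr_pMr// ltr1n.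
by apply: le_trans NS; rewrite lef_pV2 ?posrE// ler_nat ltnS.
Unshelve. all: by end_near. Qed.

(* Where the derivative does not exist [derive1] has the junk value [point]; the rational Cauchy
   criterion makes the set of such points measurable. *)
Lemma measurable_derive1 (dsp : measure_display) (T : measurableType dsp) (f : T -> R -> R) :
    (forall t, measurable_fun setT (f ^~ t)) ->
    (forall y, exists2 del, 0 < del & forall t, t != 0 -> `|t| < del -> {for t, continuous (f y)}) ->
  measurable_fun setT (fun y => derive1 (f y) 0).
Proof.
move=> mf fc.
have mq h : measurable_fun setT (fun y => dquot (f y) h).
  by apply: measurable_funM; [exact: measurable_cst|exact: measurable_funB].
pose C := [set y | rat_cauchy (f y)].
have mC : measurable C.
  apply: (measurable_forall _ _ _ (fun k y => exists n : nat, forall p q : rat,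
    p != 0 -> q != 0 -> `|ratr p| < n.+1%:R^-1 :> R -> `|ratr q| < n.+1%:R^-1 :> R ->
    `|dquot (f y) (ratr p) - dquot (f y) (ratr q)| <= k.+1%:R^-1)) => k.
  apply: (measurable_exists _ _ _ (fun n y => forall p q : rat,
    p != 0 -> q != 0 -> `|ratr p| < n.+1%:R^-1 :> R -> `|ratr q| < n.+1%:R^-1 :> R ->
    `|dquot (f y) (ratr p) - dquot (f y) (ratr q)| <= k.+1%:R^-1)) => n.
  apply: (measurable_forall _ _ _ (fun p y => forall q : rat,
    p != 0 -> q != 0 -> `|ratr p| < n.+1%:R^-1 :> R -> `|ratr q| < n.+1%:R^-1 :> R ->
    `|dquot (f y) (ratr p) - dquot (f y) (ratr q)| <= k.+1%:R^-1)) => p.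
  apply: (measurable_forall _ _ _ (fun q y =>
    p != 0 -> q != 0 -> `|ratr p| < n.+1%:R^-1 :> R -> `|ratr q| < n.+1%:R^-1 :> R ->
    `|dquot (f y) (ratr p) - dquot (f y) (ratr q)| <= k.+1%:R^-1)) => q.
  have [H|H] := pselect ([/\ p != 0, q != 0, `|ratr p| < n.+1%:R^-1 :> R & `|ratr q| < n.+1%:R^-1 :> R]).
    case: H => p0 q0 pn qn.
    rewrite [X in measurable X](_ : _ = (fun y => `|dquot (f y) (ratr p) - dquot (f y) (ratr q)|) @^-1` `]-oo, k.+1%:R^-1]).
      rewrite -[X in measurable X]setTI.
      have : measurable_fun setT (fun y => `|dquot (f y) (ratr p) - dquot (f y) (ratr q)|).
        by apply: (measurableT_comp (@normr_measurable R setT)); exact: measurable_funB.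
      by apply => //; exact: measurable_itv.
    apply/seteqP; split=> y /=; rewrite in_itv/=; first exact.
    by [].
  rewrite [X in measurable X](_ : _ = setT)//; apply/seteqP; split=> // y _ /= p0 q0 pn qn.
  by exfalso; apply: H.
pose h n y := if y \in C then dquot (f y) n.+1%:R^-1 else point : R.
apply: (@measurable_fun_cvg _ _ _ _ h) => [n|y _].
  apply: measurable_fun_ifT; [|exact: mq|exact: measurable_cst].
  apply: (@measurable_fun_bool _ _ _ _ true); rewrite setTI (_ : _ @^-1` _ = C)//.
  by apply/seteqP; split=> w; [exact: set_mem|exact: mem_set].
have [H1 H2] := derive1_rat_cauchy _ (fc y); rewrite /h.
have [Cy|nCy] := pselect (C y).
  by rewrite (mem_set Cy); exact: H1.
by rewrite (memNset nCy) (H2 nCy); exact: cvg_cst.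
Qed.

End RationalDerivative.

(** * Gradients of convex functions and the transform [Q2] *)

Lemma measurable_ler_set (R : realType) (dsp : measure_display) (T : measurableType dsp)
    (f g : T -> R) : measurable_fun setT f -> measurable_fun setT g ->
  measurable [set x | f x <= g x].
Proof.
move=> mf mg; rewrite (_ : [set x | _] = (fun x => g x - f x) @^-1` `[0, +oo[).
  rewrite -[X in measurable X]setTI.
  by have := measurable_funB mg mf; apply => //; exact: measurable_itv.
by apply/seteqP; split=> x /=; rewrite in_itv/= andbT subr_ge0.
Qed.

Section LineFunctions.
Context {R : realType} {d : nat}.
Local Notation E := (d.-tuple R).
Variable G : E -> \bar R.
Hypotheses (cG : econvex G) (GNy : forall y, G y != -oo%E).

Definition ldom (y : E) (i : 'I_d) : set R :=
  [set t | (G (tadd y (tscale t (tbasis i))) < +oo)%E].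
(** [fine] sends [+oo] to 0, so [lfun] vanishes off [ldom], which is the convention of the
    continuity lemmas on the line. *)
Definition lfun (y : E) (i : 'I_d) (t : R) : R := fine (G (tadd y (tscale t (tbasis i)))).

Lemma ldomE y i t : ldom y i t -> G (tadd y (tscale t (tbasis i))) = (lfun y i t)%:E.
Proof. by rewrite /ldom/= /lfun => D; rewrite fineK// fin_numE GNy/= lt_eqF. Qed.

Lemma line_conv_on y i : conv_on (ldom y i) (lfun y i).
Proof.
move=> a b c Da Dc ab bc; case: (eqVneq a c) => [ac|ac].
  have -> : b = a by apply/eqP; rewrite eq_le ab ac bc.
  by split=> //; rewrite ac subrr !mul0r addr0.
have ca : 0 < c - a by rewrite subr_gt0 lt_neqAle ac (le_trans ab bc).
pose t := (b - a) / (c - a).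
have t01 : 0 <= t <= 1.
  by rewrite divr_ge0 ?subr_ge0 ?(ltW ca)//= ?ler_pdivrMr// ?mul1r ?lerD2r//; exact: le_trans bc.
have tca : t * (c - a) = b - a by rewrite divfK// gt_eqF.
have bE : b = (1 - t) * a + t * c by lra.
have := cG (tadd y (tscale a (tbasis i))) (tadd y (tscale c (tbasis i))) t t01.
rewrite -line_seg -bE (ldomE _ _ _ Da) (ldomE _ _ _ Dc) -!EFinM -EFinD => H.
have Db : ldom y i b by rewrite /ldom/=; apply: le_lt_trans H _; rewrite ltry.
split=> //; move: H; rewrite (ldomE _ _ _ Db) lee_fin => /(ler_wpM2l (ltW ca)) H.
apply: le_trans H _.
have -> : (c - a) * ((1 - t) * lfun y i a + t * lfun y i c) =
  (c - a - t * (c - a)) * lfun y i a + t * (c - a) * lfun y i c by ring.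
rewrite tca; lra.
Qed.

Lemma lfun_out y i t : ~ ldom y i t -> lfun y i t = 0.
Proof.
rewrite /ldom /lfun/= => /negP; rewrite -leNgt leye_eq => /eqP -> //.
Qed.

Lemma ldom_shift y i t s : ldom (tadd y (tscale t (tbasis i))) i s = ldom y i (t + s).
Proof. by rewrite /ldom/= line_tadd. Qed.

Lemma lfun_shift y i t s : lfun (tadd y (tscale t (tbasis i))) i s = lfun y i (t + s).
Proof. by rewrite /lfun/= line_tadd. Qed.

(** Only the coordinate directions are tested; [near_max] shows that this already localizes almost
    maximizers. *)
Definition smooth_pt (y : E) := (G y < +oo)%E /\ forall i, kinkfree (ldom y i) (lfun y i) 0.

Hypothesis mG : measurable_fun setT G.

Lemma measurable_line t i : measurable_fun setT (fun y => G (tadd y (tscale t (tbasis i)))).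
Proof. exact: (measurableT_comp mG (shift_measurable _)). Qed.

Lemma measurable_lfun t i : measurable_fun setT (fun y => lfun y i t).
Proof.
apply: (measurableT_comp (@fine_measurable R setT measurableT)); exact: measurable_line.
Qed.

Lemma measurable_ldom t i : measurable [set y | ldom y i t].
Proof.
rewrite -[X in measurable X]setTI; apply: emeasurable_fun_infty_o => //; exact: measurable_line.
Qed.

Lemma grad_measurable : measurable_fun setT (grad G).
Proof.
apply/measurable_fun_tnthP => i; rewrite (_ : _ \o _ = fun y => derive1 (lfun y i) 0); last first.
  by apply/funext => y /=; rewrite /grad tnth_mktuple.
apply: measurable_derive1 => [t|y]; first exact: measurable_lfun.
exact: (conv_on_continuous_punctured _ _ (line_conv_on y i) (lfun_out y i)).
Qed.

Lemma measurable_kinkfree i : measurable [set y | kinkfree (ldom y i) (lfun y i) 0].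
Proof.
rewrite (_ : [set y | _] = [set y | ldom y i 0] `&` [set y | forall k : nat, exists n : nat,
  (ldom y i (0 + n.+1%:R^-1) /\ ldom y i (0 - n.+1%:R^-1)) /\
    lfun y i (0 + n.+1%:R^-1) + lfun y i (0 - n.+1%:R^-1) <= 2 * lfun y i 0 + k.+1%:R^-1 * n.+1%:R^-1]).
  apply: measurableI; first exact: measurable_ldom.
  apply: (measurable_forall _ _ _ (fun (k : nat) y => exists n : nat,
    (ldom y i (0 + n.+1%:R^-1) /\ ldom y i (0 - n.+1%:R^-1)) /\
    lfun y i (0 + n.+1%:R^-1) + lfun y i (0 - n.+1%:R^-1) <= 2 * lfun y i 0 + k.+1%:R^-1 * n.+1%:R^-1)) => k.
  apply: (measurable_exists _ _ _ (fun (n : nat) y => 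
    (ldom y i (0 + n.+1%:R^-1) /\ ldom y i (0 - n.+1%:R^-1)) /\
    lfun y i (0 + n.+1%:R^-1) + lfun y i (0 - n.+1%:R^-1) <= 2 * lfun y i 0 + k.+1%:R^-1 * n.+1%:R^-1)) => n.
  apply: (measurableI ([set y | ldom y i (0 + n.+1%:R^-1)] `&` [set y | ldom y i (0 - n.+1%:R^-1)])).
    by apply: measurableI; exact: measurable_ldom.
  apply: measurable_ler_set.
    by apply: measurable_funD; exact: measurable_lfun.
  apply: measurable_funD; last exact: measurable_cst.
  by apply: measurable_funM; [exact: measurable_cst|exact: measurable_lfun].
apply/seteqP; split=> y /=.
  move=> /(kinkfree_harmonicP _ _ _ (line_conv_on y i))[D0 H]; split=> // k.
  by have [n [? ? ?]] := H k; exists n.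
move=> [D0 H]; apply/(kinkfree_harmonicP _ _ _ (line_conv_on y i)); split=> // k.
by have [n [[? ?] ?]] := H k; exists n.
Qed.

Lemma measurable_smooth_pt : measurable smooth_pt.
Proof.
apply: (measurableI [set y | (G y < +oo)%E] [set y | forall i, kinkfree (ldom y i) (lfun y i) 0]).
  by rewrite -[X in measurable X]setTI; apply: emeasurable_fun_infty_o.
apply: (measurable_forall _ _ _ (fun i y => kinkfree (ldom y i) (lfun y i) 0)) => i.
exact: measurable_kinkfree.
Qed.

Lemma nonsmooth_null (leb : {measure set E -> \bar R}) : is_lebesgue leb -> forall i,
  leb ([set y | (G y < +oo)%E] `\` [set y | kinkfree (ldom y i) (lfun y i) 0]) = 0%E.
Proof.
move=> hleb i; apply: (leb_countable_lines _ hleb (tbasis i)).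
  apply: measurableD; last exact: measurable_kinkfree.
  by rewrite -[X in measurable X]setTI; apply: emeasurable_fun_infty_o.
move=> x; apply: sub_countable (conv_on_kinks_countable _ _ (line_conv_on x i)).
apply: subset_card_le => t [Dt nk]; split=> // -[_ H]; apply: nk; split.
  by rewrite ldom_shift addr0.
move=> e /H[s [s0 D1 D2 Hs]]; exists s.
by rewrite !ldom_shift !lfun_shift add0r sub0r addr0.
Qed.

End LineFunctions.

(** * The Legendre transform [psi] and its relation to [Q2] *)

Section Psi.
Context {R : realType} {d : nat}.
Local Notation E := (d.-tuple R).
Variable phi : E -> R.
Let psi := legendre (fun x => (phibar0 phi x)%:E).

Lemma le_psi x y : ((dotp x y - phibar0 phi x)%:E <= psi y)%E.
Proof. by apply: ereal_sup_ubound; exists x. Qed.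

Lemma psi_neqNy y : psi y != -oo%E.
Proof.
apply/negP => /eqP H.
by have := le_psi [tuple 0 | i < d] y; rewrite H leeNy_eq.
Qed.

Lemma le_Q2 x y : ((phi x - sqn (tsub x y))%:E <= Q2 phi y)%E.
Proof. by apply: ereal_sup_ubound; exists x. Qed.

Lemma phibar0E x y : phi x - sqn (tsub x y) = 2 * (dotp x y - phibar0 phi x) - sqn y.
Proof. by rewrite sqn_tsub /phibar0; lra. Qed.

Lemma Q2_psi y : Q2 phi y = (2%:E * psi y - (sqn y)%:E)%E.
Proof.
apply/eqP; rewrite eq_le; apply/andP; split.
  apply: ge_ereal_sup => _ [x _ <-]; rewrite phibar0E EFinB EFinM.
  by apply: leeB => //; rewrite lee_pmul2l// le_psi.
rewrite leeBlDr//.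
suff H : (psi y <= 2^-1%:E * (Q2 phi y + (sqn y)%:E))%E.
  rewrite (le_trans (y := 2%:E * (2^-1%:E * (Q2 phi y + (sqn y)%:E)))%E)//.
    by rewrite lee_pmul2l.
  by rewrite muleA -EFinM divff// mul1e.
apply: ge_ereal_sup => _ [x _ <-]; rewrite lee_pdivlMl// -leeBlDr//.
by have := le_Q2 x y; rewrite phibar0E.
Qed.

Lemma psi_elsc : elsc psi.
Proof.
move=> y a /ereal_sup_gt[_ [x _ <-]]; rewrite -EFinB lte_fin => ax.
have e0 : 0 < dotp x y - phibar0 phi x - a by rewrite subr_gt0.
have lip : n1_lip (n1 x) (dotp x).
  move=> z w; rewrite /dotp -sumrB; apply: le_trans (ler_norm_sum _ _ _) _.
  rewrite [n1 (tsub z w)]/n1 mulr_sumr; apply: ler_sum => i _; rewrite -mulrBr normrM tnthE.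
  by rewrite ler_wpM2r// tnth_le_n1.
have [del del0 H] := n1_lip_continuous _ _ (n1_ge0 x) lip y _ e0.
exists del => // z /H; rewrite ltr_norml => /andP[H1 _].
by apply: lt_le_trans (le_psi x z); rewrite lte_fin; lra.
Qed.

Lemma psi_measurable : measurable_fun setT psi.
Proof. by apply: elsc_measurable; exact: psi_elsc. Qed.

Lemma sqn_measurable : measurable_fun setT (@sqn R d).
Proof.
rewrite (_ : sqn = fun x : E => \sum_(i < d) tnth x i ^+ 2); last by apply/funext => x; rewrite sqnE.
by apply: measurable_sum => i; apply: measurable_funX; exact: measurable_tnth.
Qed.

Lemma Q2_measurable : measurable_fun setT (Q2 phi).
Proof.
rewrite (_ : Q2 phi = fun y => (2%:E * psi y - (sqn y)%:E)%E); last by apply/funext => y; exact: Q2_psi.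
apply: emeasurable_funB; last by apply/measurable_EFinP; exact: sqn_measurable.
by apply: measurable_funeM; exact: psi_measurable.
Qed.

Hypothesis cphi : econvex (fun x => (phi x)%:E).

(* [psi - |.|^2 / 2] is half of [sup_z (phi (. + z) - |z|^2)], a supremum of convex functions. *)
Lemma psi_unif_convex x y t : 0 <= t <= 1 ->
  (psi (seg x y t) + (t * (1 - t) * (sqn (tsub x y) / 2))%:E <= (1 - t)%:E * psi x + t%:E * psi y)%E.
Proof.
move=> t01; have /andP[t0 t1] := t01.
rewrite -leeBrDr//; apply: ge_ereal_sup => _ [z _ <-]; rewrite leeBrDr//.
(* Both points keep the displacement of [z] from [seg x y t], so the quadratic parts match exactly
   ([Q] below) and only [phi] is compared by convexity. *)
pose u := tadd z (tsub x (seg x y t)); pose w := tadd z (tsub y (seg x y t)).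
have zE : z = seg u w t by apply: eq_from_tnth => i; rewrite !tnthE; ring.
have := (econvexR phi).1 cphi u w t t01; rewrite -zE => H.
have := lee_wpmul2l (_ : 0 <= (1 - t)%:E)%E (le_psi u x); rewrite lee_fin subr_ge0 => /(_ t1) Hx.
have := lee_wpmul2l (_ : 0 <= t%:E)%E (le_psi w y); rewrite lee_fin => /(_ t0) Hy.
apply: le_trans (leeD Hx Hy); rewrite -EFinB -!EFinM -!EFinD lee_fin /phibar0.
have Q : dotp z (seg x y t) - sqn z / 2 + t * (1 - t) * (sqn (tsub x y) / 2) =
   (1 - t) * (dotp u x - sqn u / 2) + t * (dotp w y - sqn w / 2).
  rewrite /sqn /dotp !mulr_suml -!sumrB !mulr_sumr -!big_split/=.
  by apply: eq_bigr => i _; rewrite /u /w !tnthE; field.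
lra.
Qed.

Lemma psi_econvex : econvex psi.
Proof.
move=> x y t t01; have /andP[t0 t1] := t01.
apply: le_trans (psi_unif_convex x y t t01); rewrite leeDl// lee_fin.
by rewrite !mulr_ge0 ?subr_ge0 ?invr_ge0 ?sqn_ge0.
Qed.

End Psi.

(** * Danskin's formula *)

Section Danskin.
Context {R : realType} {d : nat}.
Local Notation E := (d.-tuple R).

(** The inverse of 1 plus the sum of reciprocals replaces a minimum and also makes sense for an
    empty index set. *)
Lemma finite_lower_bound (m : 'I_d -> R) : (forall i, 0 < m i) ->
  exists2 m0, 0 < m0 & forall i, m0 <= m i.
Proof.
move=> mp; have S0 : 0 <= \sum_(i < d) (m i)^-1.
  by apply: sumr_ge0 => i _; rewrite invr_ge0 ltW.
exists (1 + \sum_(i < d) (m i)^-1)^-1; first by rewrite invr_gt0 ltr_pwDl.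
move=> i; rewrite invf_ple ?posrE ?ltr_pwDl//; apply: (@le_trans _ _ (\sum_(i < d) (m i)^-1)).
  by rewrite (bigD1 i)//= lerDl sumr_ge0// => j _; rewrite invr_ge0 ltW.
by rewrite lerDr.
Qed.

Lemma dotp_le_n1 (x v : E) : `|dotp x v| <= n1 v * n1 x.
Proof.
apply: le_trans (ler_norm_sum _ _ _) _; rewrite [n1 x]/n1 mulr_sumr; apply: ler_sum => i _.
by rewrite normrM mulrC ler_wpM2r// tnth_le_n1.
Qed.

Lemma sqn_continuous (y : E) : continuous_on_Rd (fun x => sqn (tsub x y)).
Proof.
move=> x e e0; have v0 := n1_ge0 (tsub x y).
pose c := e / (4 * (n1 (tsub x y) + 1)).
have k0 : 0 < 4 * (n1 (tsub x y) + 1) by rewrite mulr_gt0// ltr_pwDr.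
have c0 : 0 < c by rewrite divr_gt0.
have cE : c * (4 * (n1 (tsub x y) + 1)) = e by rewrite divfK// gt_eqF.
exists (Num.min (e / 2) ((c / d.+1%:R) ^+ 2)).
  by rewrite lt_min divr_gt0//= exprn_gt0// divr_gt0.
move=> w; rewrite lt_min => /andP[H1 /(n1_lt_sqn _ _ c0) H2].
have -> : sqn (tsub w y) - sqn (tsub x y) = sqn (tsub w x) + 2 * dotp (tsub w x) (tsub x y).
  rewrite /sqn /dotp mulr_sumr -sumrB -big_split/=; apply: eq_bigr => i _.
  by rewrite !tnthE; ring.
have /ler_normlP[H3 H4] := dotp_le_n1 (tsub w x) (tsub x y).
have H5 := ler_wpM2l v0 (ltW H2); have H6 := sqn_ge0 (tsub w x).
rewrite ltr_norml; apply/andP; split; lra.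
Qed.

Variable phi : E -> R.
Hypothesis cphi : econvex (fun x => (phi x)%:E).
Let psi := legendre (fun x => (phibar0 phi x)%:E).
Let T := grad psi.

Let cpsi : econvex psi := psi_econvex phi cphi.
Let psiNy : forall y, psi y != -oo%E := psi_neqNy phi.

(** An almost maximizer [x] gives an affine minorant of [psi] of slope [x], within [m] of [psi] at
    [y]. Testing it at increments [s] and [- s] along axis [i] confines the coordinate: half of [e]
    pays for the second difference, the other half for [m = e / 2 * s]. *)
Lemma near_max_coord y i (e : R) : smooth_pt psi y -> 0 < e ->
  exists2 m, 0 < m & forall x, fine (psi y) - m <= dotp x y - phibar0 phi x ->
    `|tnth x i - tnth (T y) i| <= e.
Proof.
move=> [yfin /(_ i) kf] e0.
have cl := line_conv_on psi cpsi psiNy y i.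
have [t [tL tR]] := kinkfree_slope _ _ _ cl kf.
have -> : tnth (T y) i = t.
  by rewrite /T /grad tnth_mktuple; exact: (kinkfree_derive _ _ _ _ cl kf tL tR).
have e2 : 0 < e / 2 by rewrite divr_gt0.
have [D0 /(_ _ e2)[s [s0 D1 D2 H]]] := kf.
exists (e / 2 * s); first by rewrite mulr_gt0.
have A w x : ldom psi y i w -> dotp x y + w * tnth x i - phibar0 phi x <= lfun psi y i w.
  move=> Dw; have := le_psi phi x (tadd y (tscale w (tbasis i))).
  by rewrite dotp_line -/psi (ldomE _ psiNy _ _ _ Dw) lee_fin.
have f0 : lfun psi y i 0 = fine (psi y) by rewrite /lfun tscale0.
move=> x Hx; rewrite add0r in D1 H; rewrite sub0r in D2 H.
have := tL s s0; rewrite sub0r => /(_ D2) H1.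
have := tR s s0; rewrite add0r => /(_ D1) H2.
have B1 := A _ x D1; have B2 := A _ x D2.
rewrite ler_norml; apply/andP; split; rewrite -(ler_pM2l s0); lra.
Qed.

Lemma near_max y (e : R) : smooth_pt psi y -> 0 < e ->
  exists2 m, 0 < m & forall x, fine (psi y) - m <= dotp x y - phibar0 phi x ->
    forall i, `|tnth x i - tnth (T y) i| <= e.
Proof.
move=> sy e0.
have /choice[m_ H] : forall i, exists m, 0 < m /\ forall x,
    fine (psi y) - m <= dotp x y - phibar0 phi x -> `|tnth x i - tnth (T y) i| <= e.
  by move=> i; have [m m0 Hm] := near_max_coord y i e sy e0; exists m.
have [m m0 Hm] := finite_lower_bound m_ (fun i => (H i).1).
exists m => // x Hx i; apply: (H i).2; apply: le_trans Hx.
by rewrite lerD2l lerN2.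
Qed.

Lemma psi_fineK y : (psi y < +oo)%E -> psi y = (fine (psi y))%:E.
Proof. by move=> yfin; rewrite fineK// fin_numE psiNy lt_eqF. Qed.

Lemma Q2_fin y : (psi y < +oo)%E -> Q2 phi y = (2 * fine (psi y) - sqn y)%:E.
Proof. by move=> yfin; rewrite Q2_psi -/psi psi_fineK. Qed.

Lemma close_sqn (x z : E) (e del : R) : 0 < e -> d.+1%:R * e ^+ 2 <= del ->
  (forall i, `|tnth x i - tnth z i| <= e) -> sqn (tsub x z) < del.
Proof.
move=> e0 ed H; apply: lt_le_trans ed; apply: sqn_lt_tnth => // i.
by rewrite tnthE.
Qed.

Lemma exists_close (del : R) : 0 < del -> exists2 e : R, 0 < e & d.+1%:R * e ^+ 2 <= del.
Proof.
move=> del0; have D0 : 0 < d.+1%:R :> R by [].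
exists (Num.min 1 (del / d.+1%:R)); first by rewrite lt_min ltr01 divr_gt0.
set e := Num.min _ _; have e1 : e <= 1 by rewrite ge_min lexx.
have e0 : 0 <= e by rewrite le_min ler01 divr_ge0// ltW.
have : e <= del / d.+1%:R by rewrite ge_min lexx orbT.
rewrite ler_pdivlMr// mulrC => ed; apply: le_trans ed.
by rewrite ler_pM2l// expr2 ler_piMr.
Qed.

Hypothesis kphi : continuous_on_Rd phi.

(** Almost maximizers approach [T y], where the objective is continuous, so its value there is the
    supremum. *)
Lemma Q2_attained y : smooth_pt psi y -> Q2 phi y = (phi (T y) - sqn (tsub (T y) y))%:E.
Proof.
move=> sy; have yfin := sy.1.
apply/eqP; rewrite eq_le le_Q2 andbT (Q2_fin _ yfin) lee_fin.
apply/ler_addgt0Pr => e e0; have e2 : 0 < e / 2 by rewrite divr_gt0.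
have ku := continuous_on_Rd_comb _ _ 1 (-1) kphi (sqn_continuous y).
have [del del0 Hdel] := ku (T y) _ e2.
have [c c0 cdel] := exists_close _ del0.
have [m m0 Hm] := near_max y c sy c0.
(* A gap [k] in [psi] doubles in [Q2], hence [e / 4]; continuity uses the other half of [e]. *)
pose k := Num.min m (e / 4).
have k0 : 0 < k by rewrite lt_min m0 divr_gt0.
have pf : psi y \is a fin_num by rewrite fin_numE psiNy lt_eqF.
have [_ [x _ <-]] := ub_ereal_sup_adherent k0 pf.
rewrite -[ereal_sup _]/(psi y) => Hx0.
have Hx : fine (psi y) - k < dotp x y - phibar0 phi x.
  by move: Hx0; rewrite {1}(psi_fineK _ yfin).
have xm : fine (psi y) - m <= dotp x y - phibar0 phi x.
  by apply: le_trans (ltW Hx); rewrite lerD2l lerN2 ge_min lexx.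
have := Hdel x (close_sqn _ _ _ _ c0 cdel (Hm x xm)).
rewrite ltr_norml !mul1r !mulN1r (phibar0E phi x y) => /andP[_ H].
have : k <= e / 4 by rewrite ge_min lexx orbT.
lra.
Qed.

(** [Q2] is convex in the function, as a supremum of affine functionals. This keeps the perturbed
    transforms finite between two finite ones and gives Fatou its sign. *)
Lemma Q2_segment (u : E -> R) y (e : R) : 0 <= e <= 1 ->
  (Q2 (fun x => phi x + e * u x)%R y <= (1 - e)%:E * Q2 phi y + e%:E * Q2 (fun x => phi x + u x)%R y)%E.
Proof.
move=> /andP[e0 e1]; apply: ge_ereal_sup => _ [x _ <-].
have := lee_wpmul2l (_ : 0 <= (1 - e)%:E)%E (le_Q2 phi x y); rewrite lee_fin subr_ge0 => /(_ e1) H1.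
have := lee_wpmul2l (_ : 0 <= e%:E)%E (le_Q2 (fun x => phi x + u x) x y); rewrite lee_fin => /(_ e0) H2.
by apply: le_trans (leeD H1 H2); rewrite -!EFinM -!EFinD lee_fin; lra.
Qed.

(* Away from the maximizer the concave gap [m] beats the perturbation; near it [u] is close to [u (T y)]. *)
Lemma danskin (u : E -> R) y (eta : R) : continuous_on_Rd u -> smooth_pt psi y ->
  (Q2 (fun x => phi x + u x)%R y < +oo)%E -> 0 < eta ->
  exists2 e0, 0 < e0 & forall e, 0 < e -> e <= e0 ->
    (Q2 (fun x => phi x + e * u x)%R y <= Q2 phi y + (e * (u (T y) + eta))%:E)%E.
Proof.
move=> ku sy Hfin eta0; have yfin := sy.1.
set h0 := phi (T y) - sqn (tsub (T y) y).
have h0E : Q2 phi y = h0%:E := Q2_attained y sy.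
have h0P : h0 = 2 * fine (psi y) - sqn y by move: h0E; rewrite (Q2_fin _ yfin) => -[].
have [H HE] : exists H : R, Q2 (fun x => phi x + u x)%R y = H%:E.
  exists (fine (Q2 (fun x => phi x + u x)%R y)); rewrite fineK// fin_numE (lt_eqF Hfin) andbT.
  by rewrite gt_eqF//; apply: lt_le_trans (le_Q2 _ y y); exact: ltNyr.
have [del del0 Hdel] := ku (T y) _ eta0.
have [c c0 cdel] := exists_close _ del0.
have [m m0 Hm] := near_max y c sy c0.
(* Far from [T y] the objective is at most [h0 - 2 m] at step 0 and at most [H] at step 1. By
   interpolation the claim becomes [e * (2 m + H - h0 - u (T y) - eta) <= 2 m], which [e <= m / K]
   ensures. *)
pose K := `|2 * m + H - h0 - u (T y) - eta| + 1.
have K0 : 0 < K by rewrite ltr_pwDr.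
exists (Num.min 1 (m / K)); first by rewrite lt_min ltr01 divr_gt0.
move=> e e0; rewrite le_min => /andP[e1]; rewrite ler_pdivlMr// => eK.
rewrite h0E; apply: ge_ereal_sup => _ [x _ <-]; rewrite -EFinD lee_fin.
have B1 : phi x - sqn (tsub x y) <= h0 by have := le_Q2 phi x y; rewrite h0E lee_fin.
have B2 : phi x + u x - sqn (tsub x y) <= H.
  by have := le_Q2 (fun x => phi x + u x) x y; rewrite HE lee_fin.
case: (leP (fine (psi y) - m) (dotp x y - phibar0 phi x)) => Hx.
  have := Hdel x (close_sqn _ _ _ _ c0 cdel (Hm x Hx)).
  rewrite ltr_norml => /andP[_ Hu].
  have : e * (u x - u (T y)) <= e * eta by rewrite ler_pM2l// ltW.
  lra.
have B3 : phi x - sqn (tsub x y) <= h0 - 2 * m by rewrite phibar0E h0P; lra.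
have B4 := ler_wpM2l (_ : 0 <= 1 - e) B3; rewrite subr_ge0 in B4.
have {}B4 := B4 e1.
have B5 := ler_wpM2l (ltW e0) B2.
have B6 : e * (2 * m + H - h0 - u (T y) - eta) <= m.
  apply: le_trans eK; rewrite ler_pM2l//; apply: le_trans (ler_norm _) _.
  by rewrite lerDl.
lra.
Qed.

End Danskin.

(** * Integration *)

Section IntegrationTools.
Context {R : realType} {dsp : measure_display} {X : measurableType dsp}.
Variable m : {measure set X -> \bar R}.
Implicit Types (D : set X) (f g : X -> \bar R).

Lemma limn_einf_ub (u : (\bar R)^nat) (K : \bar R) : (forall n, u n <= K)%E -> (limn_einf u <= K)%E.
Proof.
move=> H; rewrite limn_einf_lim; apply: lime_le; first exact: is_cvg_einfs.
near=> n; apply: le_trans (H n); apply: ereal_inf_lbound; exists n => //=.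
Unshelve. all: by end_near. Qed.

(** Integrability of the limit is part of the conclusion: this is how [u o T] is shown integrable
    before any moment of the law of [T] is known. *)
Lemma fatou_bounded D (f : nat -> X -> R) (L : X -> R) (K : R) : measurable D ->
    (forall n, measurable_fun D (f n)) -> (forall n x, D x -> 0 <= f n x) ->
    (forall x, D x -> f n x @[n --> \oo] --> L x) ->
    (forall n, (\int[m]_(x in D) (f n x)%:E <= K%:E)%E) ->
  m.-integrable D (EFin \o L) /\ (\int[m]_(x in D) (L x)%:E <= K%:E)%E.
Proof.
move=> mD mf f0 fL fK.
have mL : measurable_fun D L by exact: (@measurable_fun_cvg _ _ _ _ f).
have L0 x : D x -> 0 <= L x.
  move=> Dx; apply: (cvgr_to_ge (fL x Dx)).
  by near=> n; exact: f0.
have IL : (\int[m]_(x in D) (L x)%:E <= K%:E)%E.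
  have := @fatou _ _ _ m D mD (fun n x => (f n x)%:E).
  rewrite (@eq_integral _ _ _ m D (fun x => (L x)%:E)); last first.
    move=> x /set_mem Dx.
    have /cvg_limn_einf_sup[-> _]// : (f n x)%:E @[n --> \oo] --> (L x)%:E.
    by apply/fine_cvgP; split; [exact: nearW|exact: fL].
  move=> /(_ _ _) H; apply: le_trans (H _ _) _.
  - by move=> n; apply/measurable_EFinP.
  - by move=> n x Dx; rewrite lee_fin f0.
  exact: limn_einf_ub.
split=> //; apply/integrableP; split; first exact/measurable_EFinP.
rewrite (eq_integral (fun x => (L x)%:E)); first by apply: le_lt_trans IL _; exact: ltry.
by move=> x /set_mem Dx; rewrite gee0_abs// lee_fin L0.
Unshelve. all: by end_near. Qed.

Lemma integrable_between D f g1 g2 : measurable D -> measurable_fun D f ->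
  m.-integrable D g1 -> m.-integrable D g2 ->
  (forall x, D x -> g1 x <= f x)%E -> (forall x, D x -> f x <= g2 x)%E -> m.-integrable D f.
Proof.
move=> mD mf i1 i2 H1 H2.
apply: (@le_integrable _ _ _ m D mD _ (fun x => `|g1 x| + `|g2 x|)%E) => //.
  move=> x Dx; rewrite [X in (_ <= X)%E]gee0_abs ?adde_ge0//.
  case: (leP 0%E (f x)) => fx.
    rewrite gee0_abs//; apply: (@le_trans _ _ `|g2 x|%E); last by rewrite leeDr.
    by apply: le_trans (lee_abs _); exact: H2.
  rewrite lte0_abs//; apply: (@le_trans _ _ `|g1 x|%E); last by rewrite leeDl.
  by rewrite -(abseN (g1 x)); apply: le_trans (lee_abs _); rewrite leeN2; exact: H1.
by apply: integrableD => //; exact: integrable_abse.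
Qed.

Lemma integrable_bounded_below f g : measurable_fun setT f -> m.-integrable setT g ->
  (forall x, g x <= f x)%E -> (\int[m]_x f x < +oo)%E -> m.-integrable setT f.
Proof.
move=> mf ig H If; apply/integrableP; split=> //.
have fn : (\int[m]_x f^\- x < +oo)%E.
  apply: le_lt_trans (integral_funeneg_lt_pinfty measurableT ig).
  apply: ge0_le_integral => //; [exact: measurable_funeneg|exact/measurable_funeneg/measurable_int/ig|].
  by move=> x _; rewrite !funenegE ge_max !le_max lexx orbT andbT leeN2 H.
have fnf : (\int[m]_x f^\- x)%E \is a fin_num.
  by rewrite ge0_fin_numE; [exact: fn|apply: integral_ge0 => x _; rewrite funenegE le_max lexx orbT].
have fp : (\int[m]_x f^\+ x < +oo)%E.
  by move: If; rewrite integralE lteBlDr// => /lt_le_trans; apply; exact: leey.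
rewrite (eq_integral (fun x => f^\+ x + f^\- x)%E); last first.
  by move=> x _; have := congr1 (fun h => h x) (fune_abse f).
rewrite ge0_integralD//; [exact: lte_add_pinfty|exact: measurable_funepos|exact: measurable_funeneg].
Qed.

Lemma integral_full D f : measurable D -> m (~` D) = 0%E -> measurable_fun setT f ->
  m.-integrable D f -> m.-integrable setT f /\ (\int[m]_x f x = \int[m]_(x in D) f x)%E.
Proof.
move=> mD D0 mf fi; have mDC := measurableC mD.
have DE : D = setT `\` ~` D by rewrite setTD setCK.
have fT : m.-integrable setT f by apply/(negligible_integrable mDC measurableT mf D0); rewrite -DE.
by split=> //; rewrite (negligible_integral mDC measurableT fT D0) -DE.
Qed.

Lemma integrable_pinfty_null f : m.-integrable setT f -> m [set x | f x = +oo%E] = 0%E.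
Proof.
move=> fi; have mf := measurable_int m fi; have := integrable_ae measurableT fi => -[A [mA A0 H]].
apply: (subset_measure0 _ mA _ A0) => [|x /= fx].
  by have := mf measurableT _ (emeasurable_set1 +oo%E); rewrite setTI.
by apply: H => /= /(_ I); rewrite fx.
Qed.

End IntegrationTools.

Section QuadraticGrowth.
Context {R : realType} {d : nat}.
Local Notation E := (d.-tuple R).

Lemma integrable_quad (m : probability E R) (f : E -> R) : in_P2 m ->
  measurable_fun setT f -> quad_growth f -> m.-integrable setT (EFin \o f).
Proof.
move=> m2 mf [C HC].
have isq : m.-integrable setT (fun x => (sqn x)%:E).
  apply/integrableP; split; first by apply/measurable_EFinP; exact: sqn_measurable.
  by rewrite (eq_integral (fun x => (sqn x)%:E))// => x _; rewrite gee0_abs// lee_fin sqn_ge0.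
have i1 : m.-integrable setT (fun x => C%:E * (1 + (sqn x)%:E))%E.
  apply: integrableZl => //; apply: integrableD => //.
  exact: (finite_measure_integrable_cst m 1).
apply: le_integrable i1 => //; first exact/measurable_EFinP.
move=> x _; rewrite /= lee_fin; apply: le_trans (HC x) _.
by rewrite ler_norm.
Qed.

Lemma Q2_integrable (m : probability E R) (w : E -> R) : in_P2 m ->
  measurable_fun setT w -> quad_growth w -> (\int[m]_y Q2 w y < +oo)%E ->
  m.-integrable setT (Q2 w).
Proof.
move=> m2 mw qw; apply: integrable_bounded_below; [exact: Q2_measurable|exact: (integrable_quad _ _ m2 mw qw)|].
move=> x; apply: le_trans (le_Q2 w x x); rewrite lee_fin.
by rewrite sqn_refl subr0.
Qed.

End QuadraticGrowth.

Section LinearCombination.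
Context {R : realType} {dsp : measure_display} {X : measurableType dsp}.
Variable m : {measure set X -> \bar R}.

Lemma integral_comb D (f g : X -> R) (a b i j : R) : measurable D ->
    m.-integrable D (EFin \o f) -> m.-integrable D (EFin \o g) ->
    (\int[m]_(x in D) (f x)%:E)%E = i%:E -> (\int[m]_(x in D) (g x)%:E)%E = j%:E ->
  m.-integrable D (EFin \o (fun x => a * f x + b * g x)) /\
  (\int[m]_(x in D) (a * f x + b * g x)%:E)%E = (a * i + b * j)%:E.
Proof.
move=> mD fi gi Hi Hj.
have fa : m.-integrable D (fun x => a%:E * (f x)%:E)%E by exact: integrableZl.
have gb : m.-integrable D (fun x => b%:E * (g x)%:E)%E by exact: integrableZl.
split; first exact: (integrableD mD fa gb).
rewrite (eq_integral (fun x => a%:E * (f x)%:E + b%:E * (g x)%:E)%E)//.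
by rewrite integralD// !integralZl// Hi Hj.
Qed.

Lemma integral_fine D (f : X -> \bar R) : measurable D -> m.-integrable D f ->
  (\int[m]_(x in D) f x)%E = (fine (\int[m]_(x in D) f x)%E)%:E.
Proof. by move=> mD fi; rewrite fineK//; exact: integrable_fin_num. Qed.

End LinearCombination.

(** * Danskin's formula under the integral *)

Section DanskinIntegral.
Context {R : realType} {d : nat}.
Local Notation E := (d.-tuple R).
Variables (phi : E -> R) (nu : probability E R).
Hypotheses (cphi : econvex (fun x => (phi x)%:E)) (kphi : continuous_on_Rd phi)
  (qphi : quad_growth phi) (nu2 : in_P2 nu).
Let psi := legendre (fun x => (phibar0 phi x)%:E).
Let T := grad psi.
Hypotheses (smooth_ae : nu (~` smooth_pt psi) = 0%E) (iQ : nu.-integrable setT (Q2 phi)).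

Let cpsi : econvex psi := psi_econvex phi cphi.
Let psiNy : forall y, psi y != -oo%E := psi_neqNy phi.
Let mpsi : measurable_fun setT psi := psi_measurable phi.

Lemma transport_measurable : measurable_fun setT T.
Proof. exact: (grad_measurable psi cpsi psiNy mpsi). Qed.

Lemma Q2_perturb_integrable (u : E -> R) (e : R) : continuous_on_Rd u -> quad_growth u ->
    nu.-integrable setT (Q2 (fun x => phi x + u x)) -> 0 <= e <= 1 ->
  nu.-integrable setT (Q2 (fun x => phi x + e * u x)).
Proof.
move=> ku qu iu e01.
pose w x := 1 * phi x + e * u x.
have wE : (fun x => phi x + e * u x) = w by apply/funext => x; rewrite /w mul1r.
have kw : continuous_on_Rd w by exact: continuous_on_Rd_comb.
have qw : quad_growth w by exact: quad_growth_comb.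
apply: (integrable_between _ setT _ (EFin \o w) (fun y => (1 - e)%:E * Q2 phi y + e%:E * Q2 (fun x => phi x + u x)%R y)%E) => //.
- exact: Q2_measurable.
- apply: integrable_quad => //; exact: continuous_on_Rd_measurable.
- by apply: integrableD => //; exact: integrableZl.
- move=> y _; rewrite wE; apply: le_trans (le_Q2 w y y); rewrite lee_fin.
  by rewrite sqn_refl subr0.
- by move=> y _; exact: Q2_segment.
Qed.

Lemma Q2_finE (w : E -> R) y : (Q2 w y < +oo)%E -> Q2 w y = (fine (Q2 w y))%:E.
Proof.
move=> wy; rewrite fineK// fin_numE (lt_eqF wy) andbT gt_eqF//.
by apply: lt_le_trans (le_Q2 w y y); exact: ltNyr.
Qed.

(** The difference quotients at step [1/(n+1)] stay below the chord [Q2 (phi + u) - Q2 phi] and tend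
    to [u (T y)], while their integrals are at least [c]. Fatou is applied to chord minus
    quotient. *)
Lemma danskin_integral (u : E -> R) (c : R) : continuous_on_Rd u -> quad_growth u ->
    nu.-integrable setT (Q2 (fun x => phi x + u x)) ->
    (forall e, 0 < e -> e <= 1 ->
      ((e * c)%:E + \int[nu]_y Q2 phi y <= \int[nu]_y Q2 (fun x => phi x + e * u x)%R y)%E) ->
  nu.-integrable setT (fun y => (u (T y))%:E) /\ (c%:E <= \int[nu]_y (u (T y))%:E)%E.
Proof.
move=> ku qu iu Hc.
(* A set of full [nu]-measure on which all transforms involved are finite, so that quotients can be
   formed in [R]. *)
pose D := smooth_pt psi `&` [set y | (Q2 (fun x => phi x + u x)%R y < +oo)%E].
have mS : measurable (smooth_pt psi) by exact: (measurable_smooth_pt psi cpsi psiNy mpsi).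
have mF (w : E -> R) : measurable [set y | (Q2 w y < +oo)%E].
  rewrite -[X in measurable X]setTI; apply: emeasurable_fun_infty_o => //; exact: Q2_measurable.
have mD : measurable D by exact: measurableI.
have mB : measurable [set y | Q2 (fun x => phi x + u x) y = +oo%E].
  have := Q2_measurable (fun x => phi x + u x) measurableT _ (emeasurable_set1 +oo%E).
  by rewrite setTI.
have mA := measurableC mS.
have D0 : nu (~` D) = 0%E.
  apply: (subset_measure0 (B := ~` smooth_pt psi `|` [set y | Q2 (fun x => phi x + u x) y = +oo%E])).
  - exact: measurableC.
  - exact: measurableU.
  - move=> y /= nD; have [sy|] := pselect (smooth_pt psi y); last by left.
    right; apply/eqP; rewrite -leye_eq leNgt; apply/negP => H; exact/nD.
  - have H := integrable_pinfty_null nu _ iu.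
    apply/eqP; rewrite eq_le measure_ge0 andbT.
    apply: (@le_trans _ _ (nu (~` smooth_pt psi) + nu [set y | Q2 (fun x => phi x + u x)%R y = +oo])%E).
      exact: measureU2.
    by rewrite smooth_ae H adde0.
have Dphi y : D y -> (Q2 phi y < +oo)%E.
  by move=> [sy _]; rewrite (Q2_fin _ _ sy.1) ltry.
have De y e : 0 <= e <= 1 -> D y -> (Q2 (fun x => phi x + e * u x)%R y < +oo)%E.
  move=> e01 Dy; apply: le_lt_trans (Q2_segment phi u y e e01) _.
  by rewrite (Q2_finE _ _ (Dphi y Dy)) (Q2_finE _ _ Dy.2) -!EFinM -EFinD ltry.
have fineD (w : E -> R) : nu.-integrable setT (Q2 w) -> (forall y, D y -> (Q2 w y < +oo)%E) ->
    [/\ nu.-integrable D (EFin \o (fun y => fine (Q2 w y))), 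
      (\int[nu]_(y in D) (fine (Q2 w y))%:E)%E = (fine (\int[nu]_y Q2 w y)%E)%:E &
      measurable_fun D (fun y => fine (Q2 w y))].
  move=> iw Hw; have iwD : nu.-integrable D (Q2 w) by apply: integrableS iw.
  have eqD : {in D, Q2 w =1 EFin \o (fun y => fine (Q2 w y))}.
    by move=> y /set_mem Dy /=; exact/Q2_finE/Hw.
  have iD' : nu.-integrable D (EFin \o (fun y => fine (Q2 w y))) by exact: eq_integrable iwD.
  split=> //.
    rewrite -integral_fine//.
    have [_ ->] := integral_full nu D (Q2 w) mD D0 (Q2_measurable w) iwD.
    by apply: eq_integral => y Dy; rewrite eqD.
  apply: measurable_funTS; apply: (measurableT_comp (@fine_measurable R setT measurableT)).
  exact: Q2_measurable.
pose e_ (n : nat) : R := n.+1%:R^-1.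
have e_01 n : 0 < e_ n /\ e_ n <= 1 by rewrite invr_gt0 ltr0Sn invf_le1// ler1n.
have eN n : n.+1%:R * e_ n = 1 by rewrite mulfV.
pose h0 y := fine (Q2 phi y).
pose H y := fine (Q2 (fun x => phi x + u x) y).
pose hn n y := fine (Q2 (fun x => phi x + e_ n * u x) y).
have [i0 I0 m0] := fineD phi iQ Dphi.
have [iH IH mH] := fineD _ iu (fun y Dy => Dy.2).
have e_w n : 0 <= e_ n <= 1 by have [/ltW -> ->] := e_01 n.
have iun n := Q2_perturb_integrable u (e_ n) ku qu iu (e_w n).
have hnP n := fineD _ (iun n) (fun y Dy => De y (e_ n) (e_w n) Dy).
set a0 := fine _ in I0; set aH := fine _ in IH.
pose an n := fine (\int[nu]_y Q2 (fun x => phi x + e_ n * u x)%R y)%E.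
have can n : c <= n.+1%:R * (an n - a0).
  have [e0 e1] := e_01 n; have := Hc _ e0 e1.
  rewrite (integral_fine nu setT (Q2 phi) measurableT iQ) (integral_fine nu setT _ measurableT (iun n)) -EFinD lee_fin.
  rewrite -/a0 -/(an n) => Hle.
  have : n.+1%:R * (e_ n * c) <= n.+1%:R * (an n - a0) by rewrite ler_pM2l//; lra.
  by rewrite mulrA eN mul1r.
(* This is [(H - h0) - (n+1) (hn - h0)], spelled in the shape of [integral_comb]. *)
pose f n y := 1 * (1 * H y + n%:R * h0 y) + (- n.+1%:R) * hn n y.
pose L y := H y - h0 y - u (T y).
have [||||iL LK] := fatou_bounded nu D f L (aH - a0 - c) mD.
- move=> n; have [_ _ mn] := hnP n.
  apply: measurable_funD; apply: measurable_funM => //; apply: measurable_funD.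
    by apply: measurable_funM.
  by apply: measurable_funM.
- move=> n y Dy; have := Q2_segment phi u y (e_ n) (e_w n).
  rewrite (Q2_finE _ _ (Dphi y Dy)) (Q2_finE _ _ Dy.2) (Q2_finE _ _ (De y _ (e_w n) Dy)).
  rewrite -!EFinM -EFinD lee_fin -/(h0 y) -/(H y) -/(hn n y) => Hle.
  have : n.+1%:R * hn n y <= n.+1%:R * ((1 - e_ n) * h0 y + e_ n * H y) by rewrite ler_pM2l.
  have -> : n.+1%:R * ((1 - e_ n) * h0 y + e_ n * H y) = n.+1%:R * h0 y - (n.+1%:R * e_ n) * h0 y + (n.+1%:R * e_ n) * H y by ring.
  rewrite eN /f -natr1; lra.
- move=> y Dy; have sy := Dy.1.
  apply/(@cvgrPdist_le _ R^o) => eta eta0.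
  have [e0 e00 He] := danskin phi cphi kphi u y eta ku sy Dy.2 eta0.
  have [N NS] := harmonic_le e0 e00.
  near=> n.
  have Nn : (N <= n)%N by near: n; exists N.
  have [en0 en1] := e_01 n.
  have ene : e_ n <= e0 by apply: le_trans NS; rewrite lef_pV2 ?posrE// ler_nat ltnS.
  have := He _ en0 ene.
  rewrite (Q2_finE _ _ (Dphi y Dy)) (Q2_finE _ _ (De y _ (e_w n) Dy)) -EFinD lee_fin.
  rewrite -/(h0 y) -/(hn n y) -/psi -/(T y) => U1.
  (* The lower bound tests the perturbed supremum at [T y], which attains [Q2 phi y]. *)
  have := le_Q2 (fun x => phi x + e_ n * u x) (T y) y.
  rewrite (Q2_finE _ _ (De y _ (e_w n) Dy)) lee_fin -/(hn n y).
  have h0E : h0 y = phi (T y) - sqn (tsub (T y) y) by rewrite /h0 (Q2_attained phi cphi kphi y sy).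
  move=> U2.
  have V1 : n.+1%:R * hn n y <= n.+1%:R * (h0 y + e_ n * (u (T y) + eta)) by rewrite ler_pM2l.
  have V2 : n.+1%:R * (h0 y + e_ n * u (T y)) <= n.+1%:R * hn n y by rewrite ler_pM2l//; lra.
  have V3 : n.+1%:R * (h0 y + e_ n * (u (T y) + eta)) = n.+1%:R * h0 y + (n.+1%:R * e_ n) * (u (T y) + eta) by ring.
  have V4 : n.+1%:R * (h0 y + e_ n * u (T y)) = n.+1%:R * h0 y + (n.+1%:R * e_ n) * u (T y) by ring.
  rewrite V3 eN in V1; rewrite V4 eN in V2.
  rewrite /L /f; move: V1 V2; rewrite -natr1 => V1 V2.
  rewrite ler_norml; apply/andP; split; lra.
- move=> n; have [i_n In mn] := hnP n.
  have [j1 J1] := integral_comb nu D H h0 1 n%:R aH a0 mD iH i0 IH I0.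
  have [_ ->] := integral_comb nu D _ (hn n) 1 (- n.+1%:R) _ _ mD j1 i_n J1 In.
  rewrite lee_fin -/(an n); have := can n; rewrite -natr1; lra.
have lE := integral_fine nu D _ mD iL; set l := fine _ in lE.
have lK : l <= aH - a0 - c by move: LK; rewrite [X in (X <= _)%E]lE lee_fin.
have [j1 J1] := integral_comb nu D H h0 1 (-1) aH a0 mD iH i0 IH I0.
have [j2 J2] := integral_comb nu D _ L 1 (-1) _ l mD j1 iL J1 lE.
have uE : (fun y => 1 * (1 * H y + -1 * h0 y) + -1 * L y) = u \o T.
  by apply/funext => y; rewrite /L /=; ring.
have mu_ : measurable_fun setT (fun y => (u (T y))%:E).
  apply/measurable_EFinP; apply: (measurableT_comp (continuous_on_Rd_measurable _ ku)).
  exact: transport_measurable.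
rewrite uE in j2.
have [k1 ->] := integral_full nu D _ mD D0 mu_ j2.
split=> //.
rewrite (eq_integral (fun y => (1 * (1 * H y + -1 * h0 y) + -1 * L y)%:E)); last first.
  by move=> y _; have := congr1 (fun h => h y) uE => /= ->.
by rewrite J2 lee_fin; lra.
Unshelve. all: by end_near. Qed.

End DanskinIntegral.

(** * Lipschitz envelopes of convex functions *)

Section ConvexLipschitzEnvelopes.
Context {R : realType} {d : nat}.
Local Notation E := (d.-tuple R).
Variable f : E -> R.
Hypothesis cf : econvex (fun x => (f x)%:E).

Let cfR : forall x y t, 0 <= t <= 1 -> f (seg x y t) <= (1 - t) * f x + t * f y :=
  (econvexR f).1 cf.

(** Induction on the number [k] of free coordinates: [tadd x v] lies on a segment joining two
    opposite faces, on which one coordinate fewer is free. *)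
Lemma convex_bounded_cube (k : nat) : (k <= d)%N -> forall x, exists M : R, forall v : E,
  (forall i, `|tnth v i| <= 1) -> (forall i : 'I_d, (k <= i)%N -> tnth v i = 0) ->
  f (tadd x v) <= M.
Proof.
elim: k => [|k IH] kd x.
  exists (f x) => v _ v0; rewrite (_ : tadd x v = x)//.
  by apply: eq_from_tnth => i; rewrite tnthE v0// addr0.
pose e := @tbasis R d (Ordinal kd).
have [M1 H1] := IH (ltnW kd) (tadd x e).
have [M2 H2] := IH (ltnW kd) (tsub x e).
exists (`|M1| + `|M2|) => v v1 v0.
pose w : E := [tuple if i == Ordinal kd then 0 else tnth v i | i < d].
have w1 i : `|tnth w i| <= 1.
  by rewrite tnth_mktuple; case: ifP => _; rewrite ?normr0// v1.
have w0 (i : 'I_d) : (k <= i)%N -> tnth w i = 0.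
  rewrite tnth_mktuple; case: eqP => // /eqP ik ki; apply: v0.
  rewrite ltn_neqAle ki andbT; apply: contra ik => /eqP ik; apply/eqP/val_inj.
  by rewrite /= ik.
have := v1 (Ordinal kd); set a := tnth v _ => /ler_normlP[a1 a2].
have t01 : 0 <= (1 + a) / 2 <= 1 by apply/andP; split; lra.
have -> : tadd x v = seg (tadd (tsub x e) w) (tadd (tadd x e) w) ((1 + a) / 2).
  apply: eq_from_tnth => i; rewrite !tnthE tnth_mktuple eq_sym.
  case: (eqVneq i (Ordinal kd)) => [->|ik]; rewrite ?mulr1n ?mulr0n; last by field.
  by rewrite -/a; field.
apply: le_trans (cfR _ _ _ t01) _.
have := H1 w w1 w0; have := H2 w w1 w0.
move: (ler_norm M1) (ler_norm M2) (normr_ge0 M1) (normr_ge0 M2) => A1 A2 A3 A4 B2 B1.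
have C1 : (1 + a) / 2 * f (tadd (tadd x e) w) <= (1 + a) / 2 * `|M1|.
  by apply: ler_wpM2l; [case/andP: t01|lra].
have C2 : (1 - (1 + a) / 2) * f (tadd (tsub x e) w) <= (1 - (1 + a) / 2) * `|M2|.
  by apply: ler_wpM2l; [lra|lra].
have C3 : (1 + a) / 2 * `|M1| <= `|M1| by apply: ler_piMl => //; case/andP: t01.
have C4 : (1 - (1 + a) / 2) * `|M2| <= `|M2| by apply: ler_piMl => //; lra.
lra.
Qed.

(** With [M] a bound on the unit cube around [x], the slope is [M - f x]: the point [x] lies between
    [z] and a point of that cube on the opposite side, and convexity extrapolates back to [z]. *)
Lemma convex_n1_minorant x : exists2 K : R, 0 <= K & forall z, f x - K * n1 (tsub z x) <= f z.
Proof.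
have [M HM] := convex_bounded_cube d (leqnn d) x.
have {}HM v : (forall i, `|tnth v i| <= 1) -> f (tadd x v) <= M.
  by move=> v1; apply: HM => // i; rewrite leqNgt ltn_ord.
have fM : f x <= M.
  have := HM [tuple 0 | i < d]; rewrite (_ : tadd _ _ = x); last first.
    by apply: eq_from_tnth => i; rewrite tnthE tnth_mktuple addr0.
  by apply => i; rewrite tnth_mktuple normr0.
exists (M - f x); first by rewrite subr_ge0.
move=> z; have := n1_ge0 (tsub z x); rewrite le_eqVlt => /orP[/eqP a0|].
  by rewrite -a0 mulr0 subr0 (n1_eq0 _ _ (esym a0)).
set a := n1 _ => a0.
pose v := tscale a^-1 (tsub x z).
have v1 i : `|tnth v i| <= 1.
  rewrite !tnthE normrM ger0_norm ?invr_ge0 ?(ltW a0)// mulrC ler_pdivrMr// mul1r distrC.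
  by have := tnth_le_n1 (tsub z x) i; rewrite tnthE.
have a1 : 0 < 1 + a by lra.
have t01 : 0 <= a / (1 + a) <= 1.
  by rewrite divr_ge0 ?(ltW a0) ?(ltW a1)//= ler_pdivrMr// mul1r lerDr.
have xE : x = seg z (tadd x v) (a / (1 + a)).
  apply: eq_from_tnth => i; rewrite !tnthE; field.
  by rewrite !gt_eqF.
have := cfR z (tadd x v) _ t01; rewrite -xE.
have fv := HM v v1; move/(ler_wpM2l (ltW a1)).
have -> : (1 + a) * ((1 - a / (1 + a)) * f z + a / (1 + a) * f (tadd x v)) = f z + a * f (tadd x v).
  by field; rewrite gt_eqF.
have : a * f (tadd x v) <= a * M by rewrite ler_pM2l.
lra.
Qed.

(* Inf-convolution with [n * n1]; for convex [f] it reaches [f x] as soon as [n] bounds a slope at [x]. *)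
Definition lip_env (n : nat) (x : E) : R := inf [set f z + n%:R * n1 (tsub x z) | z in [set: E]].

Let o : E := [tuple 0 | i < d].

(** From [N] on, [n] exceeds a slope of [f] at the origin, so the infimum defining [lip_env n] is
    over a set bounded below. Hence the index shift by [N] in what follows. *)
Lemma lip_env_bound : exists (K : R) (N : nat), 0 <= K /\ forall n, (N <= n)%N -> forall x z,
  f o - K * n1 (tsub x o) <= f z + n%:R * n1 (tsub x z).
Proof.
have [K K0 HK] := convex_n1_minorant o; exists K, (Num.trunc K).+1; split=> // n Nn x z.
have Kn : K <= n%:R by apply: le_trans (ltW (truncnS_gt K)) _; rewrite ler_nat.
have := HK z; have := n1_triangle z x o; rewrite (n1C z x) => H1 H2.
have H3 := ler_wpM2l K0 H1.
have H4 : K * n1 (tsub x z) <= n%:R * n1 (tsub x z) by rewrite ler_wpM2r// n1_ge0.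
lra.
Qed.

Variables (K : R) (N : nat).
Hypothesis HKN : forall n, (N <= n)%N -> forall x z,
  f o - K * n1 (tsub x o) <= f z + n%:R * n1 (tsub x z).

Lemma lip_env_has_inf n x : (N <= n)%N -> has_inf [set f z + n%:R * n1 (tsub x z) | z in [set: E]].
Proof.
move=> Nn; split; first by exists (f x + n%:R * n1 (tsub x x)), x.
by exists (f o - K * n1 (tsub x o)) => _ [z _ <-]; exact: HKN.
Qed.

Lemma lip_env_le n x z : (N <= n)%N -> lip_env n x <= f z + n%:R * n1 (tsub x z).
Proof. by move=> Nn; apply: ge_inf; [case: (lip_env_has_inf n x Nn)|exists z]. Qed.

Lemma lip_env_ge n x a : (N <= n)%N -> (forall z, a <= f z + n%:R * n1 (tsub x z)) -> a <= lip_env n x.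
Proof. by move=> Nn H; apply: lb_le_inf => [|_ [z _ <-]//]; case: (lip_env_has_inf n x Nn). Qed.

Lemma lip_env_le_fun n x : (N <= n)%N -> lip_env n x <= f x.
Proof. by move=> Nn; have := lip_env_le n x x Nn; rewrite n1_refl mulr0 addr0. Qed.

Lemma lip_env_lip n : (N <= n)%N -> n1_lip n%:R (lip_env n).
Proof.
move=> Nn; have H x y : lip_env n x - n%:R * n1 (tsub x y) <= lip_env n y.
  apply: lip_env_ge => // z; have := lip_env_le n x z Nn.
  have := ler_wpM2l (ler0n R n) (n1_triangle x y z); lra.
move=> x y; have := H x y; have := H y x; rewrite (n1C y x) => H1 H2.
by rewrite ler_norml; apply/andP; split; lra.
Qed.

(** The minimized expression is jointly convex in the point and the competitor, so almost minimizers
    [z] and [w] combine into [seg z w t]. *)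
Lemma lip_env_convex n : (N <= n)%N -> econvex (fun x => (lip_env n x)%:E).
Proof.
move=> Nn; apply/econvexR => x y t t01; have /andP[t0 t1] := t01.
apply/ler_addgt0Pr => e e0.
have [_ [z _ <-] Hz] := inf_adherent e0 (lip_env_has_inf n x Nn).
have [_ [w _ <-] Hw] := inf_adherent e0 (lip_env_has_inf n y Nn).
rewrite -/(lip_env n x) in Hz; rewrite -/(lip_env n y) in Hw.
apply: le_trans (lip_env_le n _ (seg z w t) Nn) _.
have H1 := cfR z w t t01; have H2 := ler_wpM2l (ler0n R n) (n1_seg x y z w t t01).
have H3 := ler_wpM2l t0 (ltW Hw).
have H4 := ler_wpM2l (_ : 0 <= 1 - t) (ltW Hz); rewrite subr_ge0 in H4.
have {}H4 := H4 t1.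
lra.
Qed.

Lemma lip_env_nondecreasing n m x : (N <= n)%N -> (n <= m)%N -> lip_env n x <= lip_env m x.
Proof.
move=> Nn nm; apply: lip_env_ge; first exact: leq_trans nm.
move=> z; apply: le_trans (lip_env_le n x z Nn) _.
by rewrite lerD2l ler_wpM2r ?n1_ge0// ler_nat.
Qed.

Lemma lip_env_stationary x : exists m : nat, forall n, (N <= n)%N -> (m <= n)%N -> lip_env n x = f x.
Proof.
have [L L0 HL] := convex_n1_minorant x; exists (Num.trunc L).+1 => n Nn mn.
apply/eqP; rewrite eq_le lip_env_le_fun//=; apply: lip_env_ge => // z.
have Ln : L <= n%:R by apply: le_trans (ltW (truncnS_gt L)) _; rewrite ler_nat.
have := HL z; rewrite (n1C z x).
have : L * n1 (tsub x z) <= n%:R * n1 (tsub x z) by rewrite ler_wpM2r// n1_ge0.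
lra.
Qed.

Lemma lip_env_cvg x : lip_env (N + n)%N x @[n --> \oo] --> f x.
Proof.
have [m Hm] := lip_env_stationary x.
apply: cvg_near_cst; near=> n; apply: Hm; first exact: leq_addr.
by apply: leq_trans (leq_addl N n); near: n; exists m.
Unshelve. all: by end_near. Qed.

Lemma lip_env_measurable n : (N <= n)%N -> measurable_fun setT (lip_env n).
Proof.
by move=> Nn; apply: continuous_on_Rd_measurable; apply: n1_lip_continuous (lip_env_lip n Nn).
Qed.

Lemma convex_measurable : measurable_fun setT f.
Proof.
apply: (@measurable_fun_cvg _ _ _ _ (fun n => lip_env (N + n)%N)) => [n|x _].
  by apply: lip_env_measurable; exact: leq_addr.
exact: lip_env_cvg.
Qed.

(** The envelopes increase to [f]; after subtraction of the first one Fatou passes to the limit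
    under [mu], with the bound given by the integral of [f] under [xi], assumed finite without
    loss. *)
Lemma convex_le_of_lip (mu xi : probability E R) : in_P2 mu -> in_P2 xi ->
    (forall g L, 0 <= L -> n1_lip L g -> econvex (fun x => (g x)%:E) ->
      (\int[mu]_x (g x)%:E <= \int[xi]_x (g x)%:E)%E) ->
  (\int[mu]_x (f x)%:E <= \int[xi]_x (f x)%:E)%E.
Proof.
move=> mu2 xi2 Hlip.
pose g n := lip_env (N + n)%N.
have Ng n : (N <= N + n)%N := leq_addr n N.
have mg n : measurable_fun setT (g n) := lip_env_measurable _ (Ng n).
have ig (m : probability E R) n : in_P2 m -> m.-integrable setT (EFin \o g n).
  move=> m2; apply: integrable_quad => //.
  by apply: n1_lip_quad_growth (lip_env_lip _ (Ng n)).
have gf n x : g n x <= f x := lip_env_le_fun _ x (Ng n).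
have mf := convex_measurable.
have [Hoo|] := eqVneq (\int[xi]_x (f x)%:E)%E +oo%E; first by rewrite Hoo leey.
rewrite -ltey => Hoo.
have ixi : xi.-integrable setT (EFin \o f).
  apply: (integrable_bounded_below _ _ (EFin \o g 0%N)) => //; first exact/measurable_EFinP.
    exact: ig.
  by move=> x; rewrite lee_fin.
have bE := integral_fine xi setT _ measurableT ixi; set b := fine _ in bE.
have aE n := integral_fine mu setT _ measurableT (ig mu n mu2).
pose a n := fine (\int[mu]_x (g n x)%:E)%E.
have ab n : a n <= b.
  rewrite -lee_fin -aE -bE; apply: le_trans (Hlip (g n) (N + n)%:R _ _ _) _.
  - by [].
  - exact: lip_env_lip.
  - exact: lip_env_convex.
  by apply: le_integral => //; [exact: ig|move=> x _; rewrite lee_fin].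
have [||||iL LK] := fatou_bounded mu setT (fun n x => 1 * g n x + (-1) * g 0%N x) (fun x => 1 * f x + (-1) * g 0%N x) (b - a 0%N) measurableT.
- by move=> n; apply: measurable_funD; apply: measurable_funM => //.
- move=> n x _; have : g 0%N x <= g n x by apply: lip_env_nondecreasing; rewrite ?addn0 ?leq_addr.
  lra.
- move=> x _; apply: (@cvgD _ R^o); last exact: cvg_cst.
  by rewrite mul1r; under eq_fun do rewrite mul1r; exact: lip_env_cvg.
- move=> n; have [_ ->] := integral_comb mu setT _ _ 1 (-1) _ _ measurableT (ig mu n mu2) (ig mu 0%N mu2) (aE n) (aE 0%N).
  by rewrite lee_fin; have := ab n; rewrite /a /=; lra.
have lE := integral_fine mu setT _ measurableT iL; set l := fine _ in lE.
have lK : l <= b - a 0%N by move: LK; rewrite [X in (X <= _)%E]lE lee_fin.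
have [_ J] := integral_comb mu setT _ _ 1 1 _ _ measurableT iL (ig mu 0%N mu2) lE (aE 0%N).
rewrite bE (eq_integral (fun x => (1 * (1 * f x + -1 * g 0%N x) + 1 * g 0%N x)%:E)); last first.
  by move=> x _; congr (_%:E); ring.
by rewrite J lee_fin; move: lK; rewrite /a /=; lra.
Qed.

End ConvexLipschitzEnvelopes.

(** * Duality *)

Section ImageMeasure.
Context {R : realType} {d1 d2 : measure_display} {X : measurableType d1} {Y : measurableType d2}.
Variables (m : {measure set X -> \bar R}) (p : {measure set Y -> \bar R}) (h : X -> Y).
Hypotheses (mh : measurable_fun setT h) (hp : forall A, measurable A -> m (h @^-1` A) = p A).

(** The measure [p] only has to agree with the image on measurable sets, so that marginals of
    couplings, translates of [leb] and the law of [T] are all covered. *)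
Lemma ge0_integral_image (f : Y -> \bar R) : measurable_fun setT f -> (forall y, 0 <= f y)%E ->
  (\int[m]_x f (h x) = \int[p]_y f y)%E.
Proof.
move=> mf f0; have := ge0_integral_pushforward mh m measurableT mf (fun y _ => f0 y).
rewrite preimage_setT => <-; apply: eq_measure_integral => A mA _.
by rewrite /pushforward -hp.
Qed.

Lemma integral_image (f : Y -> \bar R) : p.-integrable setT f ->
  m.-integrable setT (f \o h) /\ (\int[m]_x f (h x) = \int[p]_y f y)%E.
Proof.
move=> fi; have mf := measurable_int p fi.
have fhi : m.-integrable setT (f \o h).
  apply/integrableP; split; first exact: measurableT_comp.
  rewrite (ge0_integral_image (fun y => `|f y|)%E)//; last exact: measurableT_comp.
  by case/integrableP : fi.
split=> //; have := @integral_pushforward _ _ _ _ _ _ mh m setT f mf.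
rewrite preimage_setT => /(_ fhi measurableT) <-.
by apply: eq_measure_integral => A mA _; rewrite /pushforward -hp.
Qed.

End ImageMeasure.

Section Duality.
Context {R : realType} {d : nat}.
Local Notation E := (d.-tuple R).

Lemma cost_measurable : measurable_fun setT (fun z : E * E => sqn (tsub z.1 z.2)).
Proof.
rewrite (_ : (fun z => _) = fun z : E * E => \sum_(i < d) (tnth z.1 i - tnth z.2 i) ^+ 2); last first.
  by apply/funext => z; rewrite sqnE; apply: eq_bigr => i _; rewrite tnthE.
apply: measurable_sum => i; apply: measurable_funX; apply: measurable_funB.
  exact: (measurableT_comp (measurable_tnth i) measurable_fst).
exact: (measurableT_comp (measurable_tnth i) measurable_snd).
Qed.

(** Integrate [w x - Q2 w y <= |x - y|^2] against a coupling. The function [w] is arbitrary, which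
    later admits perturbations of both signs. *)
Lemma weak_duality (xi nu : probability E R) (w : E -> R) (a b : R) :
    xi.-integrable setT (EFin \o w) -> nu.-integrable setT (Q2 w) ->
    (\int[xi]_x (w x)%:E)%E = a%:E -> (\int[nu]_y Q2 w y)%E = b%:E ->
  ((a - b)%:E <= T2 xi nu)%E.
Proof.
move=> iw iq wa qb; apply: le_ereal_inf_tmp => _ [pi [c1 c2] <-].
have [Hoo|] := eqVneq (\int[pi]_z (sqn (tsub z.1 z.2))%:E)%E +oo%E; first by rewrite Hoo leey.
rewrite -ltey => Hoo.
have ic : pi.-integrable setT (fun z => (sqn (tsub z.1 z.2))%:E).
  apply/integrableP; split; first by apply/measurable_EFinP; exact: cost_measurable.
  rewrite (eq_integral (fun z => (sqn (tsub z.1 z.2))%:E))// => z _.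
  by rewrite gee0_abs// lee_fin sqn_ge0.
have [i1 E1] := integral_image pi xi fst measurable_fst
  (fun A mA => etrans (congr1 pi (esym (setXT _ A))) (c1 A mA)) _ iw.
have [i2 E2] := integral_image pi nu snd measurable_snd
  (fun A mA => etrans (congr1 pi (esym (setTX _ A))) (c2 A mA)) _ iq.
rewrite EFinB -wa -qb -E1 -E2 -integralB//.
apply: le_integral => //; first exact: integrableB.
move=> [x y] _ /=; have := le_Q2 w x y; case: (Q2 w y) => [r| |] //.
  by rewrite -EFinB !lee_fin; lra.
by move=> _; exact: leNye.
Qed.

(** The sum penalizes leaving the interval from [a_i + 1/(n+1)] to [b_i] in each coordinate. Pushing
    the lower faces inwards makes the limit the indicator of the half-open box. *)
Definition box_bump (a b : E) (n : nat) (x : E) : R :=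
  Num.max 0 (1 - n.+1%:R * \sum_(i < d)
    (Num.max 0 (tnth x i - tnth b i) + Num.max 0 (tnth a i + n.+1%:R^-1 - tnth x i))).

Lemma max0_lip (s t : R) : `|Num.max 0 s - Num.max 0 t| <= `|s - t|.
Proof.
rewrite /Num.max; case: ifP => s0; case: ifP => t0; rewrite ler_norml.
- have := ler_norm (s - t); have := ler_norm (t - s); rewrite distrC => *; apply/andP; split; lra.
- move/negbT : t0; rewrite -leNgt => t0; have := ler_norm (s - t); have := ler_norm (t - s); rewrite distrC => *; apply/andP; split; lra.
- move/negbT : s0; rewrite -leNgt => s0; have := ler_norm (s - t); have := ler_norm (t - s); rewrite distrC => *; apply/andP; split; lra.
- by rewrite subrr oppr_le0 normr_ge0.
Qed.

Lemma box_bump_lip a b n : n1_lip (n.+1%:R * 2) (box_bump a b n).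
Proof.
move=> x y; apply: le_trans (max0_lip _ _) _.
rewrite (_ : 1 - _ - _ = n.+1%:R * (\sum_(i < d)
    ((Num.max 0 (tnth y i - tnth b i) + Num.max 0 (tnth a i + n.+1%:R^-1 - tnth y i))
    - (Num.max 0 (tnth x i - tnth b i) + Num.max 0 (tnth a i + n.+1%:R^-1 - tnth x i))))); last first.
  by rewrite sumrB mulrBr; move: (_ * _) (_ * _) => s t; ring.
rewrite normrM ger0_norm// -mulrA ler_pM2l//; apply: le_trans (ler_norm_sum _ _ _) _.
rewrite /n1 mulr_sumr; apply: ler_sum => i _; rewrite tnthE.
have H1 := max0_lip (tnth x i - tnth b i) (tnth y i - tnth b i).
have H2 := max0_lip (tnth a i + n.+1%:R^-1 - tnth y i) (tnth a i + n.+1%:R^-1 - tnth x i).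
rewrite (_ : _ - _ - _ = tnth x i - tnth y i) in H1; last by ring.
rewrite (_ : _ + _ - _ - _ = tnth x i - tnth y i) in H2; last by move: (n.+1%:R^-1) => c; ring.
set s := Num.max 0 (tnth y i - _) in H1 *; set s' := Num.max 0 (tnth x i - _) in H1 *.
set t := Num.max 0 (_ - tnth y i) in H2 *; set t' := Num.max 0 (_ - tnth x i) in H2 *.
rewrite (_ : s + t - (s' + t') = - (s' - s) + (t - t')); last by ring.
apply: le_trans (ler_normD _ _) _; rewrite normrN; lra.
Qed.

Lemma box_bump_01 a b n x : 0 <= box_bump a b n x <= 1.
Proof.
rewrite /box_bump le_max lexx/= ge_max ler01/= gerDl oppr_le0 mulr_ge0// sumr_ge0// => i _.
by rewrite addr_ge0// le_max lexx.
Qed.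

Lemma box_bump_cvg a b x : box_bump a b n x @[n --> \oo] --> (\1_(box a b) x : R).
Proof.
have max0 (s : R) : 0 <= Num.max 0 s by rewrite le_max lexx.
have S0 n : 0 <= \sum_(i < d)
    (Num.max 0 (tnth x i - tnth b i) + Num.max 0 (tnth a i + n.+1%:R^-1 - tnth x i)).
  by apply: sumr_ge0 => i _; rewrite addr_ge0.
apply: cvg_near_cst; have [bx|nbx] := pselect (box a b x).
  rewrite indicE mem_set//=.
  have [e e0 He] := finite_lower_bound (fun i => tnth x i - tnth a i)
    (fun i => ltac:(by rewrite subr_gt0; have /andP[] := bx i)).
  have [N HN] := harmonic_le e e0.
  near=> n; rewrite /box_bump big1 ?mulr0 ?subr0; first by rewrite max_r.
  move=> i _; have Nn : (N <= n)%N by near: n; exists N.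
  have ne : n.+1%:R^-1 <= e by apply: le_trans HN; rewrite lef_pV2 ?posrE// ler_nat ltnS.
  have /andP[_ xb] := bx i; have := He i => ax.
  by rewrite !max_l ?addr0// ?subr_le0//; move: (n.+1%:R^-1) ne => c ne; lra.
rewrite indicE memNset//=.
have [i] : exists i, ~~ (tnth a i < tnth x i <= tnth b i).
  by move/existsNP : nbx => [i /negP H]; exists i.
rewrite negb_and -!leNgt -ltNge => /orP[xa|bx].
  (* At [x_i <= a_i] the inward shift alone makes the penalty at least [1/(n+1)], so the bump
     vanishes for every [n]. *)
  near=> n; rewrite /box_bump max_l// subr_le0 (bigD1 i)//=.
  have n0 : 0 < n.+1%:R :> R by [].
  have H : n.+1%:R^-1 <= Num.max 0 (tnth a i + n.+1%:R^-1 - tnth x i).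
    by rewrite le_max; apply/orP; right; move: (n.+1%:R^-1) => c; lra.
  rewrite -ler_pdivrMl// mulr1; apply: le_trans H _.
  apply: (@le_trans _ _ (Num.max 0 (tnth x i - tnth b i) + Num.max 0 (tnth a i + n.+1%:R^-1 - tnth x i))).
    by rewrite lerDr.
  by rewrite lerDl sumr_ge0// => j _; rewrite addr_ge0.
have bx0 : 0 < tnth x i - tnth b i by rewrite subr_gt0.
have [N HN] := harmonic_le _ bx0.
near=> n; rewrite /box_bump max_l// subr_le0 (bigD1 i)//=.
have n0 : 0 < n.+1%:R :> R by [].
have Nn : (N <= n)%N by near: n; exists N.
have ne : n.+1%:R^-1 <= tnth x i - tnth b i.
  by apply: le_trans HN; rewrite lef_pV2 ?posrE// ler_nat ltnS.
have H : n.+1%:R^-1 <= Num.max 0 (tnth x i - tnth b i) by rewrite le_max ne orbT.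
rewrite -ler_pdivrMl// mulr1; apply: le_trans H _.
apply: (@le_trans _ _ (Num.max 0 (tnth x i - tnth b i) + Num.max 0 (tnth a i + n.+1%:R^-1 - tnth x i))).
  by rewrite lerDl.
by rewrite lerDl sumr_ge0// => j _; rewrite addr_ge0.
Unshelve. all: by end_near. Qed.

Lemma probability_eq_of_lip (m1 m2 : probability E R) :
    (forall f L, 0 <= L -> n1_lip L f -> (forall x, 0 <= f x <= 1) ->
      (\int[m1]_x (f x)%:E = \int[m2]_x (f x)%:E)%E) ->
  forall A, measurable A -> m1 A = m2 A.
Proof.
move=> H; apply: measure_eq_on_boxes => a b; last first.
  by apply: le_lt_trans (probability_le1 _ _) _; [exact: box_measurable|exact: ltry].
have C (m : probability E R) : (\int[m]_x (box_bump a b n x)%:E)%E @[n --> \oo] --> m (box a b).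
  have := @dominated_convergence _ _ _ m setT measurableT
    (fun n x => (box_bump a b n x)%:E) (fun x => (\1_(box a b) x)%:E) (cst 1%E).
  rewrite integral_indic//; last exact: box_measurable.
  rewrite setIT => -[] //.
  - move=> n; apply/measurable_EFinP; apply: continuous_on_Rd_measurable.
    by apply: n1_lip_continuous (box_bump_lip a b n); rewrite mulr_ge0.
  - by apply/measurable_EFinP; apply: measurable_indic; exact: box_measurable.
  - apply: aeW => x _; apply/fine_cvgP; split; [exact: nearW|exact: box_bump_cvg].
  - exact: (finite_measure_integrable_cst m 1).
  - apply: aeW => x n _; have /andP[h0 h1] := box_bump_01 a b n x.
    by rewrite gee0_abs ?lee_fin.
have := C m1; rewrite (_ : (fun n => _) = (fun n => \int[m2]_x (box_bump a b n x)%:E)%E); last first.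
  apply/funext => n; apply: (H _ (n.+1%:R * 2)); [by rewrite mulr_ge0|exact: box_bump_lip|].
  exact: box_bump_01.
by move=> C1; apply: (@cvg_unique _ (@ereal_hausdorff R) _ _ _ _ C1 (C m2)).
Qed.

End Duality.

(** * Distributional Hessian bound *)

Section CompactSupport.
Context {R : realType} {d : nat}.
Local Notation E := (d.-tuple R).

(** A cube of row vectors is compact, so [g] is read on row vectors through [tup]. *)
Lemma continuous_supp_bounded (g : E -> R) (M : R) : continuous_on_Rd g ->
  (forall x, M < sqn x -> g x = 0) -> exists2 K, 0 <= K & forall x, `|g x| <= K.
Proof.
move=> cg g0.
pose tup (r : 'rV[R]_d) : E := [tuple r ord0 i | i < d].
(* The square of [N] dominates [M], so the cube of half-side [N] contains the ball [sqn x <= M]. *)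
pose N := `|M| + 1.
have N0 : 1 <= N by rewrite lerDr.
have cpt : compact [set r : 'rV[R]_d | forall i, `[- N, N]%classic (r ord0 i)].
  exact: (@rV_compact R d (fun _ => `[- N, N]%classic) (fun _ => @segment_compact R (- N) N)).
have ct : continuous (g \o tup : 'rV[R]_d -> R^o).
  move=> r A /nbhs_ballP[e /= e0 HA].
  have [del del0 H] := cg (tup r) e e0.
  have [c c0 cd] := exists_close (d := d) _ del0.
  apply/nbhs_ballP; exists c => //= s [_ rs]; apply: HA; rewrite /ball/= distrC.
  apply: H; apply: (close_sqn _ _ _ _ c0 cd) => i.
  by rewrite !tnth_mktuple distrC; apply/ltW; have := rs ord0 i.
have := continuous_compact (continuous_subspaceT ct) cpt.
move=> /compact_bounded[K [_ HK]].
have K1 : K < `|K| + 1 by apply: le_lt_trans (ler_norm K) _; rewrite ltrDl.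
exists (`|K| + 1) => [|x]; first by rewrite addr_ge0.
have [xM|xM] := ltP M (sqn x); first by rewrite g0// normr0 addr_ge0.
apply: (HK _ K1); exists (\row_i tnth x i) => /=; last first.
  by congr g; apply: eq_from_tnth => i; rewrite tnth_mktuple mxE.
move=> i; rewrite mxE in_itv/= -ler_norml.
have := sqr_tnth_le x i; rewrite -real_normK ?num_real// => H1.
have H2 : `|tnth x i| ^+ 2 <= N ^+ 2.
  apply: le_trans H1 _; apply: (le_trans xM); apply: le_trans (ler_norm M) _.
  have := normr_ge0 M; rewrite /N expr2 => M0; nra.
by move: H2; rewrite ler_pXn2r ?nnegrE// (le_trans ler01).
Qed.

Definition line (g : E -> R) (v x : E) (t : R) : R := g (tadd x (tscale t v)).

Lemma line_continuous (g : E -> R) v x (e : R) : continuous_on_Rd g -> 0 < e ->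
  exists2 r, 0 < r & forall t, `|t| < r -> `|line g v x t - g x| < e.
Proof.
move=> cg e0; have [del del0 H] := cg x e e0.
have s0 : 0 < sqn v + 1 by rewrite ltr_pwDr// sqn_ge0.
exists (Num.min 1 (del / (sqn v + 1))); first by rewrite lt_min ltr01 divr_gt0.
move=> t; rewrite lt_min ltr_pdivlMr// => /andP[t1 td]; apply: H.
have -> : sqn (tsub (tadd x (tscale t v)) x) = t ^+ 2 * sqn v.
  by rewrite /sqn /dotp mulr_sumr; apply: eq_bigr => i _; rewrite !tnthE; ring.
apply: le_lt_trans td; rewrite -real_normK ?num_real//.
have t0 := normr_ge0 t; have v0 := sqn_ge0 v.
have : `|t| ^+ 2 <= `|t| by rewrite expr2 ler_piMr// ltW.
move=> /(ler_wpM2r v0) H1; apply: (le_trans H1); rewrite ler_wpM2l//; lra.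
Qed.

Lemma ddir_supp (g : E -> R) v (M : R) : (forall x, M < sqn x -> g x = 0) ->
  forall x, M < sqn x -> ddir g v x = 0.
Proof.
move=> g0 x xM; rewrite /ddir derive1_dquot; apply/cvg_lim => //; apply: cvg_near_cst.
have c0 : continuous_on_Rd (@sqn R d).
  suff -> : @sqn R d = fun x => sqn (tsub x [tuple 0 | i < d]) by exact: sqn_continuous.
  by apply/funext => w; congr sqn; apply: eq_from_tnth => i; rewrite tnthE tnth_mktuple subr0.
have e0 : 0 < sqn x - M by rewrite subr_gt0.
have [r r0 Hr] := line_continuous _ v x _ c0 e0.
near=> h; rewrite /dquot tscale0 (g0 x xM) subr0 g0 ?mulr0//.
have : `|h| < r by near: h; exact: dnbhs0_lt.
by move=> /Hr; rewrite ltr_norml /line => /andP[+ _]; lra.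
Unshelve. all: by end_near. Qed.

(** [smooth] speaks of parameter 0 only; moving the base point along the line gives every [t]. *)
Lemma line_is_derive (g : E -> R) (v x : E) (t : R) :
    (forall x, derivable (line g v x) 0 1) ->
  is_derive t 1 (line g v x) (ddir g v (tadd x (tscale t v))).
Proof.
move=> dg.
have E1 : (fun h : R => h^-1 *: (line g v x (h *: 1 + t) - line g v x t)) =
    (fun h : R => h^-1 *: (line g v (tadd x (tscale t v)) (h *: 1 + 0) - line g v (tadd x (tscale t v)) 0)).
  apply/funext => h; rewrite /line !line_tadd !addr0; congr (_ *: (_ - _)).
  by congr g; congr tadd; congr tscale; rewrite addrC.
split; first by rewrite /derivable E1; exact: dg.
by rewrite /derive E1 -[lim _]/('D_1 (line g v (tadd x (tscale t v))) 0) -derive1E.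
Qed.

(* Two applications of the mean value theorem: to [w - w (. - h)], then to its derivative. *)
Lemma second_difference (g : E -> R) (v x : E) (h : R) : 0 < h ->
    (forall x, derivable (line g v x) 0 1) -> (forall x, derivable (line (ddir g v) v x) 0 1) ->
  exists2 c, `|c| < h & line g v x h + line g v x (- h) - 2 * g x = h ^+ 2 * line (ddir (ddir g v) v) v x c.
Proof.
move=> h0 d1 d2.
pose x' := tadd x (tscale (- h) v).
pose G (t : R) : R := line g v x t - line g v x' t.
have dG (t : R) : is_derive t 1 G (ddir g v (tadd x (tscale t v)) - ddir g v (tadd x' (tscale t v))).
  by apply: is_deriveB; exact: line_is_derive.
have cG : {within `[0, h], continuous G}.
  by apply: derivable_within_continuous => t _; exact: ex_derive.
have [c] := MVT h0 (fun t _ => dG t) cG.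
rewrite in_itv/= subr0 => /andP[c0 ch] EG.
pose G2 := line (ddir g v) v x.
have dG2 (t : R) : is_derive t 1 G2 (ddir (ddir g v) v (tadd x (tscale t v))) by exact: line_is_derive.
have cG2 : {within `[c - h, c], continuous G2}.
  by apply: derivable_within_continuous => t _; exact: ex_derive.
have cc : c - h < c by lra.
have [c'] := MVT cc (fun t _ => dG2 t) cG2.
rewrite in_itv/= => /andP[c'1 c'2] EG2.
exists c'; first by rewrite ltr_norml; apply/andP; split; lra.
have GE t : line g v x' t = line g v x (t - h) by rewrite /line line_tadd addrC.
rewrite /G !GE subrr sub0r in EG.
have L0 : line g v x 0 = g x by rewrite /line tscale0.
rewrite L0 in EG.
have E2 : ddir g v (tadd x' (tscale c v)) = G2 (c - h) by rewrite /G2 /line /x' line_tadd addrC.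
rewrite E2 -[ddir g v _]/(G2 c) EG2 in EG.
rewrite expr2 /line.
have -> : line g v x h + line g v x (- h) - 2 * g x = line g v x h - g x - (g x - line g v x (- h)) by ring.
rewrite EG; ring.
Qed.

(** * Second differences integrated against Lebesgue measure *)

Section HessBound.
Variable leb : {measure set E -> \bar R}.
Hypothesis hleb : is_lebesgue leb.

Lemma ball_measurable (M : R) : measurable [set x : E | sqn x <= M].
Proof. by apply: measurable_ler_set; [exact: sqn_measurable|exact: measurable_cst]. Qed.

Lemma leb_ball_lty (M : R) : (leb [set x : E | (sqn x <= M)%R] < +oo)%E.
Proof.
pose N := `|M| + 1.
apply: le_lt_trans (leb_box_lty leb hleb [tuple - (N + 1) | i < d] [tuple N | i < d]).
apply: le_measure; rewrite ?inE; [exact: ball_measurable|exact: box_measurable|].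
move=> x /= xM i; rewrite !tnth_mktuple.
have M0 := normr_ge0 M.
have : `|tnth x i| <= N.
  have := sqr_tnth_le x i; rewrite -real_normK ?num_real// => H1.
  have H2 : `|tnth x i| ^+ 2 <= N ^+ 2.
    apply: le_trans H1 _; apply: (le_trans xM); apply: le_trans (ler_norm M) _.
    rewrite /N expr2; nra.
  by move: H2; rewrite ler_pXn2r ?nnegrE// /N addr_ge0.
by rewrite ler_norml => /andP[? ?]; apply/andP; split; lra.
Qed.

Lemma bounded_integrable_ball (f : E -> R) (K M : R) : measurable_fun setT f ->
  (forall x, sqn x <= M -> `|f x| <= K) -> leb.-integrable [set x | sqn x <= M] (EFin \o f).
Proof.
move=> mf fK; apply: measurable_bounded_integrable.
- exact: ball_measurable.
- exact: leb_ball_lty.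
- exact: measurable_funTS.
- by exists K; split; [exact: num_real|move=> k Kk x /= xM; apply: le_trans (fK x xM) (ltW Kk)].
Qed.

Lemma supp_integrable (f : E -> R) (K M : R) : measurable_fun setT f ->
    (forall x, `|f x| <= K) -> (forall x, M < sqn x -> f x = 0) ->
  leb.-integrable setT (EFin \o f).
Proof.
move=> mf fK f0.
have := bounded_integrable_ball f K M mf (fun x _ => fK x).
move=> /(integrable_mkcond _ (ball_measurable M)).
rewrite (_ : (EFin \o f) \_ _ = EFin \o f)//; apply/funext => x; rewrite patchE.
case: ifPn => // /negP nx; rewrite /= f0// ltNge; apply/negP => xM; apply: nx.
by rewrite inE.
Qed.

Lemma quad_growth_loc_integrable (F : E -> R) : measurable_fun setT F -> quad_growth F ->
  loc_integrable leb (fun x => (F x)%:E).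
Proof.
move=> mF [C HC] M; apply: (bounded_integrable_ball F (`|C| * (1 + M))) => // x xM.
apply: le_trans (HC x) _; have := sqn_ge0 x => s0.
apply: (@le_trans _ _ (`|C| * (1 + sqn x))).
  by rewrite ler_wpM2r ?ler_norm// addr_ge0.
by rewrite ler_wpM2l// lerD2l.
Qed.

Lemma integral_shift (f : E -> R) v : leb.-integrable setT (EFin \o f) ->
  leb.-integrable setT (EFin \o (fun x => f (tadd x v))) /\
  (\int[leb]_x (f (tadd x v))%:E = \int[leb]_x (f x)%:E)%E.
Proof.
exact: (integral_image leb leb (fun x => tadd x v) (shift_measurable v)
  (fun A mA => leb_shift leb hleb v A mA) (EFin \o f)).
Qed.

(** All translates by at most [v] share one support radius, obtained from [sqn_le2]. *)
Lemma line_support (z : E -> R) (v : E) (M s : R) : (forall x, M < sqn x -> z x = 0) ->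
  `|s| <= 1 -> forall x, 2 * `|M| + 2 * sqn v < sqn x -> line z v x s = 0.
Proof.
move=> z0 s1 x xM; apply: z0.
have := sqn_le2 x (tadd x (tscale s v)).
have -> : sqn (tsub x (tadd x (tscale s v))) = s ^+ 2 * sqn v.
  by rewrite /sqn /dotp mulr_sumr; apply: eq_bigr => i _; rewrite !tnthE; ring.
have : s ^+ 2 <= 1 by rewrite -real_normK ?num_real// exprn_ile1.
move=> /(ler_wpM2r (sqn_ge0 v)); rewrite mul1r.
have := ler_norm M; lra.
Qed.

Variable F : E -> R.
Hypotheses (mF : measurable_fun setT F) (qF : quad_growth F).

Lemma growth_supp_integrable (g : E -> R) (K M : R) : measurable_fun setT g ->
    (forall x, `|g x| <= K) -> (forall x, M < sqn x -> g x = 0) ->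
  leb.-integrable setT (EFin \o (fun x => F x * g x)) /\
  exists C, forall x, `|F x * g x| <= C * K.
Proof.
move=> mg gK g0; have [C HC] := qF.
have K0 : 0 <= K by apply: le_trans (normr_ge0 _) (gK [tuple 0 | i < d]).
have bnd x : `|F x * g x| <= `|C| * (1 + `|M|) * K.
  have [xM|xM] := ltP M (sqn x).
    by rewrite g0// mulr0 normr0 !mulr_ge0// addr_ge0.
  rewrite normrM ler_pM//; apply: le_trans (HC x) _; have := sqn_ge0 x => s0.
  apply: (@le_trans _ _ (`|C| * (1 + sqn x))).
    by rewrite ler_wpM2r ?ler_norm// addr_ge0.
  by rewrite ler_wpM2l// lerD2l (le_trans xM)// ler_norm.
split; last by exists (`|C| * (1 + `|M|)).
apply: (supp_integrable _ _ M _ bnd); first exact: measurable_funM.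
by move=> x /g0 ->; rewrite mulr0.
Qed.

Lemma line_measurable (z : E -> R) v s : measurable_fun setT z -> measurable_fun setT (fun x => line z v x s).
Proof. by move=> mz; apply: (measurableT_comp mz); exact: shift_measurable. Qed.

(* Moving the second difference from the test function to [F] uses translation invariance only. *)
Lemma integral_second_difference (z : E -> R) (v : E) (K M k h : R) :
    measurable_fun setT z -> (forall x, `|z x| <= K) -> (forall x, M < sqn x -> z x = 0) ->
    (forall x, 0 <= z x) -> (\int[leb]_x (z x)%:E)%E = k%:E -> 0 < h -> h <= 1 ->
    (forall x, line F v x (- h) + line F v x h - 2 * F x <= h ^+ 2 * sqn v) ->
  (\int[leb]_x (F x * (line z v x h + line z v x (- h) - 2 * z x))%:E <= (h ^+ 2 * (sqn v * k))%:E)%E.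
Proof.
move=> mz zK z0 zpos zk h0 h1 HF.
pose Fz s x := F x * line z v x s.
have iFz s : `|s| <= 1 -> leb.-integrable setT (EFin \o Fz s).
  move=> s1; have [//|//|//|i _] := growth_supp_integrable (fun x => line z v x s) K (2 * `|M| + 2 * sqn v).
  - exact: line_measurable.
  - by move=> x; exact: zK.
  - exact: line_support z0 s1.
  - exact: i.
have hn1 : `|h| <= 1 by rewrite gtr0_norm.
have hn2 : `|- h| <= 1 by rewrite normrN.
have hn0 : `|0 : R| <= 1 by rewrite normr0.
have i1 := iFz _ hn1; have i2 := iFz _ hn2; have i0 := iFz _ hn0.
have E1 := integral_fine leb setT _ measurableT i1.
have E2 := integral_fine leb setT _ measurableT i2.
have E0 := integral_fine leb setT _ measurableT i0.
set a1 := fine _ in E1; set a2 := fine _ in E2; set a0 := fine _ in E0.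
have L0 x : line z v x 0 = z x by rewrite /line tscale0.
have [j1 J1] := integral_comb leb setT _ _ 1 1 _ _ measurableT i1 i2 E1 E2.
have [j2 J2] := integral_comb leb setT _ _ 1 (-2) _ _ measurableT j1 i0 J1 E0.
rewrite (eq_integral (fun x => (1 * (1 * Fz h x + 1 * Fz (- h) x) + -2 * Fz 0 x)%:E)); last first.
  by move=> x _; congr (_%:E); rewrite /Fz L0; ring.
rewrite J2 lee_fin.
have shiftE s x : Fz s (tadd x (tscale (- s) v)) = line F v x (- s) * z x.
  rewrite /Fz /line line_tadd addNr; congr (_ * z _).
  by rewrite tscale0.
have [s1 S1] := integral_shift _ (tscale (- h) v) i1.
have [s2 S2] := integral_shift _ (tscale (- - h) v) i2.
have F1 : (\int[leb]_x (Fz h (tadd x (tscale (- h) v)))%:E)%E = a1%:E by rewrite S1.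
have F2 : (\int[leb]_x (Fz (- h) (tadd x (tscale (- - h) v)))%:E)%E = a2%:E by rewrite S2.
have [k1 K1] := integral_comb leb setT _ _ 1 1 _ _ measurableT s1 s2 F1 F2.
have [k2 K2] := integral_comb leb setT _ _ 1 (-2) _ _ measurableT k1 i0 K1 E0.
have iz : leb.-integrable setT (EFin \o z) by exact: supp_integrable z0.
(* The second term, with coefficient 0, is a dummy: scalar multiples are obtained from
   [integral_comb]. *)
have [iz2 Z2] := integral_comb leb setT _ _ (h ^+ 2 * sqn v) 0 _ _ measurableT iz iz zk zk.
have : (\int[leb]_x (1 * (1 * Fz h (tadd x (tscale (- h) v)) + 1 * Fz (- h) (tadd x (tscale (- - h) v))) + -2 * Fz 0 x)%:E <=
   \int[leb]_x (h ^+ 2 * sqn v * z x + 0 * z x)%:E)%E.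
  apply: le_integral => // x _; rewrite lee_fin !shiftE opprK /Fz L0.
  have := ler_wpM2r (zpos x) (HF x); lra.
rewrite K2 Z2 lee_fin; lra.
Qed.

End HessBound.

(** The quadratic part contributes exactly the right-hand side, and midpoint convexity makes the
    contribution of [- phi / 2] nonpositive. *)
Lemma second_difference_phibar0 (phi : E -> R) v x (h : R) : econvex (fun x => (phi x)%:E) ->
  line (phibar0 phi) v x (- h) + line (phibar0 phi) v x h - 2 * phibar0 phi x <= h ^+ 2 * sqn v.
Proof.
move=> /econvexR cphi; have h2 : 0 <= (1 / 2 : R) <= 1 by apply/andP; split; lra.
have := cphi (tadd x (tscale (- h) v)) (tadd x (tscale h v)) _ h2.
have -> : seg (tadd x (tscale (- h) v)) (tadd x (tscale h v)) (1 / 2) = x.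
  by apply: eq_from_tnth => i; rewrite !tnthE; field.
rewrite /line /phibar0.
have -> : sqn (tadd x (tscale (- h) v)) = 2 * sqn x + 2 * (h ^+ 2 * sqn v) - sqn (tadd x (tscale h v)).
  rewrite /sqn /dotp !mulr_sumr -big_split/= -sumrB; apply: eq_bigr => i _.
  by rewrite !tnthE; ring.
lra.
Qed.

(** Divide the integrated second difference by the squared step. By the mean value form each
    quotient [q n x] is a value of [zvv] near [x], hence uniformly bounded with common support, and
    dominated convergence applies. *)
Lemma hess_phibar0 (leb : {measure set E -> \bar R}) (phi : E -> R) : is_lebesgue leb ->
    econvex (fun x => (phi x)%:E) -> continuous_on_Rd phi -> quad_growth phi ->
  hess_le_id leb (fun x => (phibar0 phi x)%:E).
Proof.
move=> hleb cphi kphi qphi; pose F := phibar0 phi.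
have FE : F = fun x => 2^-1 * sqn x + (- 2^-1) * phi x.
  by apply/funext => x; rewrite /F /phibar0; lra.
have mF : measurable_fun setT F.
  rewrite FE; apply: measurable_funD; apply: measurable_funM => //; first exact: sqn_measurable.
  exact: continuous_on_Rd_measurable.
have qF : quad_growth F.
  rewrite FE; apply: quad_growth_comb => //; exists 1 => x.
  by rewrite ger0_norm ?sqn_ge0// mul1r lerDr.
split; first exact: quad_growth_loc_integrable.
move=> z [sz [M z0]] zpos v.
have [cz dz] := sz [::]; have [cz1 dz1] := sz [:: v]; have [cz2 _] := sz [:: v; v].
rewrite /= in cz dz cz1 dz1 cz2.
pose zvv := ddir (ddir z v) v.
have [K K0 zK] := continuous_supp_bounded z M cz z0.
have zvv0 := ddir_supp _ v M (ddir_supp z v M z0).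
have [K2 K20 zvvK] := continuous_supp_bounded zvv M cz2 zvv0.
have mz := continuous_on_Rd_measurable _ cz.
have mzvv := continuous_on_Rd_measurable _ cz2.
have iz : leb.-integrable setT (EFin \o z) := supp_integrable leb hleb z K M mz zK z0.
have zk := integral_fine leb setT _ measurableT iz; set k := fine _ in zk.
rewrite [X in (_ <= _ * X)%E]zk -EFinM.
pose e_ (n : nat) : R := n.+1%:R^-1.
have e0 n : 0 < e_ n by rewrite invr_gt0.
have e1 n : e_ n <= 1 by rewrite invf_le1// ler1n.
pose S n x := line z v x (e_ n) + line z v x (- e_ n) - 2 * z x.
pose q n x := (e_ n) ^- 2 * S n x.
have SE n x : exists2 c, `|c| < e_ n & S n x = e_ n ^+ 2 * line zvv v x c.
  exact: second_difference (e0 n) (dz v) (dz1 v).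
have qE n x : exists2 c, `|c| < e_ n & q n x = line zvv v x c.
  have [c cn Sc] := SE n x; exists c => //; rewrite /q Sc mulKf//.
  by rewrite expf_neq0// gt_eqF.
pose M' := 2 * `|M| + 2 * sqn v.
have M'M : M <= M'.
  by have := ler_norm M; have := sqn_ge0 v; have := normr_ge0 M; rewrite /M'; lra.
have q0 n x : M' < sqn x -> q n x = 0.
  move=> xM; have l0 s : `|s| <= 1 -> line z v x s = 0.
    by move=> s1; exact: line_support z0 s1 x xM.
  rewrite /q /S (z0 x (le_lt_trans M'M xM)) !l0 ?normrN ?gtr0_norm//.
  by rewrite mulr0 subr0 addr0 mulr0.
have qK n x : `|q n x| <= K2 by have [c _ ->] := qE n x; exact: zvvK.
have mq n : measurable_fun setT (q n).
  apply: measurable_funM => //; apply: measurable_funB; last exact: measurable_funM.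
  by apply: measurable_funD; exact: line_measurable.
have [C HC] := qF.
pose B : E -> R := fun x => (`|C| * (1 + `|M'|) * K2) * \1_[set x | sqn x <= M'] x.
have iB : leb.-integrable setT (EFin \o B).
  apply: (supp_integrable leb hleb B (`|C| * (1 + `|M'|) * K2) M').
  - apply: measurable_funM => //; apply: measurable_indic; exact: ball_measurable.
  - move=> x; rewrite /B normrM ger0_norm ?mulr_ge0 ?addr_ge0//.
    by rewrite ler_piMr ?mulr_ge0 ?addr_ge0// indicE; case: (_ \in _); rewrite ?normr1 ?normr0.
  - by move=> x xM; rewrite /B indicE memNset ?mulr0//= leNgt xM.
have bnd n x : `|F x * q n x| <= B x.
  rewrite /B indicE; have [xM|xM] := ltP M' (sqn x).
    by rewrite q0// mulr0 normr0 mulr_ge0// mulr_ge0// mulr_ge0// addr_ge0.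
  rewrite mem_set//= mulr1 normrM ler_pM//; apply: le_trans (HC x) _; have := sqn_ge0 x => s0.
  apply: (@le_trans _ _ (`|C| * (1 + sqn x))).
    by rewrite ler_wpM2r ?ler_norm// addr_ge0.
  by rewrite ler_wpM2l// lerD2l (le_trans xM)// ler_norm.
have qcvg x : F x * q n x @[n --> \oo] --> F x * zvv x.
  apply: (@cvgMr R^o); apply/(@cvgrPdist_lt _ R^o) => e ee.
  have [r r0 Hr] := line_continuous zvv v x e cz2 ee.
  have [N HN] := harmonic_le r r0.
  near=> n; have [c cn ->] := qE n x; rewrite distrC; apply: Hr.
  apply: lt_le_trans cn _; apply: le_trans HN; rewrite lef_pV2 ?posrE// ler_nat ltnS.
  by near: n; exists N.
have [] := @dominated_convergence _ _ _ leb setT measurableT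
  (fun n x => (F x * q n x)%:E) (fun x => (F x * zvv x)%:E) (EFin \o B).
- by move=> n; apply/measurable_EFinP; exact: measurable_funM.
- by apply/measurable_EFinP; exact: measurable_funM.
- by apply: aeW => x _; apply/fine_cvgP; split; [exact: nearW|exact: qcvg].
- exact: iB.
- by apply: aeW => x n _; rewrite /= lee_fin; exact: bnd.
move=> _ _ H.
have <- := @cvg_lim _ (@ereal_hausdorff R) _ _ _ _ _ H.
apply: lime_le; first by apply/cvg_ex; eexists; exact: H.
near=> n.
have iq : leb.-integrable setT (EFin \o (fun x => F x * q n x)).
  apply: le_integrable iB => //; first by apply/measurable_EFinP; exact: measurable_funM.
  by move=> x _; rewrite /= lee_fin (le_trans (bnd n x))// ler_norm.
have qa := integral_fine leb setT _ measurableT iq; set a := fine _ in qa.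
have en2 : 0 < e_ n ^+ 2 by rewrite exprn_gt0.
have := integral_second_difference leb hleb F mF qF z v K M k (e_ n) mz zK z0 zpos zk (e0 n) (e1 n)
  (fun x => second_difference_phibar0 phi v x (e_ n) cphi).
have [_ J] := integral_comb leb setT _ _ (e_ n ^+ 2) 0 _ _ measurableT iq iq qa qa.
rewrite (eq_integral (fun x => (e_ n ^+ 2 * (F x * q n x) + 0 * (F x * q n x))%:E)); last first.
  move=> x _; congr (_%:E); rewrite mul0r addr0 /q.
  by rewrite mulrCA (mulrA (e_ n ^+ 2)) mulfV ?mul1r// gt_eqF.
rewrite J lee_fin mul0r addr0 ler_pM2l// => le_a.
by rewrite /= qa lee_fin.
Unshelve. all: by end_near. Qed.

End CompactSupport.

(** * First-order optimality *)

Section Optimizer.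
Context {R : realType} {d : nat}.
Local Notation E := (d.-tuple R).
Variables (leb : {measure set E -> \bar R}) (mu nu : probability E R) (phi : E -> R).
Hypotheses (hleb : is_lebesgue leb) (mu2 : in_P2 mu) (nu2 : in_P2 nu)
  (nuac : abs_cont leb nu) (cphi : econvex (fun x => (phi x)%:E))
  (kphi : continuous_on_Rd phi) (qphi : quad_growth phi).
Hypothesis phi_opt : forall g : E -> R, econvex (fun x => (g x)%:E) -> continuous_on_Rd g ->
  quad_growth g -> (D2fun mu nu g <= D2fun mu nu phi)%E.

Let psi := legendre (fun x => (phibar0 phi x)%:E).
Let T := grad psi.
Let cpsi : econvex psi := psi_econvex phi cphi.
Let psiNy : forall y, psi y != -oo%E := psi_neqNy phi.
Let mpsi : measurable_fun setT psi := psi_measurable phi.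

Lemma integrable_cq (m : probability E R) (g : E -> R) : in_P2 m -> continuous_on_Rd g ->
  quad_growth g -> m.-integrable setT (EFin \o g).
Proof. by move=> m2 kg qg; apply: integrable_quad => //; exact: continuous_on_Rd_measurable. Qed.

Lemma continuous_on_Rd_cst (c : R) : continuous_on_Rd (fun _ : E => c).
Proof. by move=> x e e0; exists 1 => // y _; rewrite subrr normr0. Qed.

Lemma n1_lip_cst (c : R) : n1_lip 0 (fun _ : E => c).
Proof. by move=> x y; rewrite subrr normr0 mul0r. Qed.

(** The competitor 0 has dual value 0, which rules out an infinite integral of [Q2 phi]; from below
    [Q2 phi] is bounded by [phi]. *)
Lemma Q2_opt_integrable : nu.-integrable setT (Q2 phi).
Proof.
apply: Q2_integrable => //; first exact: continuous_on_Rd_measurable.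
have qc : quad_growth (fun _ : E => 0 : R) := n1_lip_quad_growth _ _ (lexx 0) (n1_lip_cst 0).
have cc : econvex (fun _ : E => (0 : R)%:E) by apply/econvexR => x y t _; lra.
have := phi_opt _ cc (continuous_on_Rd_cst 0) qc; rewrite /D2fun.
have ip := integral_fine mu setT _ measurableT (integrable_cq mu phi mu2 kphi qphi).
have E1 : (\int[mu]__ 0%R%:E)%E = 0%E by exact: integral0.
have E2 : (\int[nu]_y Q2 (fun _ : E => 0%R) y)%E = 0%E.
  apply: integral0_eq => y _; apply/eqP; rewrite eq_le; apply/andP; split.
    by apply: ge_ereal_sup => _ [x _ <-]; rewrite lee_fin sub0r oppr_le0 sqn_ge0.
  by apply: le_trans (le_Q2 _ y y); rewrite sqn_refl subr0.
rewrite E1 E2 [X in (_ <= X - _)%E]ip; case: (\int[nu]_y Q2 phi y)%E => [r _| |_].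
- exact: ltry.
- by rewrite sube0.
- by [].
Qed.

(** Where [psi] is infinite so is [Q2 phi], an integrable function; where [psi] is finite, absolute
    continuity disposes of the kinks in each of the [d] directions. *)
Lemma smooth_ae : nu (~` smooth_pt psi) = 0%E.
Proof.
have mS : measurable (smooth_pt psi) := measurable_smooth_pt psi cpsi psiNy mpsi.
pose B (i : 'I_d) := [set y | (psi y < +oo)%E] `\` [set y | kinkfree (ldom psi y i) (lfun psi y i) 0].
have mfin : measurable [set y | (psi y < +oo)%E].
  by rewrite -[X in measurable X]setTI; apply: emeasurable_fun_infty_o.
have mB i : measurable (B i) by apply: measurableD => //; exact: measurable_kinkfree.
have B0 i : nu (B i) = 0%E by apply: nuac => //; exact: nonsmooth_null.
(* The finite family is padded with empty sets to use countable unions indexed by [nat]. *)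
pose C (n : nat) : set E := if insub n is Some i then B i else set0.
have C0 n : nu.-negligible (C n).
  rewrite /C; case: insubP => [i _ _|_]; last exact: negligible_set0.
  by exists (B i); split.
have Noo : nu.-negligible [set y | Q2 phi y = +oo%E].
  exists [set y | Q2 phi y = +oo%E]; split=> //; last exact: (integrable_pinfty_null nu _ Q2_opt_integrable).
  by have := Q2_measurable phi measurableT _ (emeasurable_set1 +oo%E); rewrite setTI.
have : nu.-negligible (~` smooth_pt psi).
  apply: negligibleS (negligibleU Noo (negligible_bigcup C0)) => y /= ns.
  have [yfin|] := ltP (psi y) +oo%E; last first.
    by rewrite leye_eq => /eqP yoo; left; rewrite /= Q2_psi -/psi yoo gt0_muley// lte_fin.
  right; have [i ni] : exists i, ~ kinkfree (ldom psi y i) (lfun psi y i) 0.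
    by apply/existsNP => H; apply: ns.
  by exists (val i) => //; rewrite /C valK.
by move=> /(measure_negligible (measurableC mS)).
Qed.

Lemma D2_real (g : E -> R) : continuous_on_Rd g -> quad_growth g -> nu.-integrable setT (Q2 g) ->
  D2fun mu nu g = (fine (\int[mu]_x (g x)%:E) - fine (\int[nu]_y Q2 g y))%:E.
Proof.
move=> kg qg ig; rewrite /D2fun EFinB -(integral_fine _ _ _ measurableT ig).
by rewrite -(integral_fine _ _ _ measurableT (integrable_cq mu g mu2 kg qg)).
Qed.

(** In each coordinate [L t - t^2 <= L^2 / 4]. This makes [Q2 g] integrable, which quadratic growth
    of [g] alone does not guarantee. *)
Lemma Q2_lip_le (g : E -> R) L y : n1_lip L g -> (Q2 g y <= (g y + d%:R * (L ^+ 2 / 4))%:E)%E.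
Proof.
move=> lg; apply: ge_ereal_sup => _ [x _ <-]; rewrite lee_fin.
have : L * n1 (tsub x y) - sqn (tsub x y) <= d%:R * (L ^+ 2 / 4).
  rewrite sqnE /n1 mulr_sumr -sumrB.
  have -> : d%:R * (L ^+ 2 / 4) = \sum_(i < d) (L ^+ 2 / 4) by rewrite sumr_const card_ord mulr_natl.
  apply: ler_sum => i _; rewrite -[tnth _ _ ^+ 2]real_normK ?num_real//.
  by have := sqr_ge0 (`|tnth (tsub x y) i| - L / 2); lra.
by have /ler_normlP[_] := lg x y; lra.
Qed.

(* [phi] is compared with the points [(1 - e) phi + e g] of the segment towards [g]. *)
Lemma optimality_lip (g : E -> R) L : 0 <= L -> n1_lip L g -> econvex (fun x => (g x)%:E) ->
  nu.-integrable setT (fun y => (g (T y) - phi (T y))%:E) /\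
  ((fine (\int[mu]_x (g x)%:E) - fine (\int[mu]_x (phi x)%:E))%:E <=
    \int[nu]_y (g (T y) - phi (T y))%:E)%E.
Proof.
move=> L0 lg cg.
have kg := n1_lip_continuous _ _ L0 lg; have qg := n1_lip_quad_growth _ _ L0 lg.
pose u x := 1 * g x + (-1) * phi x.
have ku : continuous_on_Rd u by exact: continuous_on_Rd_comb.
have qu : quad_growth u by exact: quad_growth_comb.
have uE : (fun x => phi x + u x) = g by apply/funext => x; rewrite /u; ring.
have igQ : nu.-integrable setT (Q2 g).
  apply: (integrable_between _ setT _ (EFin \o g) (EFin \o (fun y => 1 * g y + 1 * (d%:R * (L ^+ 2 / 4))))) => //.
  - exact: Q2_measurable.
  - exact: integrable_cq.
  - apply: integrable_cq => //; first exact: (continuous_on_Rd_comb _ _ _ _ kg (continuous_on_Rd_cst _)).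
    by apply: quad_growth_comb => //; exact: (n1_lip_quad_growth _ _ (lexx 0) (n1_lip_cst _)).
  - by move=> y _; apply: le_trans (le_Q2 _ y y); rewrite sqn_refl subr0.
  - by move=> y _ /=; rewrite !mul1r; exact: Q2_lip_le.
have uT : (fun y => (g (T y) - phi (T y))%:E) = (fun y => (u (T y))%:E).
  by apply/funext => y; congr (_%:E); rewrite /u; ring.
rewrite uT; apply: danskin_integral => //; [exact: smooth_ae|exact: Q2_opt_integrable|by rewrite uE|].
move=> e e0 e1.
have e01 : 0 <= e <= 1 by rewrite (ltW e0).
have iw : nu.-integrable setT (Q2 (fun x => phi x + e * u x)).
  by apply: Q2_perturb_integrable => //; [exact: Q2_opt_integrable|rewrite uE].
have wE : (fun x => phi x + e * u x) = (fun x => (1 - e) * phi x + e * g x).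
  by apply/funext => x; rewrite /u; ring.
have wE2 : (fun x => phi x + e * u x) = (fun x => 1 * phi x + e * u x).
  by apply/funext => x; rewrite mul1r.
have kw : continuous_on_Rd (fun x => phi x + e * u x) by rewrite wE; exact: continuous_on_Rd_comb.
have qw : quad_growth (fun x => phi x + e * u x) by rewrite wE; exact: quad_growth_comb.
have cw : econvex (fun x => (phi x + e * u x)%:E).
  have e1' : 0 <= 1 - e by rewrite subr_ge0.
  have := econvex_comb _ _ _ _ e1' (ltW e0) cphi cg.
  by rewrite (_ : (fun x => ((1 - e) * phi x + e * g x)%:E) = EFin \o (fun x => (1 - e) * phi x + e * g x))// -wE.
have := phi_opt _ cw kw qw.
rewrite (D2_real _ kw qw iw) (D2_real _ kphi qphi Q2_opt_integrable) lee_fin.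
rewrite (integral_fine nu setT _ measurableT Q2_opt_integrable) (integral_fine nu setT _ measurableT iw) -EFinD lee_fin.
have ip := integrable_cq mu phi mu2 kphi qphi; have ig := integrable_cq mu g mu2 kg qg.
have Ep := integral_fine mu setT _ measurableT ip; have Eg := integral_fine mu setT _ measurableT ig.
have [_ J] := integral_comb mu setT _ _ (1 - e) e _ _ measurableT ip ig Ep Eg.
have -> : (\int[mu]_x (phi x + e * u x)%:E)%E =
    ((1 - e) * fine (\int[mu]_x (phi x)%:E)%E + e * fine (\int[mu]_x (g x)%:E)%E)%:E.
  rewrite -J; apply: eq_integral => x _; congr (_%:E).
  by have := congr1 (fun h => h x) wE.
rewrite /=; lra.
Qed.

Lemma phi_T_integrable : nu.-integrable setT (fun y => (phi (T y))%:E) /\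
  (\int[nu]_y (phi (T y))%:E <= \int[mu]_x (phi x)%:E)%E.
Proof.
have c0 : econvex (fun _ : E => (0 : R)%:E) by apply/econvexR => x y t _; lra.
have [i0 I0] := optimality_lip _ 0 (lexx 0) (n1_lip_cst 0) c0.
have E0 := integral_fine nu setT _ measurableT i0; set a := fine _ in E0.
have [i1 I1] := integral_comb nu setT _ _ (-1) 0 _ _ measurableT i0 i0 E0 E0.
have EE : (fun y => -1 * (0 - phi (T y)) + 0 * (0 - phi (T y))) = phi \o T.
  by apply/funext => y /=; ring.
rewrite EE in i1; split=> //.
rewrite (eq_integral (fun y => (-1 * (0 - phi (T y)) + 0 * (0 - phi (T y)))%:E)); last first.
  by move=> y _; congr (_%:E); have := congr1 (fun h => h y) EE => /= ->.
rewrite I1 (integral_fine mu setT _ measurableT (integrable_cq mu phi mu2 kphi qphi)) lee_fin.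
move: I0; rewrite E0 integral0 /= lee_fin; lra.
Qed.

Lemma lip_order (g : E -> R) L : 0 <= L -> n1_lip L g -> econvex (fun x => (g x)%:E) ->
  (\int[mu]_x (g x)%:E <= \int[nu]_y (g (T y))%:E)%E.
Proof.
move=> L0 lg cg; have [ip Ip] := phi_T_integrable.
have kg := n1_lip_continuous _ _ L0 lg; have qg := n1_lip_quad_growth _ _ L0 lg.
have [i1 _] := optimality_lip g L L0 lg cg.
have E1 := integral_fine nu setT _ measurableT i1; have Ep := integral_fine nu setT _ measurableT ip.
have [ig Ig] := integral_comb nu setT _ _ 1 1 _ _ measurableT i1 ip E1 Ep.
have gE : (fun y => 1 * (g (T y) - phi (T y)) + 1 * phi (T y)) = g \o T.
  by apply/funext => y /=; ring.
rewrite gE in ig.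
have Eg := integral_fine nu setT _ measurableT ig; set b := fine _ in Eg.
have iga := integrable_cq mu g mu2 kg qg.
have Ea := integral_fine mu setT _ measurableT iga; set a := fine _ in Ea.
rewrite [X in (X <= _)%E]Ea [X in (_ <= X)%E]Eg lee_fin leNgt; apply/negP => ba.
set p := fine (\int[nu]_y (phi (T y))%:E)%E in Ep *.
pose q := fine (\int[mu]_x (phi x)%:E)%E.
(* Optimality against [l * g] would give [l * (a - b) <= q - p]; this [l] makes the left side exceed
   the absolute value of [q - p] by 1. *)
pose l := (`|q - p| + 1) / (a - b).
have ab0 : 0 < a - b by rewrite subr_gt0.
have l0 : 0 <= l by apply: divr_ge0; [exact: addr_ge0|exact: ltW].
have llg : n1_lip (l * L) (fun x => l * g x).
  by move=> x y; rewrite -mulrBr normrM (ger0_norm l0) -(mulrA l L) ler_wpM2l.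
have lcg : econvex (fun x => (l * g x)%:E).
  have := econvex_comb _ _ _ _ l0 (lexx 0) cg cg.
  by rewrite (_ : (fun x => (l * g x + 0 * g x)%:E) = (fun x => (l * g x)%:E))//;
    apply/funext => x; rewrite mul0r addr0.
have [_ ] := optimality_lip _ _ (mulr_ge0 l0 L0) llg lcg.
have [_ J1] := integral_comb mu setT _ _ l 0 _ _ measurableT iga iga Ea Ea.
have [_ J2] := integral_comb nu setT _ _ l (-1) _ _ measurableT ig ip Eg Ep.
rewrite (eq_integral (fun x => (l * g x + 0 * g x)%:E)); last first.
  by move=> x _; rewrite mul0r addr0.
rewrite [X in (_ <= X)%E](_ : _ = (l * b + -1 * p)%:E); last first.
  by rewrite -J2; apply: eq_integral => y _; congr (_%:E) => /=; ring.
rewrite J1 /= lee_fin -/q.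
have : l * (a - b) = `|q - p| + 1 by rewrite divfK// gt_eqF.
by have := ler_norm (q - p); lra.
Qed.

Let pc : E -> E * E := fun y => (T y, y).

Lemma T_measurable : measurable_fun setT T.
Proof. exact: (grad_measurable psi cpsi psiNy mpsi). Qed.

Lemma pc_measurable : measurable_fun setT pc.
Proof. by apply: measurable_fun_pair; [exact: T_measurable|exact: measurable_id]. Qed.

(** At smooth points [T y] attains [Q2 phi y], so the cost equals [phi (T y) - Q2 phi y] almost
    everywhere and inherits its integrability. *)
Lemma cost_T : nu.-integrable setT (fun y => (sqn (tsub (T y) y))%:E) /\
  (\int[nu]_y (sqn (tsub (T y) y))%:E =
    (fine (\int[nu]_y (phi (T y))%:E) - fine (\int[nu]_y Q2 phi y))%:E)%E.
Proof.
have [ip _] := phi_T_integrable; have iQ := Q2_opt_integrable.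
have mS : measurable (smooth_pt psi) := measurable_smooth_pt psi cpsi psiNy mpsi.
have mc : measurable_fun setT (fun y => (sqn (tsub (T y) y))%:E).
  by apply/measurable_EFinP; exact: (measurableT_comp cost_measurable pc_measurable).
pose S : set E := smooth_pt psi.
have eqS : {in S, (fun y => (phi (T y))%:E - Q2 phi y)%E =1 (fun y => (sqn (tsub (T y) y))%:E)}.
  move=> y /set_mem sy; rewrite (Q2_attained phi cphi kphi y sy) -EFinB.
  by congr (_%:E); rewrite -/psi -/(T y); ring.
have ipS : nu.-integrable (S) (fun y => (phi (T y))%:E) by apply: integrableS ip.
have iQS : nu.-integrable (S) (Q2 phi) by apply: integrableS iQ.
have icS : nu.-integrable (S) (fun y => (sqn (tsub (T y) y))%:E).
  by apply: eq_integrable (integrableB mS ipS iQS).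
have [ic ->] := integral_full nu _ _ mS smooth_ae mc icS; split=> //.
rewrite -(eq_integral _ _ (fun y H => eqS y H)) integralB//.
have [_ <-] := integral_full nu _ _ mS smooth_ae (measurable_int nu ip) ipS.
have [_ <-] := integral_full nu _ _ mS smooth_ae (measurable_int nu iQ) iQS.
by rewrite EFinB -!integral_fine.
Qed.

(** * The law of [T] under [nu] *)

Section ImageLaw.
Variable xi : probability E R.
Hypothesis xiE : forall A, measurable A -> xi A = pushforward nu T A.

Let imT A (mA : measurable A) : nu (T @^-1` A) = xi A := esym (xiE A mA).

Lemma xi_P2 : in_P2 xi.
Proof.
rewrite /in_P2 -(ge0_integral_image nu xi T T_measurable imT); last 2 first.
- by apply/measurable_EFinP; exact: sqn_measurable.
- by move=> x; rewrite lee_fin sqn_ge0.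
have [ic _] := cost_T.
have is_ : nu.-integrable setT (fun y => (sqn y)%:E).
  apply: (integrable_quad nu (@sqn R d) nu2 sqn_measurable).
  by exists 1 => x; rewrite ger0_norm ?sqn_ge0// mul1r lerDr.
have Ec := integral_fine nu setT _ measurableT ic; have Es := integral_fine nu setT _ measurableT is_.
have [_ J] := integral_comb nu setT _ _ 2 2 _ _ measurableT ic is_ Ec Es.
apply: (@le_lt_trans _ _ (\int[nu]_y (2 * sqn (tsub (T y) y) + 2 * sqn y)%:E)%E).
  apply: ge0_le_integral => //.
  - by move=> y _; rewrite lee_fin sqn_ge0.
  - by apply/measurable_EFinP; apply: (measurableT_comp sqn_measurable); exact: T_measurable.
  - apply/measurable_EFinP; apply: measurable_funD; apply: measurable_funM => //.
      by apply/measurable_EFinP; exact: (measurable_int nu ic).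
    exact: sqn_measurable.
  - by move=> y _; rewrite lee_fin sqn_le2.
by rewrite J ltry.
Qed.

Lemma xi_cx : cx_le mu xi.
Proof.
move=> f cf _ _.
have [K [N [_ HKN]]] := lip_env_bound f cf.
apply: (convex_le_of_lip f cf K N HKN mu xi mu2 xi_P2) => g L L0 lg cg.
apply: le_trans (lip_order g L L0 lg cg) _.
have ig := integrable_cq xi g xi_P2 (n1_lip_continuous _ _ L0 lg) (n1_lip_quad_growth _ _ L0 lg).
by have [_ ->] := integral_image nu xi T T_measurable imT _ ig.
Qed.

(** The coupling is the image of [nu] under [pc]. By [cost_T] its cost is the dual expression with
    [phi o T] integrated against [nu], which [phi_T_integrable] compares with [mu]. *)
Lemma T2_xi_le : (T2 xi nu <= (fine (\int[mu]_x (phi x)%:E) - fine (\int[nu]_y Q2 phi y))%:E)%E.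
Proof.
have mpc := pc_measurable.
pose pcm : {mfun E >-> (E * E)%type} := HB.pack pc (isMeasurableFun.Build _ _ _ _ _ mpc).
pose pi : probability (E * E)%type R := distribution nu pcm.
apply: (@le_trans _ _ (\int[pi]_z (sqn (tsub z.1 z.2))%:E)%E).
  apply: ereal_inf_lbound; exists pi => //; split=> A mA.
    by rewrite xiE// /pi /distribution /pushforward; congr (nu _); apply/seteqP; split=> y //= [].
  by rewrite /pi /distribution /pushforward; congr (nu _); apply/seteqP; split=> y //= [].
rewrite -(ge0_integral_image nu pi pc mpc (fun A mA => erefl)); last 2 first.
- by apply/measurable_EFinP; exact: cost_measurable.
- by move=> z; rewrite lee_fin sqn_ge0.
rewrite /= (cost_T).2 lee_fin lerD2r.
have [ip Ip] := phi_T_integrable.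
move: Ip; rewrite (integral_fine nu setT _ measurableT ip).
by rewrite (integral_fine mu setT _ measurableT (integrable_cq mu phi mu2 kphi qphi)) lee_fin.
Qed.

End ImageLaw.

Lemma int_exists_integrable (m : probability E R) (f : E -> R) :
  m.-integrable setT (EFin \o f) -> int_exists m f.
Proof.
move=> fi [H _]; have := integral_funepos_lt_pinfty measurableT fi.
rewrite (eq_integral (fun x => (Num.max (f x) 0)%:E)); first by rewrite H.
by move=> x _; rewrite funeposE /= EFin_max.
Qed.

Lemma phi_mu_le (xi : probability E R) : Pcx mu xi ->
  fine (\int[mu]_x (phi x)%:E)%E <= fine (\int[xi]_x (phi x)%:E)%E.
Proof.
move=> [xi2 cx]; have im := integrable_cq mu phi mu2 kphi qphi.
have ix := integrable_cq xi phi xi2 kphi qphi.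
rewrite -lee_fin -!integral_fine//; apply: cx => //; exact: int_exists_integrable.
Qed.

Lemma T2_lower (xi : probability E R) : Pcx mu xi ->
  ((fine (\int[mu]_x (phi x)%:E) - fine (\int[nu]_y Q2 phi y))%:E <= T2 xi nu)%E.
Proof.
move=> xiP; have ix := integrable_cq xi phi xiP.1 kphi qphi.
apply: le_trans (weak_duality xi nu phi _ _ ix Q2_opt_integrable
  (integral_fine _ _ _ measurableT ix) (integral_fine _ _ _ measurableT Q2_opt_integrable)).
by rewrite lee_fin lerD2r phi_mu_le.
Qed.

(* Perturbing [phi] by a bounded [f] keeps [Q2] integrable, so duality and Danskin identify the law. *)
Lemma minimizer_test (xi : probability E R) (f : E -> R) (L M : R) : Pcx mu xi ->
    (T2 xi nu <= (fine (\int[mu]_x (phi x)%:E) - fine (\int[nu]_y Q2 phi y))%:E)%E ->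
    0 <= L -> n1_lip L f -> (forall x, `|f x| <= M) ->
  (\int[xi]_x (f x)%:E <= \int[nu]_y (f (T y))%:E)%E.
Proof.
move=> xiP opt L0 lf fM.
have kf := n1_lip_continuous _ _ L0 lf; have qf := n1_lip_quad_growth _ _ L0 lf.
have iQ := Q2_opt_integrable.
have iMe (s : R) : nu.-integrable setT (fun y => Q2 phi y + s%:E)%E.
  by apply: integrableD => //; exact: (finite_measure_integrable_cst nu s).
have iu : nu.-integrable setT (Q2 (fun x => phi x + f x)).
  apply: (integrable_between _ setT _ (fun y => Q2 phi y + (- M)%:E)%E (fun y => Q2 phi y + M%:E)%E) => //.
  - exact: Q2_measurable.
  - move=> y _; rewrite -leeBrDr//; apply: ge_ereal_sup => _ [x _ <-]; rewrite leeBrDr//.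
    apply: le_trans (le_Q2 _ x y); rewrite -EFinD lee_fin.
    by have := fM x; rewrite ler_norml => /andP[? ?]; lra.
  - move=> y _; apply: ge_ereal_sup => _ [x _ <-].
    apply: le_trans (leeD (le_Q2 phi x y) (lexx _)); rewrite -EFinD lee_fin.
    by have := fM x; rewrite ler_norml => /andP[? ?]; lra.
have ixf := integrable_cq xi f xiP.1 kf qf; have ixp := integrable_cq xi phi xiP.1 kphi qphi.
have Ef := integral_fine xi setT _ measurableT ixf; have Ep := integral_fine xi setT _ measurableT ixp.
rewrite [X in (X <= _)%E]Ef.
have [] // := danskin_integral phi nu cphi kphi qphi nu2 smooth_ae iQ f (fine (\int[xi]_x (f x)%:E)%E) kf qf iu.
move=> e e0 e1; have e01 : 0 <= e <= 1 by rewrite (ltW e0).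
have iw : nu.-integrable setT (Q2 (fun x => phi x + e * f x)) by exact: Q2_perturb_integrable.
have [ix J] := integral_comb xi setT _ _ 1 e _ _ measurableT ixp ixf Ep Ef.
have wE : (fun x => phi x + e * f x) = (fun x => 1 * phi x + e * f x).
  by apply/funext => x; rewrite mul1r.
have Ew : (\int[xi]_x (phi x + e * f x)%:E)%E = (1 * fine (\int[xi]_x (phi x)%:E)%E + e * fine (\int[xi]_x (f x)%:E)%E)%:E.
  by rewrite -J; apply: eq_integral => x _; rewrite mul1r.
rewrite -wE in ix.
have EQ := integral_fine nu setT _ measurableT iw.
have := le_trans (weak_duality xi nu _ _ _ ix iw Ew EQ) opt.
rewrite lee_fin (integral_fine nu setT _ measurableT iQ) [X in (_ <= X)%E]EQ -EFinD lee_fin.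
have := phi_mu_le xi xiP; lra.
Qed.

End Optimizer.

Theorem mainTheorem10 (R : realType) (d : nat) (hd : (0 < d)%N)
  (leb : {measure set (d.-tuple R) -> \bar R}) (hleb : is_lebesgue leb)
  (mu nu : probability (d.-tuple R) R)
  (hmu : in_P2 mu) (hnu : in_P2 nu) (hac : abs_cont leb nu)
  (phi : d.-tuple R -> R)
  (hphiA : Acx (fun x => (phi x)%:E)) (hphiC : C_b2 phi)
  (hopt : D2fun mu nu phi =
          ereal_sup [set D2fun mu nu g
                    | g in [set g : d.-tuple R -> R | Acx (fun x => (g x)%:E) /\ S_b2 g]]) :
  let psi := legendre (fun x => (phibar0 phi x)%:E) in
  (convex_expansion leb psi /\ unif_convex psi) /\
  exists xi : probability (d.-tuple R) R,
    (forall A, measurable A -> xi A = pushforward nu (grad psi) A) /\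
    Pcx mu xi /\
    forall xi' : probability (d.-tuple R) R, Pcx mu xi' ->
      (T2 xi nu <= T2 xi' nu)%E /\
      (T2 xi' nu = T2 xi nu -> forall A, measurable A -> xi' A = xi A).
Proof.
move=> psi; have [_ [_ cphi]] := hphiA; have [kphi qphi] := hphiC.
(* Real-valued continuous convex functions of quadratic growth are admissible competitors, and every
   competitor tried is of this kind. *)
have phi_opt (g : d.-tuple R -> R) : econvex (fun x => (g x)%:E) -> continuous_on_Rd g ->
    quad_growth g -> (D2fun mu nu g <= D2fun mu nu phi)%E.
  move=> cg kg qg; rewrite hopt; apply: ereal_sup_ubound; exists g => //; split; split=> //.
  - by split=> //; exists [tuple 0 | i < d].
  - by split=> //; exact: continuous_on_Rd_elsc.
  - exact: continuous_on_Rd_measurable.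
have smooth0 : nu (~` smooth_pt psi) = 0%E.
  exact: (smooth_ae leb mu nu phi hleb hmu hnu hac cphi kphi qphi phi_opt).
split; first split.
- split; first split.
  + split; first exact: psi_neqNy.
    (* If [psi] were [+oo] everywhere there would be no smooth point, although such points have full
       [nu]-measure. *)
    apply: contrapT => H; have S0 : smooth_pt psi = set0.
      apply/seteqP; split=> // y [yfin _]; apply: H; exists y.
      by rewrite lt_eqF.
    by move: smooth0; rewrite S0 setC0 probability_setT => /eqP; rewrite onee_eq0.
  + by split; [exact: psi_elsc|exact: psi_econvex].
  exists (fun x => (phibar0 phi x)%:E); split; last by split=> //; exact: hess_phibar0.
  by split=> //; exists [tuple 0 | i < d].
- exists (fun r => r ^+ 2 / 2); split=> [r r0|x y t t01]; first by rewrite divr_gt0// exprn_gt0.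
  by rewrite sqr_sqrtr ?sqn_ge0//; exact: psi_unif_convex.
have mT : measurable_fun setT (grad psi) := T_measurable phi cphi.
pose T : {mfun (d.-tuple R) >-> (d.-tuple R)} := HB.pack (grad psi) (isMeasurableFun.Build _ _ _ _ _ mT).
pose xi : probability (d.-tuple R) R := distribution nu T.
have xiE A : measurable A -> xi A = pushforward nu (grad psi) A by [].
have xi2 : in_P2 xi.
  exact: (xi_P2 leb mu nu phi hleb hmu hnu hac cphi kphi qphi phi_opt xi xiE).
have xiP : Pcx mu xi.
  by split=> //; exact: (xi_cx leb mu nu phi hleb hmu hnu hac cphi kphi qphi phi_opt xi xiE).
have xi_le := T2_xi_le leb mu nu phi hleb hmu hnu hac cphi kphi qphi phi_opt xi xiE.
exists xi; split=> //; split=> // xi' xi'P; split.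
  apply: le_trans xi_le _; exact: (T2_lower mu nu phi hmu hnu cphi kphi qphi phi_opt xi' xi'P).
move=> T2E; apply: probability_eq_of_lip => f L L0 lf f01.
have opt' := xi_le; rewrite -T2E in opt'.
(* One-sided, and applied below to [f] and to [- f] to obtain equality. *)
have test (g : d.-tuple R -> R) : n1_lip L g -> (forall x, `|g x| <= 1) ->
    (\int[xi']_x (g x)%:E <= \int[xi]_x (g x)%:E)%E.
  move=> lg g1.
  apply: le_trans (minimizer_test leb mu nu phi hleb hmu hnu hac cphi kphi qphi phi_opt xi' g L 1 xi'P opt' L0 lg g1) _.
  have ig := integrable_cq xi g xi2 (n1_lip_continuous _ _ L0 lg) (n1_lip_quad_growth _ _ L0 lg).
  by have [_ ->] := integral_image nu xi (grad psi) mT (fun A mA => esym (xiE A mA)) _ ig.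
have f1 x : `|f x| <= 1 by have /andP[f0 fl] := f01 x; rewrite ger0_norm.
apply/eqP; rewrite eq_le test//=.
have := test (fun x => - f x) _ _.
have intN (m : probability (d.-tuple R) R) : in_P2 m -> (\int[m]_x (- f x)%:E = - \int[m]_x (f x)%:E)%E.
  move=> m2; have im := integrable_cq m f m2 (n1_lip_continuous _ _ L0 lf) (n1_lip_quad_growth _ _ L0 lf).
  have Em := integral_fine m setT _ measurableT im.
  have [_ J] := integral_comb m setT _ _ (-1) 0 _ _ measurableT im im Em Em.
  rewrite (eq_integral (fun x => (-1 * f x + 0 * f x)%:E)); last first.
    by move=> x _; congr (_%:E); ring.
  by rewrite J [in RHS]Em -EFinN; congr (_%:E); ring.
rewrite !intN// ?leeN2; last exact: xi'P.1.
apply=> [x y|x]; last by rewrite normrN.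
by rewrite -opprD normrN; exact: lf.
Qed.
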